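(* Let $\mathbf{C}_0 \in \mathbb{C}^{M \times W}$ be a matrix of rank $R$ (the matrix of Fourier coefficients of the signal ensemble) with coherence $\mu^2(V) \leq \mu^2_0$. Suppose $\Omega$ measurements $\mathbf{y} = \mathcal{A}(\mathbf{C}_0)$ of $\mathbf{C}_0$ are taken using the M-Mux. If \[ \Omega \geq c\beta \left(\mu^2_0 M+W\right)R \log^3(MW), \] for some constant $\beta > 1$, then the minimizer of \[ \min_{\mathbf{C}} \|\mathbf{C}\|_* \quad \text{subject to} \quad \mathbf{y} = \mathcal{A}(\mathbf{C}) \] is unique and equal to $\mathbf{C}_0$ with probability at least $1- O((MW)^{1-\beta})$.
   Context: An ensemble of $M$ real, periodic signals on $[0,1)$, each bandlimited with $W=2B+1$ Fourier coefficients, is represented by the $M\times W$ matrix $\mathbf{C}_0$ whose $m$-th row contains the Fourier coefficients of the $m$-th signal. Let $\mathbf{F}$ be the normalized $\Omega\times\Omega$ DFT matrix with entries $F[\omega,n] = \Omega^{-1/2} e^{-j2\pi\omega n/\Omega}$, $\Omega > W$, let $\tilde{\mathbf{F}}$ be the $W\times\Omega$ matrix formed by its first $W$ rows, and let $\mathbf{f}_\omega$ denote the $\omega$-th column of $\tilde{\mathbf{F}}$. The M-Mux measurement operator $\mathcal{A}:\mathbb{C}^{M\times W}\to\mathbb{R}^\Omega$ is $\mathcal{A}(\mathbf{C}_0) = \sum_{m=1}^M \mathbf{D}_m\tilde{\mathbf{F}}^*\mathbf{c}_m$, where $\mathbf{c}_m^*$ is the $m$-th row of $\mathbf{C}_0$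 and $\mathbf{D}_m$ is an $\Omega\times\Omega$ diagonal matrix with diagonal entries $d_1[m],\dots,d_\Omega[m]$, all $d_\omega[m]$ ($1\le\omega\le\Omega$, $1\le m\le M$) independent and equal to $\pm1$ with probability $1/2$. Equivalently $y[\omega] = \langle \mathbf{C}_0, \mathbf{d}_\omega\mathbf{f}_\omega^*\rangle = \mathrm{tr}(\mathbf{C}_0 \mathbf{f}_\omega\mathbf{d}_\omega^* )$ with $\mathbf{d}_\omega = [d_\omega[1],\dots,d_\omega[M]]^{\mathrm T}$. With the SVD $\mathbf{C}_0 = \mathbf{U}\mathbf{\Sigma}\mathbf{V}^*$ ($\mathbf{V}$ is $W\times R$ with orthonormal columns), the coherence is $\mu^2(V) = \frac{\Omega}{R}\max_{1\le\omega\le\Omega}\|\mathbf{V}^*\mathbf{f}_\omega\|_2^2$. $\|\cdot\|_*$ is the nuclear norm. *)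

(* Defs.v *)
From HB Require Import structures.
From mathcomp Require Import all_boot all_order all_algebra.
From mathcomp Require Import boolp classical_sets reals.
From mathcomp Require Import exp trigo.
From mathcomp Require Import complex.
Set Implicit Arguments. Unset Strict Implicit. Unset Printing Implicit Defensive.
Import Order.TTheory GRing.Theory Num.Theory.
Local Open Scope ring_scope.

Section MMux.
Variable R : realType.
Local Notation C := R[i].

Definition toC (x : R) : C := Complex x 0.

Definition expi (t : R) : C := Complex (cos t) (sin t).

Definition adjmx m n (A : 'M[C]_(m, n)) : 'M[C]_(n, m) := (map_mx (@conjc R) A)^T.

(* tilde F : first W rows of the normalized Omega x Omega DFT matrix,
   F[w, n] = Omega^{-1/2} e^{-j 2 pi w n / Omega}  (0-based indices) *)
Definition Ftilde (W Om : nat) : 'M[C]_(W, Om) :=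
  \matrix_(w < W, n < Om)
    (toC (Num.sqrt (Om%:R))^-1 * expi (- (2 * pi * (w%:R * n%:R) / Om%:R))).

Definition fcol (W Om : nat) (om : 'I_Om) : 'cV[C]_W := col om (Ftilde W Om).

Definition sgnC (b : bool) : C := if b then 1 else -1.

(* M-Mux measurement operator: y[om] = tr(C f_om d_om^* ) *)
Definition Ameas (M W Om : nat) (d : {ffun 'I_Om * 'I_M -> bool})
    (X : 'M[C]_(M, W)) : 'cV[C]_Om :=
  \col_(om < Om) \sum_(m < M) \sum_(w < W)
      X m w * @fcol W Om om w ord0 * sgnC (d (om, m)).

Definition is_svd (M W r : nat) (X : 'M[C]_(M, W)) (U : 'M[C]_(M, r))
    (s : 'rV[R]_r) (V : 'M[C]_(W, r)) : Prop :=
  [/\ adjmx U *m U = 1%:M, adjmx V *m V = 1%:M, (forall i, 0 < s ord0 i)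
    & X = U *m diag_mx (map_mx toC s) *m adjmx V].

Definition nucnorm (M W : nat) (X : 'M[C]_(M, W)) : R :=
  xget 0 [set t | exists r (U : 'M[C]_(M, r)) (s : 'rV[R]_r) (V : 'M[C]_(W, r)),
                    is_svd X U s V /\ t = \sum_(i < r) s ord0 i].

Definition sqnorm n (v : 'cV[C]_n) : R :=
  \sum_(i < n) ((complex.Re (v i ord0)) ^+ 2 + (complex.Im (v i ord0)) ^+ 2).

Definition coherence (W Om r : nat) (V : 'M[C]_(W, r)) : R :=
  (Om%:R / r%:R) * \big[Num.max/0]_(om < Om) sqnorm (adjmx V *m @fcol W Om om).

(* uniform probability over all independent Rademacher sign patterns *)
Definition prob (M Om : nat) (P : {ffun 'I_Om * 'I_M -> bool} -> Prop) : R :=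
  #|[set d : {ffun 'I_Om * 'I_M -> bool} | `[< P d >] ]|%:R
    / #|{: {ffun 'I_Om * 'I_M -> bool}}|%:R.

End MMux.

(* Main.v *)
(* Golfing with disjoint batches.  The columns f_om with om = k mod kap carry
   complex weights w_k, of modulus at most 2 kap, for which
   sum_om w_k(om) f_om f_om^* = 1 exactly; so Z plus the noise
   sum_om w_k(om) (d_om d_om^* - 1) Z f_om f_om^* lies in the range of the
   adjoint of the measurement map.  Starting at Z_0 = U V^*, each stage replaces
   Z by minus the tangent projection of its noise.  The noise is a Rademacher
   chaos of order two: decoupling and the noncommutative Khintchine inequality
   bound its trace moments, and a Plancherel-Polya inequality for the
   trigonometric polynomials n |-> X f_n replaces the sampled sums by full ones.
   Hence with high probability each stage halves both the Frobenius norm and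
   max_om |Z f_om|, while the noise has operator norm at most 2^-k / 4, and
   kap ~ log (M W) stages produce a dual certificate.  Running the same scheme
   from the projected elementary matrices, instead of proving a restricted
   isometry, shows that an H with A(H) = 0 satisfies |P_T H| <= B |P_T^perp H|
   with B polynomial in M W, and this suffices for strict optimality. *)
Require Import Defs.
From mathcomp Require Import all_boot all_order all_algebra.
From mathcomp Require Import boolp classical_sets reals.
From mathcomp Require Import topology normedtype derive sequences exp trigo.
From mathcomp Require Import complex.
From mathcomp Require Import sesquilinear spectral.
From mathcomp Require Import ring lra zify.
Set Implicit Arguments. Unset Strict Implicit. Unset Printing Implicit Defensive.
Import Order.TTheory GRing.Theory Num.Theory.
Local Open Scope ring_scope.

(** Only the signs are random; the frequencies are fixed. A batch therefore cannot be made unbiased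
    by sampling, and its mean has to be arranged by deterministic quadrature. Residue classes serve
    because each of them still spreads over the whole period, and 4 W kap <= Om leaves it enough
    nodes for the 2 W - 1 frequencies occurring in f f^* . Two sizes of Z are followed because the
    noise has two matrix variances: one is bounded through the Frobenius norm, the other through
    max_om |Z f_om|. The projected elementary matrices need not be incoherent, so only their
    Frobenius norm is followed. All variances are multiples of kap T, where T = M rho2 + r W / Om
    and rho2 = max_om |V^* f_om|^2. A moment of order P closes a stage once kap P T is below an
    absolute constant. The union bound runs over all frequencies, and Om is not bounded in terms of
    M W; so P is taken as large as this constraint permits. For given M and W it then grows at least
    linearly in Om, and exp (- P) absorbs the factor Om. *)

(** * Complex matrices: squared moduli, Frobenius norm, operator bounds *)

Section ComplexMatrices.
Variable R : realType.
Local Notation C := R[i].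
Local Notation toC := (@toC R).

(** Squared modulus with values in [R]: squares keep every estimate in the real field and free of
    roots. *)
Definition nsq (z : C) : R := complex.Re z ^+ 2 + complex.Im z ^+ 2.

Lemma toCE x : toC x = real_complex R x. Proof. by []. Qed.
Lemma toC_inj : injective toC. Proof. by move=> x y []. Qed.
Lemma toCM x y : toC (x * y) = toC x * toC y. Proof. exact: (rmorphM (real_complex R)). Qed.
Lemma toC_sum I (r : seq I) (P : pred I) (F : I -> R) :
  toC (\sum_(i <- r | P i) F i) = \sum_(i <- r | P i) toC (F i).
Proof. exact: (rmorph_sum (real_complex R)). Qed.

Lemma ReD (x y : C) : complex.Re (x + y) = complex.Re x + complex.Re y.
Proof. by case: x y => [a b] [c d]. Qed.
Lemma ReN (x : C) : complex.Re (- x) = - complex.Re x.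
Proof. by case: x. Qed.
Lemma Re_sum I (r : seq I) (P : pred I) (F : I -> C) :
  complex.Re (\sum_(i <- r | P i) F i) = \sum_(i <- r | P i) complex.Re (F i).
Proof. by apply: (big_morph _ ReD). Qed.
Lemma ReZ t (x : C) : complex.Re (toC t * x) = t * complex.Re x.
Proof. by case: x => a b /=; rewrite mul0r subr0. Qed.
Lemma ReJ (x : C) : complex.Re (conjc x) = complex.Re x.
Proof. by case: x. Qed.

Lemma nsqE z : toC (nsq z) = conjc z * z.
Proof.
case: z => a b; rewrite /nsq /toC /=; apply/eqP; rewrite eq_complex /=.
by apply/andP; split; apply/eqP; ring.
Qed.

Lemma nsq_ge0 z : 0 <= nsq z.
Proof. by rewrite addr_ge0 ?sqr_ge0. Qed.
Lemma nsqM x y : nsq (x * y) = nsq x * nsq y.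
Proof. case: x y => [a b] [c d]; rewrite /nsq /=; ring. Qed.
Lemma nsqN x : nsq (- x) = nsq x.
Proof. case: x => [a b]; rewrite /nsq /=; ring. Qed.
Lemma nsqJ x : nsq (conjc x) = nsq x.
Proof. case: x => [a b]; rewrite /nsq /=; ring. Qed.
Lemma nsq_toC x : nsq (toC x) = x ^+ 2.
Proof. by rewrite /nsq /=; ring. Qed.
Lemma nsq0 : nsq 0 = 0. Proof. by rewrite (nsq_toC 0) expr0n. Qed.
Lemma nsq1 : nsq 1 = 1. Proof. by rewrite (nsq_toC 1) expr1n. Qed.
Lemma nsq_eq0 z : (nsq z == 0) = (z == 0).
Proof.
case: z => a b; rewrite /nsq eq_complex /= paddr_eq0 ?sqr_ge0 //.
by rewrite !sqrf_eq0.
Qed.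

Lemma adjmxE m n (A : 'M[C]_(m, n)) i j : adjmx A i j = conjc (A j i).
Proof. by rewrite !mxE. Qed.
Lemma adjmxK m n (A : 'M[C]_(m, n)) : adjmx (adjmx A) = A.
Proof. by apply/matrixP=> i j; rewrite !adjmxE conjcK. Qed.
Lemma adjmxM m n p (A : 'M[C]_(m, n)) (B : 'M[C]_(n, p)) :
  adjmx (A *m B) = adjmx B *m adjmx A.
Proof. by rewrite /adjmx map_mxM trmx_mul. Qed.
Lemma adjmxD m n (A B : 'M[C]_(m, n)) : adjmx (A + B) = adjmx A + adjmx B.
Proof. by rewrite /adjmx map_mxD linearD. Qed.
Lemma adjmxN m n (A : 'M[C]_(m, n)) : adjmx (- A) = - adjmx A.
Proof. by rewrite /adjmx map_mxN linearN. Qed.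
Lemma adjmxB m n (A B : 'M[C]_(m, n)) : adjmx (A - B) = adjmx A - adjmx B.
Proof. by rewrite adjmxD adjmxN. Qed.
Lemma adjmxZ m n c (A : 'M[C]_(m, n)) : adjmx (c *: A) = conjc c *: adjmx A.
Proof. by rewrite /adjmx map_mxZ linearZ. Qed.
Lemma adjmx1 n : adjmx (1%:M : 'M[C]_n) = 1%:M.
Proof. by rewrite /adjmx map_mx1 trmx1. Qed.
Lemma adjmx0 m n : adjmx (0 : 'M[C]_(m, n)) = 0.
Proof. by rewrite /adjmx map_mx0 trmx0. Qed.
Lemma adjmx_sum m n I (r : seq I) (P : pred I) (F : I -> 'M[C]_(m, n)) :
  adjmx (\sum_(i <- r | P i) F i) = \sum_(i <- r | P i) adjmx (F i).
Proof. apply: (big_morph (@adjmx R m n) (@adjmxD m n) (@adjmx0 m n)). Qed.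

Lemma tr_adjmx n (A : 'M[C]_n) : \tr (adjmx A) = conjc (\tr A).
Proof. by rewrite /adjmx mxtrace_tr trace_map_mx. Qed.

(** Squared Frobenius norm; on columns, the squared Euclidean norm. *)
Definition fn2 m n (A : 'M[C]_(m, n)) : R := \sum_i \sum_j nsq (A i j).

(** Real part of the Hilbert-Schmidt inner product, the pairing used for convexity arguments. *)
Definition rip m n (A B : 'M[C]_(m, n)) : R := complex.Re (\tr (adjmx A *m B)).

Lemma fn2E m n (A : 'M[C]_(m, n)) : \tr (adjmx A *m A) = toC (fn2 A).
Proof.
rewrite /mxtrace /fn2 toC_sum.
under eq_bigr do rewrite mxE.
rewrite exchange_big /=; apply: eq_bigr => i _; rewrite toC_sum.
by apply: eq_bigr => j _; rewrite adjmxE nsqE.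
Qed.

Lemma ripE m n (A : 'M[C]_(m, n)) : rip A A = fn2 A.
Proof. by rewrite /rip fn2E. Qed.

Lemma fn2_ge0 m n (A : 'M[C]_(m, n)) : 0 <= fn2 A.
Proof. by apply: sumr_ge0 => i _; apply: sumr_ge0 => j _; apply: nsq_ge0. Qed.

Lemma fn2_0 m n : fn2 (0 : 'M[C]_(m, n)) = 0.
Proof. by apply: big1 => i _; apply: big1 => j _; rewrite mxE nsq0. Qed.

Lemma fn2_eq0 m n (A : 'M[C]_(m, n)) : fn2 A = 0 -> A = 0.
Proof.
move=> /eqP; rewrite psumr_eq0 => [/allP h|i _]; last first.
  by apply: sumr_ge0 => j _; apply: nsq_ge0.
apply/matrixP => i j; move: (h i); rewrite mem_index_enum => /(_ isT) /=.
rewrite psumr_eq0 => [/allP h'|k _]; last exact: nsq_ge0.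
by move: (h' j); rewrite mem_index_enum => /(_ isT) /=; rewrite nsq_eq0 mxE => /eqP.
Qed.

Lemma fn2_adj m n (A : 'M[C]_(m, n)) : fn2 (adjmx A) = fn2 A.
Proof.
rewrite /fn2 exchange_big; apply: eq_bigr => i _; apply: eq_bigr => j _.
by rewrite adjmxE nsqJ.
Qed.

Lemma fn2Z m n c (A : 'M[C]_(m, n)) : fn2 (c *: A) = nsq c * fn2 A.
Proof.
rewrite /fn2 mulr_sumr; apply: eq_bigr => i _; rewrite mulr_sumr.
by apply: eq_bigr => j _; rewrite mxE nsqM.
Qed.

Lemma fn2N m n (A : 'M[C]_(m, n)) : fn2 (- A) = fn2 A.
Proof. by rewrite -scaleN1r fn2Z nsqN nsq1 mul1r. Qed.

Lemma fn2_col n (A : 'cV[C]_n) : fn2 A = \sum_i nsq (A i ord0).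
Proof. by apply: eq_bigr => i _; rewrite big_ord1. Qed.

Lemma sqnormE n (v : 'cV[C]_n) : sqnorm v = fn2 v.
Proof. by rewrite fn2_col. Qed.

Lemma fn2_cols m n (A : 'M[C]_(m, n)) : fn2 A = \sum_j fn2 (col j A).
Proof.
rewrite /fn2 exchange_big; apply: eq_bigr => j _; apply: eq_bigr => i _.
by rewrite big_ord1 mxE.
Qed.

Lemma ripDl m n (A B D : 'M[C]_(m, n)) : rip (A + B) D = rip A D + rip B D.
Proof. by rewrite /rip adjmxD mulmxDl linearD ReD. Qed.
Lemma ripDr m n (A B D : 'M[C]_(m, n)) : rip D (A + B) = rip D A + rip D B.
Proof. by rewrite /rip mulmxDr linearD ReD. Qed.
Lemma ripNl m n (A D : 'M[C]_(m, n)) : rip (- A) D = - rip A D.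
Proof. by rewrite /rip adjmxN mulNmx linearN ReN. Qed.
Lemma ripNr m n (A D : 'M[C]_(m, n)) : rip D (- A) = - rip D A.
Proof. by rewrite /rip mulmxN linearN ReN. Qed.
Lemma ripBl m n (A B D : 'M[C]_(m, n)) : rip (A - B) D = rip A D - rip B D.
Proof. by rewrite ripDl ripNl. Qed.
Lemma ripBr m n (A B D : 'M[C]_(m, n)) : rip D (A - B) = rip D A - rip D B.
Proof. by rewrite ripDr ripNr. Qed.
Lemma rip0l m n (D : 'M[C]_(m, n)) : rip 0 D = 0.
Proof. by rewrite /rip adjmx0 mul0mx linear0. Qed.
Lemma rip0r m n (D : 'M[C]_(m, n)) : rip D 0 = 0.
Proof. by rewrite /rip mulmx0 linear0. Qed.
Lemma ripC m n (A B : 'M[C]_(m, n)) : rip A B = rip B A.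
Proof. by rewrite /rip -ReJ -tr_adjmx adjmxM adjmxK. Qed.
Lemma ripZr m n t (A B : 'M[C]_(m, n)) : rip A (toC t *: B) = t * rip A B.
Proof. by rewrite /rip -scalemxAr linearZ ReZ. Qed.
Lemma rip_sumr m n I (r : seq I) (P : pred I) (F : I -> 'M[C]_(m, n)) D :
  rip D (\sum_(i <- r | P i) F i) = \sum_(i <- r | P i) rip D (F i).
Proof. apply: (big_morph (rip D) (fun x y => ripDr x y D) (rip0r D)). Qed.
Lemma rip_suml m n I (r : seq I) (P : pred I) (F : I -> 'M[C]_(m, n)) D :
  rip (\sum_(i <- r | P i) F i) D = \sum_(i <- r | P i) rip (F i) D.
Proof. by rewrite ripC rip_sumr; apply: eq_bigr => i _; rewrite ripC. Qed.

Lemma rip_mull m n p (A : 'M[C]_(m, n)) (B : 'M[C]_(n, p)) D :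
  rip (A *m B) D = rip B (adjmx A *m D).
Proof. by rewrite /rip adjmxM mulmxA. Qed.
Lemma rip_mulr m n p (A : 'M[C]_(m, n)) (B : 'M[C]_(n, p)) D :
  rip (A *m B) D = rip A (D *m adjmx B).
Proof. by rewrite /rip adjmxM -mulmxA mxtrace_mulC mulmxA. Qed.

Lemma fn2D m n (A B : 'M[C]_(m, n)) :
  fn2 (A + B) = fn2 A + 2 * rip A B + fn2 B.
Proof. rewrite -!ripE ripDl !ripDr (ripC B A); ring. Qed.

Lemma rip_CS m n (A B : 'M[C]_(m, n)) : rip A B ^+ 2 <= fn2 A * fn2 B.
Proof.
have h t : 0 <= fn2 A + 2 * t * rip A B + t ^+ 2 * fn2 B.
  have := fn2_ge0 (A + toC t *: B).
  by rewrite fn2D ripZr fn2Z nsq_toC mulrA.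
have [B0|B0] := eqVneq (fn2 B) 0.
  by rewrite (fn2_eq0 B0) rip0r fn2_0 mulr0 expr0n.
have Bp : 0 < fn2 B by rewrite lt_neqAle eq_sym B0 fn2_ge0.
have := h (- rip A B / fn2 B).
have -> : fn2 A + 2 * (- rip A B / fn2 B) * rip A B + (- rip A B / fn2 B) ^+ 2 * fn2 B
  = (fn2 A * fn2 B - rip A B ^+ 2) / fn2 B by field.
by rewrite pmulr_lge0 ?invr_gt0 // subr_ge0.
Qed.

Lemma rip_le m n (A B : 'M[C]_(m, n)) a b : 0 <= a -> 0 <= b ->
  fn2 A <= a ^+ 2 -> fn2 B <= b ^+ 2 -> `|rip A B| <= a * b.
Proof.
move=> a0 b0 hA hB; rewrite -ler_sqr ?nnegrE ?mulr_ge0 // real_normK ?num_real //.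
apply: le_trans (rip_CS A B) _; rewrite exprMn.
by apply: ler_pM => //; apply: fn2_ge0.
Qed.

Lemma fn2_triangle m n (A B : 'M[C]_(m, n)) a b : 0 <= a -> 0 <= b ->
  fn2 A <= a ^+ 2 -> fn2 B <= b ^+ 2 -> fn2 (A + B) <= (a + b) ^+ 2.
Proof.
move=> a0 b0 hA hB; rewrite fn2D; have := rip_le a0 b0 hA hB.
by rewrite ler_norml => /andP[_ h]; rewrite sqrrD; lra.
Qed.

Lemma fn2D_le m n (A B : 'M[C]_(m, n)) : fn2 (A + B) <= 2 * fn2 A + 2 * fn2 B.
Proof.
have := fn2_ge0 (A - B); rewrite !fn2D ripNr fn2N; lra.
Qed.

Lemma fn2_sum_triangle m n (I : finType) (F : I -> 'M[C]_(m, n)) (a : I -> R) :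
  (forall i, 0 <= a i) -> (forall i, fn2 (F i) <= a i ^+ 2) ->
  fn2 (\sum_i F i) <= (\sum_i a i) ^+ 2.
Proof.
move=> a0 h; suff [] : 0 <= \sum_i a i /\ fn2 (\sum_i F i) <= (\sum_i a i) ^+ 2 by [].
apply: (big_ind2 (fun x y => 0 <= y /\ fn2 x <= y ^+ 2)) => //.
  by rewrite fn2_0 expr0n.
by move=> x1 x2 y1 y2 [? ?] [? ?]; split; [apply: addr_ge0|apply: fn2_triangle].
Qed.

(** Operator norm at most the square root of [t], stated as a predicate so that no supremum has to
    be formed. *)
Definition opb m n (t : R) (A : 'M[C]_(m, n)) :=
  forall x : 'cV[C]_n, fn2 (A *m x) <= t * fn2 x.

Lemma opb_mul m n p t (A : 'M[C]_(m, n)) (B : 'M[C]_(n, p)) :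
  opb t A -> fn2 (A *m B) <= t * fn2 B.
Proof.
move=> h; rewrite !fn2_cols mulr_sumr; apply: ler_sum => j _.
by rewrite colE -mulmxA -colE.
Qed.

(** For [y = A^* x] one has |y|^2 = <x, A y>; after Cauchy-Schwarz one factor |y|^2 cancels. *)
Lemma opb_adj m n t (A : 'M[C]_(m, n)) : 0 <= t -> opb t A -> opb t (adjmx A).
Proof.
move=> t0 h x; set y := adjmx A *m x.
have [->|y0] := eqVneq (fn2 y) 0; first by rewrite mulr_ge0 ?fn2_ge0.
have yp : 0 < fn2 y by rewrite lt_neqAle eq_sym y0 fn2_ge0.
have e : fn2 y = rip x (A *m y) by rewrite -ripE {1}/y rip_mull adjmxK.
rewrite -(ler_pM2l yp) -expr2 {1}e.
apply: le_trans (rip_CS _ _) _.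
rewrite [leRHS]mulrA [leRHS]mulrC (mulrC (fn2 y)).
by apply: ler_wpM2l; rewrite ?fn2_ge0.
Qed.

Lemma opb_mulr m n p t (A : 'M[C]_(m, n)) (B : 'M[C]_(p, m)) :
  0 <= t -> opb t A -> fn2 (B *m A) <= t * fn2 B.
Proof.
move=> t0 h; rewrite -fn2_adj adjmxM -(fn2_adj B).
by apply: opb_mul; apply: opb_adj.
Qed.

Lemma fn2_outer m n (x : 'cV[C]_m) (y : 'cV[C]_n) :
  fn2 (x *m adjmx y) = fn2 x * fn2 y.
Proof.
rewrite (fn2_col x) mulr_suml; apply: eq_bigr => i _.
rewrite fn2_col mulr_sumr; apply: eq_bigr => j _.
by rewrite mxE big_ord1 adjmxE nsqM nsqJ.
Qed.

Lemma opb_fn2 m n (A : 'M[C]_(m, n)) : opb (fn2 A) A.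
Proof.
move=> x; set y := A *m x.
have [->|y0] := eqVneq (fn2 y) 0; first by rewrite mulr_ge0 ?fn2_ge0.
have yp : 0 < fn2 y by rewrite lt_neqAle eq_sym y0 fn2_ge0.
have e : fn2 y = rip A (y *m adjmx x) by rewrite -ripE {1}/y rip_mulr.
rewrite -(ler_pM2l yp) -expr2 {1}e.
apply: le_trans (rip_CS _ _) _.
by rewrite fn2_outer mulrCA.
Qed.

Lemma fn2M m n p (A : 'M[C]_(m, n)) (B : 'M[C]_(n, p)) :
  fn2 (A *m B) <= fn2 A * fn2 B.
Proof. by apply: opb_mul; apply: opb_fn2. Qed.

Lemma fn2_isom m n p (U : 'M[C]_(m, n)) (A : 'M[C]_(n, p)) :
  adjmx U *m U = 1%:M -> fn2 (U *m A) = fn2 A.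
Proof. by move=> h; rewrite -!ripE rip_mull mulmxA h mul1mx. Qed.

Lemma opb_isom m n (U : 'M[C]_(m, n)) : adjmx U *m U = 1%:M -> opb 1 U.
Proof. by move=> h x; rewrite fn2_isom // mul1r. Qed.

Lemma opb_isom_adj m n (U : 'M[C]_(m, n)) :
  adjmx U *m U = 1%:M -> opb 1 (adjmx U).
Proof. by move=> h; apply: opb_adj => //; apply: opb_isom. Qed.

Lemma fn2_orthoproj m n p (U : 'M[C]_(m, n)) (A : 'M[C]_(m, p)) :
  adjmx U *m U = 1%:M ->
  fn2 A = fn2 (adjmx U *m A) + fn2 (A - U *m (adjmx U *m A)).
Proof.
move=> h; rewrite [fn2 (A - _)]fn2D fn2N ripNr (fn2_isom _ h).
rewrite (ripC A) rip_mull ripE; ring.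
Qed.

Lemma opb_compl m n (U : 'M[C]_(m, n)) :
  adjmx U *m U = 1%:M -> opb 1 (1%:M - U *m adjmx U).
Proof.
move=> h x; rewrite mulmxBl mul1mx mul1r -mulmxA (fn2_orthoproj x h).
by rewrite lerDr fn2_ge0.
Qed.

Lemma opbM m n p s t (A : 'M[C]_(m, n)) (B : 'M[C]_(n, p)) : 0 <= s ->
  opb s A -> opb t B -> opb (s * t) (A *m B).
Proof.
move=> s0 hA hB x; rewrite -mulmxA; apply: le_trans (hA _) _.
by rewrite -mulrA; apply: ler_wpM2l.
Qed.

Lemma nsqD_le (x y : C) : nsq (x + y) <= 2 * nsq x + 2 * nsq y.
Proof.
case: x y => [a b] [c d]; rewrite /nsq /=.
have := sqr_ge0 (a - c); have := sqr_ge0 (b - d); nra.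
Qed.
End ComplexMatrices.

(** * Singular value decomposition and nuclear norm duality *)

Section NuclearNorm.
Variable R : realType.
Local Notation C := R[i].
Local Notation toC := (@toC R).

Definition rdiag n (l : 'rV[R]_n) : 'M[C]_n := diag_mx (map_mx toC l).

Lemma rdiagE n (l : 'rV[R]_n) i j : rdiag l i j = toC (l ord0 j) *+ (i == j).
Proof. by rewrite !mxE; case: eqP => [->|]. Qed.

Lemma adjmx_rdiag n (l : 'rV[R]_n) : adjmx (rdiag l) = rdiag l.
Proof.
apply/matrixP => i j; rewrite adjmxE !rdiagE (eq_sym j).
by case: eqP => [->|_]; rewrite ?mulr0n ?conjc0 // !mulr1n conjc_real.
Qed.

Lemma herm_spectral n (X : 'M[C]_n) : adjmx X = X ->
  exists (P : 'M[C]_n) (l : 'rV[R]_n),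
    [/\ adjmx P *m P = 1%:M, P *m adjmx P = 1%:M
      & X = P *m rdiag l *m adjmx P].
Proof.
move=> hX.
have adjT m p (A : 'M[C]_(m, p)) : map_mx Num.conj A^T = adjmx A.
  by apply/matrixP => i j; rewrite !mxE.
have herm : X \is hermsymmx.
  by apply/is_hermitianmxP; rewrite expr0 scale1r adjT hX.
have /orthomx_spectralP eX := hermitian_normalmx herm.
have /mxOverP lr := hermitian_spectral_diag_real herm.
have PU := spectral_unitarymx X.
move: eX; rewrite (invmx_unitary PU) adjT => eX.
move/unitarymxP: (PU); rewrite adjT => PU1.
exists (adjmx (spectralmx X)), (map_mx (@complex.Re R) (spectral_diag X)).
rewrite adjmxK; split; [exact: PU1|exact: mulmx1C PU1|].
rewrite {1}eX; congr (_ *m diag_mx _ *m _).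
apply/rowP => i; rewrite !mxE.
by rewrite [RHS](RRe_real (lr ord0 i)).
Qed.

(** Diagonalise X^* X, keep the eigenvectors [V] of positive eigenvalues, and normalise the columns
    of X V to obtain the left factor. *)
Lemma svd_exists M W (X : 'M[C]_(M, W)) :
  exists r (U : 'M[C]_(M, r)) (s : 'rV[R]_r) (V : 'M[C]_(W, r)), is_svd X U s V.
Proof.
have [|P [l [P1 P2 eX]]] := @herm_spectral _ (adjmx X *m X).
  by rewrite adjmxM adjmxK.
have XP i j : (adjmx (X *m P) *m (X *m P)) i j = toC (l ord0 j) *+ (i == j).
  rewrite adjmxM -mulmxA (mulmxA (adjmx X)) eX -!mulmxA P1 mulmx1.
  by rewrite mulmxA P1 mul1mx rdiagE.
have fl i : fn2 (col i (X *m P)) = l ord0 i.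
  apply: toC_inj; rewrite -fn2E /mxtrace big_ord1 mxE.
  have := XP i i; rewrite eqxx mulr1n => <-; rewrite mxE; apply: eq_bigr => k _.
  by rewrite !adjmxE !mxE.
pose B := [set i | 0 < l ord0 i]; pose r := #|B|.
pose V : 'M[C]_(W, r) := \matrix_(i, j) P i (enum_val j).
pose s : 'rV[R]_r := \row_j Num.sqrt (l ord0 (enum_val j)).
have lp (j : 'I_r) : 0 < l ord0 (enum_val j) by have := enum_valP j; rewrite inE.
have sp i : 0 < s ord0 i by rewrite mxE sqrtr_gt0.
pose si : 'rV[R]_r := \row_j (s ord0 j)^-1.
have ssi : rdiag si *m rdiag s = 1%:M.
  rewrite /rdiag mulmx_diag; apply/matrixP => i j; rewrite !mxE.
  case: eqP => // ->; rewrite !mulr1n -toCM mulVf ?mxE //.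
  by have := sp j; rewrite mxE => /lt0r_neq0.
exists r, (X *m V *m rdiag si), s, V.
have XV i j : (adjmx (X *m V) *m (X *m V)) i j = toC (l ord0 (enum_val j)) *+ (i == j).
  have -> : (i == j) = (enum_val i == enum_val j) by rewrite (inj_eq enum_val_inj).
  rewrite -XP !mxE; apply: eq_bigr => k _; rewrite !adjmxE !mxE.
  by congr (conjc _ * _); apply: eq_bigr => a _; rewrite mxE.
split => //.
- rewrite adjmxM adjmx_rdiag -mulmxA (mulmxA (adjmx _)).
  have -> : adjmx (X *m V) *m (X *m V) = rdiag s *m rdiag s.
    rewrite /rdiag mulmx_diag; apply/matrixP => i j; rewrite XV !mxE.
    case: eqP => // ->; rewrite !mulr1n -toCM -expr2 sqr_sqrtr //.
    exact/ltW/lp.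
  rewrite !mulmxA ssi mul1mx.
  have -> : rdiag s *m rdiag si = rdiag si *m rdiag s.
    by rewrite /rdiag !mulmx_diag; congr diag_mx; apply/rowP => i; rewrite !mxE mulrC.
  by rewrite ssi.
- apply/matrixP => i j; move/matrixP: P1 => /(_ (enum_val i) (enum_val j)).
  rewrite !mxE (inj_eq enum_val_inj) => <-; apply: eq_bigr => k _.
  by rewrite !adjmxE !mxE.
rewrite -[map_mx _ _]/(map_mx toC s) -/(rdiag s) -!mulmxA (mulmxA (rdiag _)) ssi mul1mx.
have -> : V *m adjmx V = \matrix_(i, j) \sum_(k in B) P i k * conjc (P j k).
  apply/matrixP => i j; rewrite !mxE [RHS]big_enum_val.
  by apply: eq_bigr => k _; rewrite adjmxE !mxE.
apply/matrixP => i j; rewrite !mxE.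
have -> : X i j = (X *m (P *m adjmx P)) i j by rewrite P2 mulmx1.
rewrite mulmxA !mxE.
under [RHS]eq_bigr => a _ do rewrite mxE mulr_sumr.
rewrite [RHS]exchange_big /=.
(* Outside [B] the eigenvalue is at most 0, yet it is the squared norm of a column of X P; that
   column vanishes and drops out of the sum. *)
rewrite (bigID (mem B)) /= [X in _ + X]big1 ?addr0 => [|k]; last first.
  rewrite inE -leNgt => lk.
  have : col k (X *m P) = 0.
    by apply: fn2_eq0; apply/eqP; rewrite eq_le fn2_ge0 fl lk.
  by move/matrixP/(_ i ord0); rewrite !mxE => ->; rewrite mul0r.
apply: eq_bigr => k _; rewrite !adjmxE mxE mulr_suml.
by apply: eq_bigr => a _; rewrite mulrA.
Qed.

(** Trace duality: <Q, X> is the sum of s_i times the real part of the i-th diagonal entry of U^* Q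
    V, and no entry of that matrix exceeds the norm of Q. *)
Lemma rip_svd_le M W r (X Q : 'M[C]_(M, W)) (U : 'M[C]_(M, r)) s V t :
  is_svd X U s V -> 0 <= t -> opb (t ^+ 2) Q -> rip Q X <= t * \sum_i s ord0 i.
Proof.
move=> [hU hV sp ->] t0 hQ.
rewrite -mulmxA ripC rip_mull ripC -(adjmxK (_ *m adjmx V)) adjmxM adjmxK.
rewrite -[map_mx _ _]/(map_mx toC s) -/(rdiag s) adjmx_rdiag.
have -> : adjmx (V *m rdiag s) = rdiag s *m adjmx V by rewrite adjmxM adjmx_rdiag.
rewrite ripC rip_mulr.
set D := adjmx U *m Q *m _.
have hD i : `|complex.Re (D i i)| <= t.
  rewrite -ler_sqr ?nnegrE // real_normK ?num_real //.
  apply: (@le_trans _ _ (nsq (D i i))); first by rewrite /nsq lerDl sqr_ge0.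
  apply: (@le_trans _ _ (fn2 (D *m delta_mx i ord0 : 'cV_r))).
    rewrite -colE fn2_col (bigD1 i) //= [col _ _ _ _]mxE lerDl.
    by apply: sumr_ge0 => j _; apply: nsq_ge0.
  rewrite /D -!mulmxA; apply: le_trans (opb_mul _ (opb_isom_adj hU)) _.
  rewrite mul1r; apply: le_trans (opb_mul _ hQ) _.
  rewrite adjmxK fn2_isom // ler_piMr ?sqr_ge0 // fn2_col (bigD1 i) //=.
  rewrite mxE !eqxx nsq1 big1 ?addr0 // => j ji.
  by rewrite mxE (negPf ji) nsq0.
rewrite /rip adjmx_rdiag /mxtrace Re_sum mulr_sumr.
apply: ler_sum => i _; rewrite mxE (bigD1 i) //= big1 ?addr0; last first.
  by move=> j ji; rewrite rdiagE eq_sym (negPf ji) mulr0n mul0r.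
rewrite rdiagE eqxx mulr1n ReZ mulrC ler_pM2r //.
by have := hD i; rewrite ler_norml => /andP[].
Qed.

Lemma opb_UV M W r (U : 'M[C]_(M, r)) (V : 'M[C]_(W, r)) :
  adjmx U *m U = 1%:M -> adjmx V *m V = 1%:M -> opb 1 (U *m adjmx V).
Proof.
move=> hU hV; rewrite -[1]mulr1; apply: opbM => //; first exact: opb_isom.
exact: opb_isom_adj.
Qed.

Lemma rip_svd_eq M W r (X : 'M[C]_(M, W)) (U : 'M[C]_(M, r)) s V :
  is_svd X U s V -> rip (U *m adjmx V) X = \sum_i s ord0 i.
Proof.
move=> [hU hV sp ->].
rewrite rip_mulr adjmxK -mulmxA hV mulmx1 ripC rip_mull hU /rip adjmx_rdiag mulmx1.
rewrite /mxtrace Re_sum; apply: eq_bigr => i _.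
by rewrite rdiagE eqxx.
Qed.

(** [nucnorm] picks some decomposition by choice, so independence of the choice is needed. The
    contraction U V^* of either decomposition attains its own sum, and by duality neither sum
    exceeds the other. *)
Lemma nucnormE M W r (X : 'M[C]_(M, W)) (U : 'M[C]_(M, r)) s V :
  is_svd X U s V -> nucnorm X = \sum_i s ord0 i.
Proof.
move=> h; rewrite /nucnorm; case: xgetP => [t _ [r' [U' [s' [V' [h' ->]]]]]|/(_ (\sum_i s ord0 i))].
  apply/eqP; rewrite eq_le; apply/andP; split.
    rewrite -(rip_svd_eq h') -[leRHS]mul1r; apply: (rip_svd_le h) => //.
    by case: h' => ? ? _ _; rewrite expr1n; apply: opb_UV.
  rewrite -(rip_svd_eq h) -[leRHS]mul1r; apply: (rip_svd_le h') => //.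
  by case: h => ? ? _ _; rewrite expr1n; apply: opb_UV.
by case; exists r, U, s, V.
Qed.

Lemma rip_nucnorm_le M W (X Q : 'M[C]_(M, W)) : opb 1 Q -> rip Q X <= nucnorm X.
Proof.
move=> hQ; have [r [U [s [V h]]]] := svd_exists X.
rewrite (nucnormE h) -[leRHS]mul1r; apply: (rip_svd_le h) => //.
by rewrite expr1n.
Qed.

Lemma fn2_svd_le M W r (X : 'M[C]_(M, W)) (U : 'M[C]_(M, r)) s V :
  is_svd X U s V -> fn2 X <= (\sum_i s ord0 i) ^+ 2.
Proof.
move=> [hU hV sp ->]; rewrite -mulmxA fn2_isom //.
rewrite -fn2_adj adjmxM adjmxK fn2_isom // fn2_adj.
have -> : fn2 (diag_mx (map_mx toC s)) = \sum_i s ord0 i ^+ 2.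
  apply: eq_bigr => i _; rewrite (bigD1 i) //= big1 ?addr0 => [|j ji].
    by rewrite !mxE eqxx mulr1n nsq_toC.
  by rewrite !mxE eq_sym (negPf ji) mulr0n nsq0.
rewrite expr2 mulr_suml; apply: ler_sum => i _; rewrite expr2 ler_pM2l //.
rewrite (bigD1 i) //= lerDl; apply: sumr_ge0 => j _; exact: ltW.
Qed.
End NuclearNorm.

(** * Tangent space and inexact dual certificate *)

Section DualCertificate.
Variable R : realType.
Local Notation C := R[i].
Local Notation toC := (@toC R).
Variables (M W r : nat) (U : 'M[C]_(M, r)) (V : 'M[C]_(W, r)).
Hypotheses (hU : adjmx U *m U = 1%:M) (hV : adjmx V *m V = 1%:M).

Definition cproj m (A : 'M[C]_(m, r)) : 'M[C]_m := 1%:M - A *m adjmx A.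

(* [PTp] is the projection onto the orthogonal complement of the tangent space
   [T = {U X + Y V^*}], [PT] the projection onto [T]. *)
Definition PTp (X : 'M[C]_(M, W)) := cproj U *m X *m cproj V.
Definition PT (X : 'M[C]_(M, W)) := X - PTp X.

Lemma cproj_adj m (A : 'M[C]_(m, r)) : adjmx (cproj A) = cproj A.
Proof. by rewrite adjmxB adjmx1 adjmxM adjmxK. Qed.
Lemma cproj_ann m (A : 'M[C]_(m, r)) : adjmx A *m A = 1%:M -> cproj A *m A = 0.
Proof. by move=> h; rewrite mulmxBl mul1mx -mulmxA h mulmx1 subrr. Qed.
Lemma cproj_annl m (A : 'M[C]_(m, r)) :
  adjmx A *m A = 1%:M -> adjmx A *m cproj A = 0.
Proof. by move=> h; rewrite mulmxBr mulmx1 mulmxA h mul1mx subrr. Qed.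
Lemma cproj_idem m (A : 'M[C]_(m, r)) :
  adjmx A *m A = 1%:M -> cproj A *m cproj A = cproj A.
Proof.
by move=> h; rewrite {2}/cproj mulmxBr mulmx1 mulmxA cproj_ann // mul0mx subr0.
Qed.

Lemma PTpD X Y : PTp (X + Y) = PTp X + PTp Y.
Proof. by rewrite /PTp (mulmxDr (cproj U)) mulmxDl. Qed.
Lemma PTpN X : PTp (- X) = - PTp X.
Proof. by rewrite /PTp mulmxN mulNmx. Qed.
Lemma PTpB X Y : PTp (X - Y) = PTp X - PTp Y.
Proof. by rewrite PTpD PTpN. Qed.
Lemma PTp0 : PTp 0 = 0.
Proof. by rewrite /PTp mulmx0 mul0mx. Qed.
Lemma PTp_sum I (s : seq I) (P : pred I) (F : I -> 'M[C]_(M, W)) :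
  PTp (\sum_(i <- s | P i) F i) = \sum_(i <- s | P i) PTp (F i).
Proof. apply: (big_morph PTp PTpD PTp0). Qed.
Lemma PTp_idem X : PTp (PTp X) = PTp X.
Proof.
by rewrite /PTp -!mulmxA (cproj_idem hV) (mulmxA (cproj U)) (cproj_idem hU).
Qed.
Lemma rip_PTp X Y : rip (PTp X) Y = rip X (PTp Y).
Proof. by rewrite /PTp rip_mulr rip_mull !cproj_adj mulmxA. Qed.
Lemma PTD X Y : PT (X + Y) = PT X + PT Y.
Proof. by rewrite /PT PTpD opprD addrACA. Qed.
Lemma PTpPT X : PTp (PT X) = 0.
Proof. by rewrite /PT PTpB PTp_idem subrr. Qed.
Lemma PT_id X : PTp X = 0 -> PT X = X.
Proof. by move=> h; rewrite /PT h subr0. Qed.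
Lemma rip_PT X Y : PTp X = 0 -> rip X Y = rip X (PT Y).
Proof. by move=> h; rewrite /PT ripBr -rip_PTp h rip0l subr0. Qed.
Lemma PTE X : PT X = U *m (adjmx U *m X) + cproj U *m (X *m V) *m adjmx V.
Proof.
rewrite /PT /PTp {2}/cproj mulmxBr mulmx1 opprB addrCA addrC.
congr (_ + _); last by rewrite !mulmxA.
by rewrite mulmxBl mul1mx opprB addrC subrK mulmxA.
Qed.
Lemma fn2_PT_le X a b : 0 <= a -> 0 <= b ->
  fn2 (adjmx U *m X) <= a ^+ 2 -> fn2 (X *m V) <= b ^+ 2 ->
  fn2 (PT X) <= (a + b) ^+ 2.
Proof.
move=> a0 b0 ha hb; rewrite PTE; apply: fn2_triangle => //.
  by rewrite fn2_isom.
apply: le_trans hb; apply: le_trans (opb_mulr _ _ (opb_isom_adj hV)) _ => //.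
by rewrite mul1r; apply: le_trans (opb_mul _ (opb_compl hU)) _; rewrite mul1r.
Qed.
Lemma opb_PTp t X : 0 <= t -> opb t X -> opb t (PTp X).
Proof.
move=> t0 h; rewrite -[t]mulr1; apply: opbM => //; last exact: opb_compl.
by rewrite -[t]mul1r; apply: opbM => //; exact: opb_compl.
Qed.
Lemma PTp_UV : PTp (U *m adjmx V) = 0.
Proof. by rewrite /PTp mulmxA cproj_ann // !mul0mx. Qed.

(** V' is an isometry and the diagonal of singular values is invertible, so both can be cancelled on
    the right. *)
Lemma svd_annl m k (X : 'M[C]_(M, W)) (U' : 'M[C]_(M, k)) s' V' (A : 'M[C]_(m, M)) :
  is_svd X U' s' V' -> A *m X = 0 -> A *m U' = 0.
Proof.
move=> [_ hV' sp ->] /(congr1 (mulmx^~ V')); rewrite mul0mx -!mulmxA hV' mulmx1.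
move=> h0; have := congr1 (mulmx^~ (rdiag (\row_j (s' ord0 j)^-1))) h0.
rewrite mul0mx -!mulmxA; have -> : diag_mx (map_mx toC s') *m
  rdiag (\row_j (s' ord0 j)^-1) = 1%:M.
  rewrite /rdiag mulmx_diag; apply/matrixP => i j; rewrite !mxE.
  case: eqP => // ->; rewrite !mulr1n -toCM mulfV ?lt0r_neq0 //.
by rewrite mulmx1.
Qed.

Lemma svd_adj m n k (X : 'M[C]_(m, n)) (U' : 'M[C]_(m, k)) s' V' :
  is_svd X U' s' V' -> is_svd (adjmx X) V' s' U'.
Proof.
move=> [h1 h2 sp ->]; split => //.
by rewrite !adjmxM adjmxK -[diag_mx _]/(rdiag s') adjmx_rdiag mulmxA.
Qed.

(** The two partial isometries have orthogonal ranges and orthogonal initial spaces, so Pythagoras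
    applies on both sides. *)
Lemma opb_sum_UV k (U' : 'M[C]_(M, k)) (V' : 'M[C]_(W, k)) :
  adjmx U' *m U' = 1%:M -> adjmx V' *m V' = 1%:M ->
  adjmx U *m U' = 0 -> adjmx V' *m V = 0 ->
  opb 1 (U *m adjmx V + U' *m adjmx V').
Proof.
move=> hU' hV' oU oV x; rewrite mulmxDl fn2D -!mulmxA rip_mull.
rewrite (mulmxA (adjmx U)) oU mul0mx rip0r mulr0 addr0 (fn2_isom _ hU) (fn2_isom _ hU') mul1r.
rewrite (fn2_orthoproj x hV) lerD2l.
have -> : adjmx V' *m x = adjmx V' *m (x - V *m (adjmx V *m x)).
  by rewrite mulmxBr (mulmxA _ V) oV mul0mx subr0.
by apply: le_trans (opb_isom_adj hV' _) _; rewrite mul1r.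
Qed.
End DualCertificate.

(** Pair X with U V^* + U' V'^* , where U' V'^* is the polar factor of P_T^perp H and H = X - C0.
    This gains the nuclear norm S' of P_T^perp H; since Y annihilates H, the term <U V^* , H> costs
    at most (1/2 + eps B) S'. The net gain (1/2 - eps B) S' is positive: if S' were 0, the bound on
    P_T H would force H = 0. *)
Lemma certificate_nucnorm_lt (R : realType) M W r (C0 X Y : 'M[R[i]]_(M, W))
    (U : 'M[R[i]]_(M, r)) s (V : 'M[R[i]]_(W, r)) (eps B : R) :
  is_svd C0 U s V -> rip Y (X - C0) = 0 -> 0 <= eps -> 0 <= B ->
  fn2 (U *m adjmx V - PT U V Y) <= eps ^+ 2 ->
  opb (2^-1 ^+ 2) (PTp U V Y) ->
  fn2 (PT U V (X - C0)) <= B ^+ 2 * fn2 (PTp U V (X - C0)) ->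
  eps * B < 2^-1 -> X <> C0 -> nucnorm C0 < nucnorm X.
Proof.
move=> svdC; have [hU hV sp eC] := svdC.
have [H HE] : exists H, X - C0 = H by exists (X - C0).
rewrite HE; have -> : X = C0 + H by rewrite -HE addrC subrK.
move=> YH e0 B0 hE hY hT eB Hne.
have [k [U' [s' [V' svdH]]]] := svd_exists (PTp U V H).
have [hU' hV' sp' eH] := svdH.
have oU : adjmx U *m U' = 0.
  apply: (svd_annl svdH).
  by rewrite /PTp !mulmxA cproj_annl // !mul0mx.
have oV : adjmx V' *m V = 0.
  rewrite -[_ *m _]adjmxK adjmxM adjmxK.
  have -> : adjmx V *m V' = 0; last by rewrite adjmx0.
  apply: (svd_annl (svd_adj svdH)).
  by rewrite /PTp !adjmxM !cproj_adj !mulmxA cproj_annl // !mul0mx.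
have oV' : adjmx V *m V' = 0.
  by rewrite -[_ *m _]adjmxK adjmxM adjmxK oV adjmx0.
set S' := \sum_i s' ord0 i.
have S'0 : 0 <= S' by apply: sumr_ge0 => i _; exact: ltW.
have nX : \sum_i s ord0 i + rip (U *m adjmx V) H + S' <= nucnorm (C0 + H).
  apply: le_trans (rip_nucnorm_le _ (opb_sum_UV hU hV hU' hV' oU oV)).
  rewrite ripDl !ripDr (rip_svd_eq svdC).
  have -> : rip (U' *m adjmx V') C0 = 0.
    rewrite eC -!mulmxA (mulmxA U) ripC rip_mull adjmxM -!mulmxA (mulmxA (adjmx U)).
    by rewrite oU mul0mx !mulmx0 rip0r.
  have -> : rip (U' *m adjmx V') H = S'.
    rewrite /S' -(rip_svd_eq svdH) -rip_PTp; congr rip.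
    have e1 : cproj U *m U' = U' by rewrite mulmxBl mul1mx -mulmxA oU mulmx0 subr0.
    have e2 : adjmx V' *m cproj V = adjmx V'.
      by rewrite mulmxBr mulmx1 mulmxA oV mul0mx subr0.
    by rewrite /PTp (mulmxA _ U') e1 -mulmxA e2.
  by rewrite add0r -addrA.
have fS' : fn2 (PTp U V H) <= S' ^+ 2 by apply: fn2_svd_le svdH.
have r1 : `|rip (U *m adjmx V - PT U V Y) H| <= eps * (B * S').
  have -> : rip (U *m adjmx V - PT U V Y) H = rip (U *m adjmx V - PT U V Y) (PT U V H).
    by apply: rip_PT; rewrite PTpB PTp_UV // PTpPT // subr0.
  apply: rip_le => //; first exact: mulr_ge0.
  apply: le_trans hT _; rewrite exprMn; apply: ler_wpM2l fS'; exact: sqr_ge0.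
have r2 : rip (PTp U V Y) H <= 2^-1 * S'.
  rewrite rip_PTp -(PTp_idem hU hV) -rip_PTp.
  by apply: (rip_svd_le svdH) hY; rewrite invr_ge0.
have e : rip (U *m adjmx V) H = rip (U *m adjmx V - PT U V Y) H - rip (PTp U V Y) H.
  rewrite /PT 2!ripBl YH; ring.
have {}nX : nucnorm C0 + (2^-1 - eps * B) * S' <= nucnorm (C0 + H).
  rewrite (nucnormE svdC); apply: le_trans nX.
  move: r1; rewrite ler_norml => /andP[r1 _]; rewrite e; clear -r1 r2; lra.
apply: lt_le_trans nX; rewrite ltrDl; apply: mulr_gt0; first by rewrite subr_gt0.
rewrite lt_neqAle S'0 andbT; apply/eqP => S0; apply: Hne.
have h1 : fn2 (PTp U V H) = 0.
  by apply/eqP; rewrite eq_le fn2_ge0 andbT; move: fS'; rewrite -S0 expr0n.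
move: hT; rewrite h1 mulr0 => h2.
have h3 : PT U V H = 0 by apply: fn2_eq0; apply/eqP; rewrite eq_le fn2_ge0 h2.
have : H = 0 by rewrite -(subrK (PTp U V H) H) -/(PT U V H) h3 (fn2_eq0 h1) addr0.
by move=> ->; rewrite addr0.
Qed.

(** * Expectation and independence over finite sign patterns *)

Section Expectation.
Variables (R : realType) (I : finType).
Implicit Types (F G : {ffun I -> bool} -> R) (d : {ffun I -> bool}).

Definition Ex F : R := (\sum_d F d) / #|{: {ffun I -> bool}}|%:R.

Lemma card_ffun_gt0 : 0 < #|{: {ffun I -> bool}}|%:R :> R.
Proof. by rewrite ltr0n card_ffun card_bool expn_gt0. Qed.

Lemma ExD F G : Ex (fun d => F d + G d) = Ex F + Ex G.
Proof. by rewrite /Ex big_split mulrDl. Qed.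
Lemma ExZ c F : Ex (fun d => c * F d) = c * Ex F.
Proof. by rewrite /Ex -mulr_sumr mulrA. Qed.
Lemma Ex_cst c : Ex (fun=> c) = c.
Proof.
by rewrite /Ex sumr_const -[c *+ _]mulr_natr mulfK // lt0r_neq0 // card_ffun_gt0.
Qed.
Lemma Ex_le F G : (forall d, F d <= G d) -> Ex F <= Ex G.
Proof.
by move=> h; rewrite /Ex ler_pM2r ?invr_gt0 ?card_ffun_gt0 //; apply: ler_sum.
Qed.
Lemma Ex_ge0 F : (forall d, 0 <= F d) -> 0 <= Ex F.
Proof. by move=> h; rewrite -(Ex_cst 0); apply: Ex_le. Qed.
Lemma Ex_sum (J : Type) (r : seq J) (P : pred J) (F : J -> {ffun I -> bool} -> R) :
  Ex (fun d => \sum_(j <- r | P j) F j d) = \sum_(j <- r | P j) Ex (F j).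
Proof.
rewrite /Ex exchange_big /= mulr_suml; apply: eq_bigr => j _.
by rewrite mulr_suml.
Qed.
Lemma eq_Ex F G : F =1 G -> Ex F = Ex G.
Proof. by move=> h; rewrite /Ex; congr (_ / _); apply: eq_bigr => d _. Qed.
Lemma Ex_reindex (h : {ffun I -> bool} -> {ffun I -> bool}) F :
  involutive h -> Ex (fun d => F (h d)) = Ex F.
Proof.
move=> hh; rewrite /Ex; congr (_ / _).
by rewrite [RHS](reindex_inj (inv_inj hh)).
Qed.

Definition flip i d : {ffun I -> bool} :=
  [ffun j => if j == i then ~~ d j else d j].
Lemma flipK i : involutive (flip i).
Proof. by move=> d; apply/ffunP => j; rewrite !ffunE; case: eqP; rewrite ?negbK. Qed.

(** Flipping one coordinate preserves the uniform law, so the inequality is only needed after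
    summing over each pair of patterns differing at [i]. *)
Lemma Ex_flip_le i c F G :
  (forall d, F d + F (flip i d) <= c * (G d + G (flip i d))) -> Ex F <= c * Ex G.
Proof.
move=> /Ex_le; rewrite ExZ !ExD (Ex_reindex F (flipK i)) (Ex_reindex G (flipK i)).
by move: (Ex F) (Ex G) => *; lra.
Qed.

Definition mix (A : pred I) d d' : {ffun I -> bool} :=
  [ffun j => if A j then d' j else d j].

(** Exchanging the coordinates in [A] between [d] and [d'] is an involution on pairs, so the spliced
    pattern is again uniform. This plays the role of conditional expectation given the coordinates
    outside [A]. *)
Lemma Ex_mix A F : Ex (fun d => Ex (fun d' => F (mix A d d'))) = Ex F.
Proof.
pose h (p : {ffun I -> bool} * {ffun I -> bool}) := (mix A p.1 p.2, mix A p.2 p.1).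
have hh : involutive h.
  by move=> [d d']; rewrite /h /=; congr (_, _); apply/ffunP => j; rewrite !ffunE; case: (A j).
rewrite /Ex -mulr_suml pair_big /=; congr (_ / _).
transitivity ((\sum_p F (p : {ffun I -> bool} * {ffun I -> bool}).1)
  / #|{: {ffun I -> bool}}|%:R).
  by congr (_ / _); rewrite [RHS](reindex_inj (inv_inj hh)).
rewrite -(pair_bigA _ (fun d _ => F d)) /=.
under eq_bigr => d _ do rewrite sumr_const -[F d *+ _]mulr_natr.
by rewrite -mulr_suml mulfK // lt0r_neq0 // card_ffun_gt0.
Qed.

Definition Pr (P : {ffun I -> bool} -> Prop) : R := Ex (fun d => (`[< P d >])%:R).

Lemma Pr_sub (P Q : {ffun I -> bool} -> Prop) :
  (forall d, P d -> Q d) -> Pr P <= Pr Q.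
Proof.
move=> h; apply: Ex_le => d; rewrite ler_nat.
by case: (asboolP (P d)) => //= /h /asboolT ->.
Qed.

Lemma Pr_or (P Q : {ffun I -> bool} -> Prop) :
  Pr (fun d => P d \/ Q d) <= Pr P + Pr Q.
Proof.
rewrite -ExD; apply: Ex_le => d; rewrite asbool_or -natrD ler_nat.
by case: asboolP => //=; case: asboolP.
Qed.

Lemma Pr_exists (J : finType) (P : J -> {ffun I -> bool} -> Prop) q :
  (forall j, Pr (P j) <= q) -> Pr (fun d => exists j, P j d) <= #|J|%:R * q.
Proof.
move=> h; apply: (@le_trans _ _ (\sum_j Pr (P j))); last first.
  by rewrite mulr_natl -sumr_const; apply: ler_sum => j _.
rewrite -Ex_sum; apply: Ex_le => d.
case: (asboolP (exists j, P j d)) => [[j hj]|_]; last exact: sumr_ge0.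
by rewrite (bigD1 j) //= asboolT // lerDl sumr_ge0.
Qed.

Lemma Pr_resample (A : pred I) (P : {ffun I -> bool} -> Prop) q :
  (forall d, Pr (fun d' => P (mix A d d')) <= q) -> Pr P <= q.
Proof. by move=> h; rewrite /Pr -(Ex_mix A) -[leRHS]Ex_cst; apply: Ex_le. Qed.

Lemma Pr_compl (P Q : {ffun I -> bool} -> Prop) :
  (forall d, ~ Q d -> P d) -> 1 - Pr Q <= Pr P.
Proof.
move=> h; rewrite lerBlDr -ExD -[leLHS]Ex_cst; apply: Ex_le => d.
rewrite -natrD ler1n; case: (asboolP (Q d)) => /= [_|/h /asboolT -> //].
by rewrite addn1.
Qed.

Lemma markov_Pr F (P : {ffun I -> bool} -> Prop) t : 0 < t ->
  (forall d, 0 <= F d) -> (forall d, P d -> t <= F d) -> Pr P <= Ex F / t.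
Proof.
move=> t0 F0 h; rewrite ler_pdivlMr // mulrC -ExZ; apply: Ex_le => d.
by case: asboolP => [/h|_]; rewrite ?mulr1 ?mulr0.
Qed.
End Expectation.

(** * Trace inequalities for powers of Hermitian matrices *)

Section TraceInequalities.
Variable R : realType.
Local Notation C := R[i].
Local Notation toC := (@toC R).

Definition rtr n (X : 'M[C]_n) : R := complex.Re (\tr X).

Lemma rtrD n (X Y : 'M[C]_n) : rtr (X + Y) = rtr X + rtr Y.
Proof. by rewrite /rtr linearD ReD. Qed.
Lemma rtrN n (X : 'M[C]_n) : rtr (- X) = - rtr X.
Proof. by rewrite /rtr linearN ReN. Qed.
Lemma rtrB n (X Y : 'M[C]_n) : rtr (X - Y) = rtr X - rtr Y.
Proof. by rewrite rtrD rtrN. Qed.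
Lemma rtr0 n : rtr (0 : 'M[C]_n) = 0.
Proof. by rewrite /rtr linear0. Qed.
Lemma rtr_sum n I (s : seq I) (P : pred I) (F : I -> 'M[C]_n) :
  rtr (\sum_(i <- s | P i) F i) = \sum_(i <- s | P i) rtr (F i).
Proof. apply: (big_morph (@rtr n) (@rtrD n) (rtr0 n)). Qed.
Lemma rtr_mulC m n (X : 'M[C]_(m, n)) Y : rtr (X *m Y) = rtr (Y *m X).
Proof. by rewrite /rtr mxtrace_mulC. Qed.
Lemma rtr_adj_mul m n (X : 'M[C]_(m, n)) : rtr (adjmx X *m X) = fn2 X.
Proof. by rewrite /rtr fn2E. Qed.
Lemma rtr1 n : rtr (1%:M : 'M[C]_n) = n%:R.
Proof.
by rewrite /rtr mxtrace1; elim: n => // n IH; rewrite -addn1 !natrD ReD IH.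
Qed.

Lemma mxpow0 n (X : 'M[C]_n) : X ^+ 0 = 1%:M. Proof. by []. Qed.
Lemma mxpow1 n (X : 'M[C]_n) : X ^+ 1 = X. Proof. exact: expr1. Qed.
Lemma mxpowS n (X : 'M[C]_n) k : X ^+ k.+1 = X *m X ^+ k.
Proof. exact: exprS. Qed.
Lemma mxpowSr n (X : 'M[C]_n) k : X ^+ k.+1 = X ^+ k *m X.
Proof. exact: exprSr. Qed.

Lemma adjmxX n (X : 'M[C]_n) k : adjmx (X ^+ k) = adjmx X ^+ k.
Proof.
elim: k => [|k IH]; first by rewrite !expr0 adjmx1.
by rewrite mxpowSr mxpowS -IH adjmxM.
Qed.

Lemma spectralX n (P : 'M[C]_n) (l : 'rV[R]_n) k : adjmx P *m P = 1%:M ->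
  P *m adjmx P = 1%:M ->
  (P *m rdiag l *m adjmx P) ^+ k = P *m rdiag (\row_i l ord0 i ^+ k) *m adjmx P.
Proof.
move=> h1 h2; elim: k => [|k IH].
  rewrite expr0; have -> : rdiag (\row_i l ord0 i ^+ 0) = 1%:M.
    by apply/matrixP => i j; rewrite rdiagE !mxE expr0.
  by rewrite mulmx1 h2.
rewrite mxpowS IH -!mulmxA (mulmxA (adjmx P) P) h1 mul1mx.
congr (_ *m _); rewrite !mulmxA; congr (_ *m _).
rewrite /rdiag mulmx_diag; congr diag_mx; apply/rowP => i.
by rewrite !mxE exprS toCM.
Qed.

Lemma rdiag_mulE m n (l : 'rV[R]_m) (X : 'M[C]_(m, n)) i j :
  (rdiag l *m X) i j = toC (l ord0 i) * X i j.
Proof. by rewrite /rdiag mul_diag_mx !mxE. Qed.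

(* Traces of words [X^a Y^b] in two Hermitian matrices are positive
   combinations of [lam_i^a mu_j^b], so polynomial trace inequalities reduce
   to scalar ones. *)
Lemma rtr_two_spectra n (X Y : 'M[C]_n) : adjmx X = X -> adjmx Y = Y ->
  exists (lam mu : 'I_n -> R) (c : 'I_n -> 'I_n -> R),
    (forall i j, 0 <= c i j) /\
    forall a b, rtr (X ^+ a *m Y ^+ b) = \sum_i \sum_j c i j * (lam i ^+ a * mu j ^+ b).
Proof.
move=> /herm_spectral[P [l [P1 P2 ->]]] /herm_spectral[Q [m [Q1 Q2 ->]]].
exists (fun i => l ord0 i), (fun j => m ord0 j), (fun i j => nsq ((adjmx P *m Q) i j)).
split=> [i j|a b]; first exact: nsq_ge0.
rewrite !spectralX // -!mulmxA rtr_mulC -!mulmxA.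
set w := adjmx P *m Q; have ew : adjmx Q *m P = adjmx w by rewrite adjmxM adjmxK.
rewrite (mulmxA (adjmx P)) -/w ew /rtr /mxtrace Re_sum; apply: eq_bigr => i _.
rewrite rdiag_mulE ReZ [(\row_k _) _ _]mxE [(w *m _) i i]mxE Re_sum mulr_sumr; apply: eq_bigr => j _.
rewrite rdiag_mulE adjmxE [(\row_k _) _ _]mxE mulrCA ReZ.
have -> : w i j * conjc (w i j) = toC (nsq (w i j)) by rewrite nsqE mulrC.
by rewrite /=; ring.
Qed.

(** Induction: multiply the case n by a and add (n + 1) b^n (a - b)^2 >= 0. *)
Lemma pow_AMGM (a b : R) n : 0 <= a -> 0 <= b ->
  n.+1%:R * (a * b ^+ n) <= a ^+ n.+1 + n%:R * b ^+ n.+1.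
Proof.
move=> a0 b0; elim: n => [|n IH]; first by rewrite mul0r addr0 expr0 mulr1 mul1r expr1.
have := ler_wpM2l a0 IH; have := mulr_ge0 (mulr_ge0 (ler0n R n.+1) (exprn_ge0 n b0)) (sqr_ge0 (a - b)).
rewrite !exprS -![n.+2%:R]natr1 -![n.+1%:R]natr1.
set p := b ^+ n; set q := a ^+ n; set k := n%:R; lra.
Qed.

Lemma even_pow_tangent (x y : R) p :
  y ^+ (2 * p.+1) + (2 * p.+1)%:R * ((x - y) * y ^+ (2 * p).+1) <= x ^+ (2 * p.+1).
Proof.
have h := pow_AMGM (2 * p).+1 (normr_ge0 x) (normr_ge0 y).
have e : (2 * p.+1 = (2 * p).+2)%N by lia.
rewrite e; move: h.
have ev (z : R) : `|z| ^+ (2 * p).+2 = z ^+ (2 * p).+2.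
  by rewrite -e !exprM real_normK ?num_real.
rewrite !ev => h.
have : x * y ^+ (2 * p).+1 <= `|x| * `|y| ^+ (2 * p).+1.
  by rewrite -normrX -normrM ler_norm.
move=> /(ler_wpM2l (ler0n R (2 * p).+2)); move: h.
rewrite ![y ^+ (2 * p).+2]exprS mulrBl.
rewrite -[(2 * p).+2%:R]natr1; set k := _.+1%:R; lra.
Qed.

(** Doubling the geometric sum and pairing index i with 2 p - i reduces the claim to u^a v^i + u^i
    v^a <= u^(a+i) + v^(a+i) for u, v >= 0, that is (u^a - v^a) (u^i - v^i) >= 0. *)
Lemma odd_pow_secant (x y : R) p :
  (x - y) * (x ^+ (2 * p).+1 - y ^+ (2 * p).+1) <=
  (2 * p).+1%:R / 2 * ((x - y) ^+ 2 * (x ^+ (2 * p) + y ^+ (2 * p))).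
Proof.
rewrite subrXX mulrA -expr2 [leRHS]mulrCA; apply: ler_wpM2l; first exact: sqr_ge0.
set S := \sum_(i < _) _.
have eS : S + S = \sum_(i < (2 * p).+1) (x ^+ (2 * p - i) * y ^+ i + x ^+ i * y ^+ (2 * p - i)).
  rewrite big_split /=; congr (_ + _); rewrite /S (reindex_inj rev_ord_inj) /=.
  apply: eq_bigr => i _; rewrite !subSS.
  by rewrite subKn // -ltnS.
suff : S + S <= (2 * p).+1%:R * (x ^+ (2 * p) + y ^+ (2 * p)) by lra.
rewrite eS mulr_natl -[X in _ *+ X]card_ord -sumr_const; apply: ler_sum => i _.
have ev (z : R) : z ^+ (2 * p) = `|z| ^+ (2 * p) by rewrite !exprM real_normK ?num_real.
have le_p (u v : R) a b : u ^+ a * v ^+ b <= `|u| ^+ a * `|v| ^+ b.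
  by rewrite -!normrX -normrM ler_norm.
rewrite (ev x) (ev y); apply: le_trans (lerD (le_p _ _ _ _) (le_p _ _ _ _)) _.
have hi : (i <= 2 * p)%N by rewrite -ltnS.
have eX (z : R) : z ^+ (2 * p) = z ^+ (2 * p - i) * z ^+ i.
  by rewrite -exprD subnK.
rewrite (eX `|x|) (eX `|y|).
move: (normr_ge0 x) (normr_ge0 y); set u := `|x|; set v := `|y| => u0 v0.
set a := (2 * p - i)%N.
suff : 0 <= (u ^+ a - v ^+ a) * (u ^+ i - v ^+ i).
  by move: (u ^+ a) (u ^+ i) (v ^+ a) (v ^+ i) => *; lra.
case: (lerP u v) => [uv|/ltW vu].
  by apply: mulr_le0; rewrite subr_le0; apply: lerXn2r.
by apply: mulr_ge0; rewrite subr_ge0; apply: lerXn2r.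
Qed.

Lemma rtr_secant_expand n (X Y : 'M[C]_n) m :
  rtr ((X - Y) *m (X ^+ m.+1 - Y ^+ m.+1)) =
  rtr (X ^+ m.+2 *m Y ^+ 0) - rtr (X ^+ 1 *m Y ^+ m.+1)
     - rtr (X ^+ m.+1 *m Y ^+ 1) + rtr (X ^+ 0 *m Y ^+ m.+2).
Proof.
rewrite (rtr_mulC (X ^+ m.+1)) !mxpow0 !mxpow1 mulmx1 mul1mx (mxpowS X m.+1) (mxpowS Y m.+1).
move: (X ^+ m.+1) (Y ^+ m.+1) => A B.
rewrite mulmxBl !mulmxBr !rtrB.
by move: (rtr (X *m A)) (rtr (X *m B)) (rtr (Y *m A)) (rtr (Y *m B)) => *; ring.
Qed.

Lemma rtr_square_expand n (X Y : 'M[C]_n) m :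
  rtr ((X - Y) *m (X - Y) *m (X ^+ m + Y ^+ m)) =
  rtr (X ^+ m.+2 *m Y ^+ 0) + rtr (X ^+ 2 *m Y ^+ m)
     + rtr (X ^+ m *m Y ^+ 2) + rtr (X ^+ 0 *m Y ^+ m.+2)
     - (rtr (X ^+ m.+1 *m Y ^+ 1) + rtr (X ^+ m.+1 *m Y ^+ 1))
     - (rtr (X ^+ 1 *m Y ^+ m.+1) + rtr (X ^+ 1 *m Y ^+ m.+1)).
Proof.
transitivity (rtr (X *m X *m X ^+ m) + rtr (X *m X *m Y ^+ m)
  + rtr (Y *m Y *m X ^+ m) + rtr (Y *m Y *m Y ^+ m)
  - (rtr (X *m Y *m X ^+ m) + rtr (Y *m X *m X ^+ m))
  - (rtr (X *m Y *m Y ^+ m) + rtr (Y *m X *m Y ^+ m))).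
  move: (X ^+ m) (Y ^+ m) => A B.
  rewrite (mulmxBr (X - Y) X Y) (mulmxBl X Y X) (mulmxBl X Y Y) (mulmxDr _ A B).
  have e D : rtr ((X *m X - Y *m X - (X *m Y - Y *m Y)) *m D) =
      rtr (X *m X *m D) - rtr (Y *m X *m D) - (rtr (X *m Y *m D) - rtr (Y *m Y *m D)).
    move: (X *m X) (Y *m X) (X *m Y) (Y *m Y) => a b c d.
    by rewrite (mulmxBl (a - b)) (mulmxBl a) (mulmxBl c) rtrB rtrB rtrB.
  rewrite rtrD !e.
  move: (rtr (X *m X *m A)) (rtr (Y *m X *m A)) (rtr (X *m Y *m A)).
  move: (rtr (Y *m Y *m A)) (rtr (X *m X *m B)) (rtr (Y *m X *m B)).
  by move: (rtr (X *m Y *m B)) (rtr (Y *m Y *m B)) => *; ring.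
congr (_ + _ + _ + _ - (_ + _) - (_ + _)).
- by rewrite mxpow0 mulmx1 (mxpowS X m.+1) (mxpowS X m) mulmxA.
- by rewrite rtr_mulC (mxpowS Y 1) mxpow1.
- by rewrite mxpow0 mul1mx (mxpowS Y m.+1) (mxpowS Y m) mulmxA.
- by rewrite rtr_mulC mulmxA mxpow1 mxpowSr.
- by rewrite -mulmxA rtr_mulC mxpow1 mxpowS.
- by rewrite -mulmxA mxpow1 mxpowS.
- by rewrite -mulmxA rtr_mulC -mulmxA mxpow1 mxpowSr.
Qed.

(** Cyclicity of the trace brings every word of the two expansions to the form X^a Y^b; then
    [odd_pow_secant] applies to each pair of eigenvalues. *)
Lemma rtr_pow_secant n (X Y : 'M[C]_n) p : adjmx X = X -> adjmx Y = Y ->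
  rtr ((X - Y) *m (X ^+ (2 * p).+1 - Y ^+ (2 * p).+1)) <=
  (2 * p).+1%:R / 2 *
    rtr ((X - Y) *m (X - Y) *m (X ^+ (2 * p) + Y ^+ (2 * p))).
Proof.
move=> hX hY; have [lam [mu [c [c0 h]]]] := rtr_two_spectra hX hY.
have hp := @odd_pow_secant _ _ p.
move: (2 * p)%N hp => m hp.
have -> : rtr ((X - Y) *m (X ^+ m.+1 - Y ^+ m.+1)) =
    \sum_i \sum_j c i j * ((lam i - mu j) * (lam i ^+ m.+1 - mu j ^+ m.+1)).
  rewrite rtr_secant_expand !h -!sumrB -big_split; apply: eq_bigr => i _.
  rewrite -!sumrB -big_split; apply: eq_bigr => j _ /=.
  rewrite !expr0 !(exprS _ m.+1); ring.
have -> : rtr ((X - Y) *m (X - Y) *m (X ^+ m + Y ^+ m)) =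
    \sum_i \sum_j c i j * ((lam i - mu j) ^+ 2 * (lam i ^+ m + mu j ^+ m)).
  rewrite rtr_square_expand.
  rewrite !h -!big_split -!sumrB; apply: eq_bigr => i _.
  rewrite -!big_split -!sumrB; apply: eq_bigr => j _ /=.
  rewrite !expr0 !(exprS _ m.+1) !(exprS _ m); ring.
rewrite mulr_sumr; apply: ler_sum => i _; rewrite mulr_sumr; apply: ler_sum => j _.
rewrite [leRHS]mulrCA; exact: ler_wpM2l.
Qed.

Lemma rtr_pow_tangent n (X Y : 'M[C]_n) p : adjmx X = X -> adjmx Y = Y ->
  rtr (Y ^+ (2 * p.+1)) + (2 * p.+1)%:R * rtr ((X - Y) *m Y ^+ (2 * p).+1)
    <= rtr (X ^+ (2 * p.+1)).
Proof.
move=> hX hY; have [lam [mu [c [c0 h]]]] := rtr_two_spectra hX hY.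
have e : (2 * p.+1 = (2 * p).+2)%N by lia.
have hp (x y : R) := even_pow_tangent x y p; rewrite e in hp *.
move: (2 * p).+1 hp => q hp {e}.
have -> : rtr ((X - Y) *m Y ^+ q) = rtr (X ^+ 1 *m Y ^+ q) - rtr (X ^+ 0 *m Y ^+ q.+1).
  by rewrite mxpow1 mxpow0 mul1mx mulmxBl rtrB mxpowS.
have -> : rtr (Y ^+ q.+1) = rtr (X ^+ 0 *m Y ^+ q.+1) by rewrite mxpow0 mul1mx.
have -> : rtr (X ^+ q.+1) = rtr (X ^+ q.+1 *m Y ^+ 0) by rewrite mxpow0 mulmx1.
rewrite !h -sumrB mulr_sumr -big_split; apply: ler_sum => i _.
rewrite -sumrB mulr_sumr -big_split; apply: ler_sum => j _ /=.
have := ler_wpM2l (c0 i j) (hp (lam i) (mu j)).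
rewrite !expr0 expr1 [mu j ^+ q.+1]exprS; lra.
Qed.

Lemma rtr_even_pow_ge0 n (X : 'M[C]_n) p : adjmx X = X -> 0 <= rtr (X ^+ (2 * p)).
Proof.
move=> hX; rewrite mul2n -addnn exprD -mulmxE -{1}hX -adjmxX rtr_adj_mul.
exact: fn2_ge0.
Qed.

Lemma average_tangent (J : finType) n (X : J -> 'M[C]_n) Z y c (f : J -> R) :
  (0 < #|J|)%N ->
  (forall j, y + c * rtr ((X j - toC (#|J|%:R)^-1 *: \sum_k X k) *m Z) <= f j) ->
  y <= #|J|%:R^-1 * \sum_j f j.
Proof.
move=> J0 h; have J1 : #|J|%:R != 0 :> R by rewrite pnatr_eq0 -lt0n.
rewrite mulrC ler_pdivlMr ?ltr0n // mulr_natr -sumr_const.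
set Y := toC _ *: _ in h.
have -> : \sum_(i in J) y = \sum_j (y + c * rtr ((X j - Y) *m Z)).
  rewrite big_split /= -mulr_sumr -(rtr_sum _ _ (fun j => (X j - Y) *m Z)).
  rewrite -(mulmx_suml Z (index_enum J) xpredT (fun j => X j - Y)) sumrB.
  have -> : \sum_(j : J) Y = \sum_j X j.
    transitivity (Y *+ #|J|); first exact: sumr_const.
    rewrite -scaler_nat /Y scalerA; have -> : (#|J|%:R : C) = toC #|J|%:R.
      by rewrite toCE rmorph_nat.
    by rewrite -toCM divff // scale1r.
  by rewrite subrr mul0mx rtr0 mulr0 addr0.
by apply: ler_sum => j _.
Qed.

Lemma rtr_pow_jensen (J : finType) n (X : J -> 'M[C]_n) p :
  (0 < #|J|)%N -> (forall j, adjmx (X j) = X j) ->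
  rtr ((toC (#|J|%:R)^-1 *: \sum_j X j) ^+ (2 * p.+1)) <=
  #|J|%:R^-1 * \sum_j rtr (X j ^+ (2 * p.+1)).
Proof.
move=> J0 hX; set Y := toC _ *: _.
have hY : adjmx Y = Y.
  by rewrite adjmxZ conjc_real adjmx_sum; congr (_ *: _); apply: eq_bigr => j _.
by apply: average_tangent => // j; apply: rtr_pow_tangent.
Qed.
End TraceInequalities.

(** * Noncommutative Khintchine inequality and Hermitian dilation *)

Section Khintchine.
Variable R : realType.
Local Notation C := R[i].
Local Notation toC := (@toC R).

Definition sgnR (b : bool) : R := if b then 1 else -1.

Lemma sgnRN b : sgnR (~~ b) = - sgnR b.
Proof. by case: b; rewrite /= ?opprK. Qed.
Lemma sgnR_sqr b : sgnR b ^+ 2 = 1.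
Proof. by case: b; rewrite /= ?sqrrN expr1n. Qed.
Lemma sgnRC b : toC (sgnR b) = sgnC R b.
Proof. by case: b => //; rewrite /sgnR /sgnC toCE rmorphN. Qed.

Definition rademacher (I : finType) m n (A : I -> 'M[C]_(m, n))
  (d : {ffun I -> bool}) : 'M[C]_(m, n) := \sum_i toC (sgnR (d i)) *: A i.

Lemma rademacher_adj (I : finType) n (A : I -> 'M[C]_n) d :
  (forall i, adjmx (A i) = A i) -> adjmx (rademacher A d) = rademacher A d.
Proof.
move=> hA; rewrite adjmx_sum; apply: eq_bigr => i _.
by rewrite adjmxZ conjc_real hA.
Qed.

Lemma sum_fn2_mul (I : finType) m n p (A : I -> 'M[C]_(m, n)) s (B : 'M[C]_(n, p)) :
  (forall x : 'cV_n, \sum_i fn2 (A i *m x) <= s * fn2 x) ->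
  \sum_i fn2 (A i *m B) <= s * fn2 B.
Proof.
move=> h; rewrite [fn2 B]fn2_cols mulr_sumr.
under eq_bigr do rewrite fn2_cols.
rewrite exchange_big /=; apply: ler_sum => j _.
by under eq_bigr do rewrite colE -mulmxA -colE.
Qed.

Lemma rtr_sqr_pow n (A X : 'M[C]_n) p : adjmx A = A -> adjmx X = X ->
  rtr (A *m A *m X ^+ (2 * p)) = fn2 (A *m X ^+ p).
Proof.
move=> hA hX; rewrite mul2n -addnn exprD -mulmxE -rtr_adj_mul adjmxM hA adjmxX hX.
by rewrite rtr_mulC -!mulmxA rtr_mulC -!mulmxA.
Qed.

Lemma rtr_pow_fn2 n (X : 'M[C]_n) p : adjmx X = X -> rtr (X ^+ (2 * p)) = fn2 (X ^+ p).
Proof.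
move=> hX; rewrite -[X ^+ (2 * p)]mul1mx -[1%:M]mulmx1.
by rewrite rtr_sqr_pow ?adjmx1 // mul1mx.
Qed.

(** Split off one factor S = sum_i T_i. Pairing each pattern with its flip at i replaces S^(2p+1) by
    its difference across the flip; there S changes by 2 T_i, and the secant inequality leaves T_i^2
    = A_i^2 in front of S^(2p). *)
Lemma khintchine_step (I : finType) n (A : I -> 'M[C]_n) s p :
  (forall i, adjmx (A i) = A i) ->
  (forall x : 'cV_n, \sum_i fn2 (A i *m x) <= s * fn2 x) ->
  Ex (fun d => rtr (rademacher A d ^+ (2 * p).+2)) <=
  (2 * p).+1%:R * s * Ex (fun d => rtr (rademacher A d ^+ (2 * p))).
Proof.
move=> hA hs; set S := rademacher A.
have hS d : adjmx (S d) = S d by apply: rademacher_adj.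
pose T i (d : {ffun I -> bool}) : 'M[C]_n := toC (sgnR (d i)) *: A i.
have TN i d : T i (flip i d) = - T i d.
  by rewrite /T ffunE eqxx sgnRN toCE rmorphN scaleNr.
have SD i d : S d - S (flip i d) = T i d + T i d.
  rewrite /S /rademacher (bigD1 i) //= [X in _ - X](bigD1 i) //= -/(T i d) -/(T i (flip i d)) TN.
  rewrite [X in _ + X - _](eq_bigr (fun j => toC (sgnR (flip i d j)) *: A j)); last first.
    by move=> j ji; rewrite ffunE (negPf ji).
  by rewrite opprD opprK addrACA subrr addr0.
have TT i d : T i d *m T i d = A i *m A i.
  by rewrite /T -scalemxAl -scalemxAr scalerA -toCM -expr2 sgnR_sqr scale1r.
have key i : Ex (fun d => rtr (T i d *m S d ^+ (2 * p).+1)) <=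
    (2 * p).+1%:R * Ex (fun d => rtr (A i *m A i *m S d ^+ (2 * p))).
  pose F (d : {ffun I -> bool}) := rtr (T i d *m S d ^+ (2 * p).+1).
  pose G (d : {ffun I -> bool}) := rtr (A i *m A i *m S d ^+ (2 * p)).
  have FG d : F d + F (flip i d) <= (2 * p).+1%:R * (G d + G (flip i d)).
    have := rtr_pow_secant p (hS d) (hS (flip i d)).
    rewrite SD /F /G TN.
    move: (S d ^+ (2 * p).+1) (S (flip i d) ^+ (2 * p).+1) (S d ^+ (2 * p)).
    move: (S (flip i d) ^+ (2 * p)) => v a b u.
    have -> : rtr ((T i d + T i d) *m (a - b)) = 2 * (rtr (T i d *m a) - rtr (T i d *m b)).
      by rewrite (mulmxDl (T i d)) (mulmxBr (T i d)) rtrD rtrB mulrDl !mul1r.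
    have -> : rtr ((T i d + T i d) *m (T i d + T i d) *m (u + v)) =
        4 * (rtr (A i *m A i *m u) + rtr (A i *m A i *m v)).
      rewrite (mulmxDl (T i d)) (mulmxDr (T i d)) TT (mulmxDr _ u) !(mulmxDl (_ + _)).
      rewrite !(mulmxDl (A i *m A i)) !rtrD.
      by move: (rtr _) (rtr (_ *m v)) => x y; ring.
    rewrite mulNmx rtrN; move: (rtr (_ *m a)) (rtr (_ *m b)) (rtr (_ *m u)) (rtr (_ *m v)).
    by move=> *; lra.
  exact: Ex_flip_le FG.
have -> : Ex (fun d => rtr (S d ^+ (2 * p).+2)) =
    \sum_i Ex (fun d => rtr (T i d *m S d ^+ (2 * p).+1)).
  rewrite -Ex_sum; apply: eq_Ex => d.
  by rewrite mxpowS {1}/S mulmx_suml rtr_sum.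
apply: le_trans (ler_sum _ (fun i _ => key i)) _.
rewrite -mulr_sumr -mulrA; apply: ler_wpM2l => //.
rewrite -Ex_sum -ExZ; apply: Ex_le => d.
under eq_bigr do rewrite rtr_sqr_pow //.
by rewrite rtr_pow_fn2 //; apply: sum_fn2_mul.
Qed.

(* The argument is Tropp's elementary proof of the noncommutative Khintchine
   inequality: condition on all signs but one and use [rtr_pow_secant]. *)
Lemma khintchine (I : finType) n (A : I -> 'M[C]_n) s p : 0 <= s ->
  (forall i, adjmx (A i) = A i) ->
  (forall x : 'cV_n, \sum_i fn2 (A i *m x) <= s * fn2 x) ->
  Ex (fun d => rtr (rademacher A d ^+ (2 * p))) <= (2 ^ p * p`!)%:R * s ^+ p * n%:R.
Proof.
move=> s0 hA hs; elim: p => [|p IH].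
  rewrite muln0 expn0 mul1n expr0 !mul1r; under eq_Ex do rewrite mxpow0 rtr1.
  by rewrite Ex_cst.
have -> : (2 * p.+1 = (2 * p).+2)%N by lia.
apply: le_trans (khintchine_step p hA hs) _.
(* The factor 2 p + 1 is relaxed to 2 (p + 1), so that the product over the induction is 2^p p!
   instead of a double factorial. *)
apply: (@le_trans _ _ ((2 * p.+1)%:R * s * ((2 ^ p * p`!)%:R * s ^+ p * n%:R))).
  apply: ler_pM => //.
  - by rewrite mulr_ge0.
  - by apply: Ex_ge0 => d; apply: rtr_even_pow_ge0; apply: rademacher_adj.
  - by apply: ler_wpM2r => //; rewrite ler_nat; lia.
rewrite expnS factS !exprS !natrM le_eqVlt; apply/orP; left; apply/eqP; ring.
Qed.

(** Hermitian dilation: it carries the Hermitian inequalities over to rectangular matrices, and its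
    even trace moments dominate powers of the norm of [X]. *)
Definition dil m n (X : 'M[C]_(m, n)) : 'M[C]_(m + n) := block_mx 0 X (adjmx X) 0.

Lemma dil_adj m n (X : 'M[C]_(m, n)) : adjmx (dil X) = dil X.
Proof.
rewrite /adjmx /dil map_block_mx tr_block_mx !map_mx0 !trmx0.
by rewrite -/(adjmx _) -/(adjmx _) adjmxK.
Qed.
Lemma dilD m n (X Y : 'M[C]_(m, n)) : dil (X + Y) = dil X + dil Y.
Proof. by rewrite /dil adjmxD add_block_mx !addr0. Qed.
Lemma dil0 m n : dil (0 : 'M[C]_(m, n)) = 0.
Proof. by rewrite /dil adjmx0 block_mx0. Qed.
Lemma dilZ m n t (X : 'M[C]_(m, n)) : dil (toC t *: X) = toC t *: dil X.
Proof. by rewrite /dil adjmxZ conjc_real scale_block_mx !scaler0. Qed.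
Lemma dil_sum m n I (r : seq I) (P : pred I) (F : I -> 'M[C]_(m, n)) :
  dil (\sum_(i <- r | P i) F i) = \sum_(i <- r | P i) dil (F i).
Proof. apply: (big_morph (@dil m n) (@dilD m n) (@dil0 m n)). Qed.
Lemma dil_rademacher (I : finType) m n (A : I -> 'M[C]_(m, n)) d :
  dil (rademacher A d) = rademacher (fun i => dil (A i)) d.
Proof. by rewrite dil_sum; apply: eq_bigr => i _; rewrite dilZ. Qed.

Lemma fn2_col_mx m n p (x : 'M[C]_(m, p)) (y : 'M[C]_(n, p)) :
  fn2 (col_mx x y) = fn2 x + fn2 y.
Proof.
rewrite /fn2 big_split_ord; congr (_ + _); apply: eq_bigr => i _; apply: eq_bigr => j _.
  by rewrite col_mxEu.
by rewrite col_mxEd.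
Qed.

Lemma fn2_dil_mul m n (X : 'M[C]_(m, n)) (x : 'cV[C]_m) (y : 'cV[C]_n) :
  fn2 (dil X *m col_mx x y) = fn2 (X *m y) + fn2 (adjmx X *m x).
Proof. by rewrite /dil mul_block_col !mul0mx add0r addr0 fn2_col_mx. Qed.

Lemma rtr_pow_spectral n (X P : 'M[C]_n) (l : 'rV[R]_n) k : adjmx P *m P = 1%:M ->
  P *m adjmx P = 1%:M -> X = P *m rdiag l *m adjmx P ->
  rtr (X ^+ k) = \sum_i l ord0 i ^+ k.
Proof.
move=> h1 h2 ->; rewrite spectralX // rtr_mulC mulmxA h1 mul1mx /rtr /mxtrace Re_sum.
by apply: eq_bigr => i _; rewrite rdiagE eqxx mulr1n /= mxE.
Qed.

Lemma bigmax_exp_le (J : finType) (x : J -> R) k : (forall j, 0 <= x j) ->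
  (\big[Num.max/0]_j x j) ^+ k.+1 <= \sum_j x j ^+ k.+1.
Proof.
move=> x0; apply: (big_ind (fun y => y ^+ k.+1 <= \sum_j x j ^+ k.+1)).
- by rewrite expr0n; apply: sumr_ge0 => i _; rewrite exprn_ge0.
- by move=> y z hy hz; case: (leP y z).
move=> i _; rewrite (bigD1 i) //= lerDl; apply: sumr_ge0 => j _.
by rewrite exprn_ge0.
Qed.

(** In an eigenbasis the largest squared eigenvalue L controls |X u|^2, and L^(k+1) is one of the
    nonnegative terms of the trace. *)
Lemma fn2_mul_pow_le_rtr n (X : 'M[C]_n) (u : 'cV[C]_n) k : adjmx X = X ->
  fn2 (X *m u) ^+ k.+1 <= rtr (X ^+ (2 * k.+1)) * fn2 u ^+ k.+1.
Proof.
move=> /herm_spectral[P [l [P1 P2 eX]]].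
rewrite (rtr_pow_spectral _ P1 P2 eX).
have -> : fn2 (X *m u) = \sum_i l ord0 i ^+ 2 * nsq ((adjmx P *m u) i ord0).
  rewrite eX -!mulmxA (fn2_isom _ P1) fn2_col; apply: eq_bigr => i _.
  by rewrite rdiag_mulE nsqM nsq_toC.
have -> : fn2 u = fn2 (adjmx P *m u) by rewrite (fn2_isom u) // adjmxK.
set v := adjmx P *m u.
under [X in _ <= X * _]eq_bigr => i _ do rewrite exprM.
pose L := \big[Num.max/0]_i l ord0 i ^+ 2.
have L0 : 0 <= L by apply: bigmax_ge_id.
have LP : L ^+ k.+1 <= \sum_i (l ord0 i ^+ 2) ^+ k.+1.
  by apply: bigmax_exp_le => i; apply: sqr_ge0.
apply: (@le_trans _ _ ((L * fn2 v) ^+ k.+1)).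
  apply: lerXn2r; rewrite ?nnegrE ?mulr_ge0 ?fn2_ge0 //.
    by apply: sumr_ge0 => i _; rewrite mulr_ge0 ?sqr_ge0 ?nsq_ge0.
  rewrite fn2_col mulr_sumr; apply: ler_sum => i _; apply: ler_wpM2r.
    exact: nsq_ge0.
  exact: (le_bigmax _ (fun i => l ord0 i ^+ 2)).
by rewrite exprMn; apply: ler_wpM2r => //; rewrite exprn_ge0 ?fn2_ge0.
Qed.

Lemma fn2_pow_le_dil m n (X : 'M[C]_(m, n)) (y : 'cV[C]_n) k :
  fn2 (X *m y) ^+ k.+1 <= rtr (dil X ^+ (2 * k.+1)) * fn2 y ^+ k.+1.
Proof.
have := fn2_mul_pow_le_rtr (col_mx 0 y) k (dil_adj X).
by rewrite fn2_dil_mul mulmx0 fn2_0 addr0 fn2_col_mx fn2_0 add0r.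
Qed.

Lemma fn2_col_pow_le_dil m (X : 'cV[C]_m) k :
  fn2 X ^+ k.+1 <= rtr (dil X ^+ (2 * k.+1)).
Proof.
have := fn2_pow_le_dil X (1%:M) k; rewrite mulmx1.
by rewrite [fn2 1%:M]fn2_col big_ord1 mxE eqxx nsq1 expr1n mulr1.
Qed.
End Khintchine.

(** * Truncated exponential series *)

Section TruncatedExponential.
Variable R : realType.
Implicit Types x y : R.

(** Exponential series cut at degree [p]: a polynomial, so its expectation needs only finitely many
    moments, yet still submultiplicative on nonnegative reals and at least x^p / p!. *)
Definition texp p x : R := \sum_(k < p.+1) x ^+ k / k`!%:R.

Lemma texp_ge0 p x : 0 <= x -> 0 <= texp p x.
Proof. by move=> x0; apply: sumr_ge0 => k _; rewrite divr_ge0 // exprn_ge0. Qed.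

Lemma pow_le_texp p x : 0 <= x -> x ^+ p <= p`!%:R * texp p x.
Proof.
move=> x0; rewrite mulrC -ler_pdivrMr ?ltr0n ?fact_gt0 //.
rewrite /texp (bigD1 ord_max) //= lerDl; apply: sumr_ge0 => k _.
by rewrite divr_ge0 // exprn_ge0.
Qed.

Lemma binom_fact x y k : (x + y) ^+ k / k`!%:R =
  \sum_(i < k.+1) (x ^+ (k - i) / (k - i)`!%:R) * (y ^+ i / i`!%:R).
Proof.
rewrite exprDn mulr_suml; apply: eq_bigr => i _.
have hi : (i <= k)%N by rewrite -ltnS.
have f0 m : m`!%:R != 0 :> R by rewrite pnatr_eq0 -lt0n fact_gt0.
have := bin_fact hi => /(congr1 (fun n => n%:R : R)).
rewrite !natrM => <-; rewrite -mulr_natr.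
have b0 : 'C(k, i)%:R != 0 :> R by rewrite pnatr_eq0 -lt0n bin_gt0.
by field; rewrite !f0 b0.
Qed.

(** By the binomial theorem the left side collects the products of terms with i + j <= p; the right
    side has further terms, all nonnegative. *)
Lemma texpD p x y : 0 <= x -> 0 <= y -> texp p (x + y) <= texp p x * texp p y.
Proof.
move=> x0 y0; pose e (z : R) k := z ^+ k / k`!%:R.
have e0 z k : 0 <= z -> 0 <= e z k by move=> z0; rewrite divr_ge0 // exprn_ge0.
have -> : texp p (x + y) = \sum_(k < p.+1) \sum_(i < p.+1) \sum_(j < p.+1)
    (if (i + j == k)%N then e x i * e y j else 0).
  apply: eq_bigr => k _; rewrite binom_fact.
  have hk : (k.+1 <= p.+1)%N by [].
  rewrite exchange_big /= (big_ord_widen _ (fun i => e x (k - i)%N * e y i) hk) /=.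
  rewrite [LHS]big_mkcond /=; apply: eq_bigr => j _; rewrite ltnS.
  case: leqP => hj; last first.
    rewrite big1 // => i _; case: eqP => // h; move: hj; rewrite -h.
    by rewrite ltnNge leq_addl.
  have hi : (k - j < p.+1)%N by apply: leq_ltn_trans (leq_subr _ _) _.
  rewrite (bigD1 (Ordinal hi)) //= subnK // eqxx big1 ?addr0 // => i ne.
  case: eqP => // h; case/eqP: ne; apply: val_inj => /=.
  by rewrite -h addnK.
rewrite exchange_big /= /texp mulr_suml; apply: ler_sum => i _.
rewrite exchange_big /= mulr_sumr; apply: ler_sum => j _.
rewrite -/(e x i) -/(e y j).
have [h|h] := ltnP (i + j) p.+1; last first.
  rewrite big1 => [|k _]; first by rewrite mulr_ge0 ?e0.
  by case: eqP => // hk; move: h; rewrite hk leqNgt ltn_ord.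
rewrite (bigD1 (Ordinal h)) //= eqxx big1 ?addr0 // => k ne.
case: eqP => // hk; case/eqP: ne; apply: val_inj => /=; by rewrite hk.
Qed.

Lemma texp0 p : texp p 0 = 1.
Proof.
rewrite /texp big_ord_recl expr0 divr1 big1 ?addr0 // => i _.
by rewrite /= exprS mul0r mul0r.
Qed.

Lemma texp_sum p (I : eqType) (s : seq I) (x : I -> R) : (forall i, 0 <= x i) ->
  texp p (\sum_(i <- s) x i) <= \prod_(i <- s) texp p (x i).
Proof.
move=> x0; elim: s => [|i s IH]; first by rewrite !big_nil texp0.
rewrite !big_cons; apply: le_trans (texpD _ _ _) _ => //; first exact: sumr_ge0.
by apply: ler_wpM2l => //; apply: texp_ge0.
Qed.
End TruncatedExponential.

Lemma fact_le_expn n : (n`! <= n ^ n)%N.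
Proof.
elim: n => // n IH; rewrite factS expnS leq_mul //; apply: leq_trans IH _.
by case: n => // n; rewrite leq_exp2r.
Qed.

(** * Tail bound for a matrix Rademacher chaos of order two *)

Section Chaos.
Variable R : realType.
Local Notation C := R[i].
Local Notation toC := (@toC R).
Variables (O Mt : finType).
Local Notation dT := {ffun O * Mt -> bool}.
Local Notation sg d o m := (sgnR R (d (o, m))).

Lemma sum_prod_type (V : nmodType) (f : O * Mt -> V) :
  \sum_q f q = \sum_o \sum_m f (o, m).
Proof. by rewrite pair_bigA; apply: eq_bigr => -[o m] _. Qed.

(** Independence of the rows: [Ex_mix] resamples row [o] alone and leaves the other factors
    unchanged. *)
Lemma Ex_prod_rows (F : O -> dT -> R) (s : seq O) : uniq s ->
  (forall o d, 0 <= F o d) ->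
  (forall o (d d' : dT), (forall m, d (o, m) = d' (o, m)) -> F o d = F o d') ->
  Ex (fun d => \prod_(o <- s) F o d) = \prod_(o <- s) Ex (F o).
Proof.
move=> us F0 hF; elim: s us => [|o s IH] /=.
  by move=> _; rewrite big_nil -[RHS](Ex_cst (O * Mt)%type 1); apply: eq_Ex => d; rewrite big_nil.
move=> /andP[os us]; rewrite big_cons -IH //.
pose A (q : O * Mt) := q.1 == o.
rewrite -(Ex_mix A (fun d => \prod_(j <- o :: s) F j d)).
transitivity (Ex (fun d : dT => Ex (fun d' => (\prod_(j <- s) F j d) * F o d'))).
  apply: eq_Ex => d; apply: eq_Ex => d'; rewrite big_cons mulrC; congr (_ * _).
    rewrite big_seq [RHS]big_seq; apply: eq_bigr => j js; apply: hF => m.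
    rewrite ffunE /A /=; case: eqP => // e; by move: os; rewrite -e js.
  by apply: hF => m; rewrite ffunE /A /= eqxx.
transitivity (Ex (fun d : dT => Ex (F o) * \prod_(j <- s) F j d)).
  by apply: eq_Ex => d; rewrite ExZ mulrC.
by rewrite ExZ.
Qed.

(** The linear form in the signs outside the split [eta]; these are independent of the signs inside,
    which is what decoupling requires. *)
Definition halfform (eta : {ffun Mt -> bool}) (z : O -> Mt -> C) o (d : dT) : C :=
  \sum_(m | ~~ eta m) toC (sg d o m) * z o m.

(** [khintchine] for scalars seen as 1 by 1 matrices; the leading 2 is the size of their
    dilation. *)
Lemma halfform_moment eta z o k :
  Ex (fun d => nsq (halfform eta z o d) ^+ k.+1) <=
  2 * ((2 * \sum_m nsq (z o m)) ^+ k.+1 * k.+1`!%:R).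
Proof.
pose A (q : O * Mt) : 'M[C]_1 :=
  if (q.1 == o) && ~~ eta q.2 then (z o q.2)%:M else 0.
have eA d : rademacher A d = (halfform eta z o d)%:M.
  rewrite /rademacher sum_prod_type.
  rewrite (bigD1 o) //= [X in _ + X]big1 => [|o' ne]; last first.
    by apply: big1 => m _; rewrite /A /= (negPf ne) scaler0.
  rewrite addr0 /halfform raddf_sum /= [RHS]big_mkcond; apply: eq_bigr => m _ /=.
  rewrite /A /= eqxx /=; case: (eta m) => /=; first by rewrite scaler0.
  by rewrite scale_scalar_mx.
set s := \sum_m nsq (z o m).
have s0 : 0 <= s by apply: sumr_ge0 => m _; apply: nsq_ge0.
have fs (c : C) : fn2 (c%:M : 'M_1) = nsq c.
  by rewrite fn2_col big_ord1 mxE eqxx mulr1n.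
have fA q : fn2 (A q) <= if q.1 == o then nsq (z o q.2) else 0.
  rewrite /A; case: eqP => /= _; last by rewrite fn2_0.
  by case: (eta q.2) => /=; rewrite ?fs // fn2_0 nsq_ge0.
have sA : \sum_q fn2 (A q) <= s.
  apply: le_trans (ler_sum _ (fun q _ => fA q)) _.
  rewrite sum_prod_type /=.
  rewrite (bigD1 o) //= [X in _ + X]big1 ?addr0 => [|o' ne]; last first.
    by apply: big1 => m _; rewrite (negPf ne).
  by under eq_bigr do rewrite eqxx.
have := khintchine k.+1 s0 (fun q => dil_adj (A q)).
move=> /(_ _)/le_trans-/(_ _ _ (lexx _)) kh.
apply: le_trans (le_trans _ (kh _)) _.
- apply: Ex_le => d; have := fn2_col_pow_le_dil (rademacher A d) k.
  by rewrite dil_rademacher eA fs.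
- move=> x; rewrite -[x]vsubmxK; under eq_bigr do rewrite fn2_dil_mul.
  rewrite fn2_col_mx mulrDr big_split /= addrC; apply: lerD.
    apply: le_trans (ler_sum _ (fun q _ => opb_mul _ (opb_fn2 (adjmx (A q))))) _.
    rewrite -mulr_suml ler_wpM2r ?fn2_ge0 //.
    by under eq_bigr do rewrite fn2_adj.
  apply: le_trans (ler_sum _ (fun q _ => opb_mul _ (opb_fn2 (A q)))) _.
  by rewrite -mulr_suml ler_wpM2r ?fn2_ge0.
rewrite le_eqVlt; apply/orP; left; apply/eqP.
rewrite natrM natrX exprMn addn1; ring.
Qed.

Lemma geom_le2 (x : R) p : 0 <= x -> x <= 2^-1 -> \sum_(k < p) x ^+ k <= 2.
Proof.
move=> x0 x1; have h : (1 - x) * \sum_(k < p) x ^+ k <= 1.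
  by rewrite -opprB mulNr -subrX1 opprB lerBlDr lerDl exprn_ge0.
have S0 : 0 <= \sum_(k < p) x ^+ k by apply: sumr_ge0 => k _; apply: exprn_ge0.
move: h S0; set S := \sum_(k < p) _ => h S0; nra.
Qed.

(** The factorial in the moment bound cancels the one in the series. What remains is geometric in x
    = 2 th s <= 1/2, with s the sum of the squared coefficients, hence at most 1 + 4 x. *)
Lemma halfform_texp eta z o p (th : R) : 0 <= th ->
  2 * th * \sum_m nsq (z o m) <= 2^-1 ->
  Ex (fun d => texp p (th * nsq (halfform eta z o d))) <=
  expR (8 * th * \sum_m nsq (z o m)).
Proof.
set s := \sum_m _ => th0 hs.
have s0 : 0 <= s by apply: sumr_ge0 => m _; apply: nsq_ge0.
set x := 2 * th * s in hs.
have x0 : 0 <= x by rewrite !mulr_ge0.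
have -> : Ex (fun d => texp p (th * nsq (halfform eta z o d))) =
   \sum_(k < p.+1) th ^+ k / k`!%:R * Ex (fun d => nsq (halfform eta z o d) ^+ k).
  rewrite /texp Ex_sum; apply: eq_bigr => k _; rewrite -ExZ; apply: eq_Ex => d.
  by rewrite exprMn mulrAC.
rewrite big_ord_recl expr0 divr1 mul1r.
have -> : Ex (fun d => nsq (halfform eta z o d) ^+ 0) = 1.
  by rewrite -[RHS](Ex_cst (O * Mt)%type 1).
apply: le_trans (expR_ge1Dx _); rewrite lerD2l.
apply: (@le_trans _ _ (2 * x * \sum_(k < p) x ^+ k)); last first.
  have := geom_le2 p x0 hs => /(ler_wpM2l (mulr_ge0 (ler0n R 2) x0)).
  by rewrite /x; set S := \sum_(k < p) _; lra.
rewrite mulr_sumr; apply: ler_sum => k _; rewrite lift0.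
apply: le_trans (ler_wpM2l _ (halfform_moment eta z o k)) _.
  by rewrite divr_ge0 // exprn_ge0.
rewrite -/s le_eqVlt; apply/orP; left; apply/eqP.
have f0 : k.+1`!%:R != 0 :> R by rewrite pnatr_eq0 -lt0n fact_gt0.
have -> : x = 2 * s * th by rewrite /x; ring.
rewrite !exprMn !exprS; field.
by [].
Qed.

Lemma halfform_row eta z o (d d' : dT) :
  (forall m, d (o, m) = d' (o, m)) -> halfform eta z o d = halfform eta z o d'.
Proof. by move=> h; apply: eq_bigr => m _; rewrite h. Qed.

(** A Bernstein-type estimate: independent rows turn the truncated exponential moment of the sum
    into a product, and the power is recovered from the single term of degree p + 1. *)
Lemma halfform_quad_moment eta z (c : O -> R) (sig2 B2 : R) p :
  (forall o, 0 <= c o) -> 0 < B2 -> 0 <= sig2 ->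
  \sum_o c o * \sum_m nsq (z o m) <= sig2 ->
  (forall o, c o * \sum_m nsq (z o m) <= B2) ->
  Ex (fun d => (\sum_o c o * nsq (halfform eta z o d)) ^+ p.+1) <=
  (4 * expR 2 * (p.+1%:R * B2 + sig2)) ^+ p.+1.
Proof.
move=> c0 B0 s0 hs hB; set P : R := p.+1%:R.
have P0 : 0 < P by rewrite ltr0n.
(* This value makes th times each row term at most 1/4, as [halfform_texp] requires, and th times
   their total at most P / 4, so that the product of exponentials is at most exp (2 P). *)
pose th := (4 * (B2 + sig2 / P))^-1.
have D0 : 0 < B2 + sig2 / P by rewrite ltr_wpDr // divr_ge0 // ltW.
have th0 : 0 < th by rewrite invr_gt0 mulr_gt0.
have zz o : 0 <= \sum_m nsq (z o m) by apply: sumr_ge0 => m _; apply: nsq_ge0.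
have b1 o : Ex (fun d => texp p.+1 (th * c o * nsq (halfform eta z o d))) <=
   expR (8 * th * (c o * \sum_m nsq (z o m))).
  apply: le_trans (@halfform_texp eta z o p.+1 (th * c o) _ _) _.
  - by rewrite mulr_ge0 // ltW.
  - have : th * (c o * \sum_m nsq (z o m)) <= 4^-1.
      rewrite /th mulrC ler_pdivrMr ?mulr_gt0 // mulKf ?pnatr_eq0 //.
      by apply: le_trans (hB o) _; rewrite lerDl divr_ge0 // ltW.
    by move: (\sum_m nsq (z o m)) => u; lra.
  by rewrite ler_expR !mulrA.
set Q := fun d => \sum_o c o * nsq (halfform eta z o d).
have Q0 d : 0 <= Q d by apply: sumr_ge0 => o _; rewrite mulr_ge0 // nsq_ge0.
have b2 : Ex (fun d => texp p.+1 (th * Q d)) <= expR (2 * P).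
  apply: (@le_trans _ _ (Ex (fun d => \prod_(o <- index_enum O)
     texp p.+1 (th * c o * nsq (halfform eta z o d))))).
    apply: Ex_le => d.
    have -> : th * Q d = \sum_o th * c o * nsq (halfform eta z o d).
      by rewrite mulr_sumr; apply: eq_bigr => o _; rewrite mulrA.
    by apply: texp_sum => o; rewrite !mulr_ge0 ?nsq_ge0 // ltW.
  rewrite Ex_prod_rows ?index_enum_uniq //; last 2 first.
  - by move=> o d; apply: texp_ge0; rewrite !mulr_ge0 ?nsq_ge0 // ltW.
  - by move=> o d d' h; rewrite (halfform_row _ _ h).
  apply: (@le_trans _ _ (\prod_(o <- index_enum O) expR (8 * th * (c o * \sum_m nsq (z o m))))).
    apply: ler_prod => o _; rewrite b1 andbT; apply: Ex_ge0 => d.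
    by apply: texp_ge0; rewrite !mulr_ge0 ?nsq_ge0 // ltW.
  rewrite -expR_sum ler_expR -mulr_sumr.
  have : th * \sum_o c o * (\sum_m nsq (z o m)) <= P / 4.
    rewrite /th mulrC ler_pdivrMr ?mulr_gt0 //; apply: le_trans hs _.
    have -> : P / 4 * (4 * (B2 + sig2 / P)) = P * B2 + sig2.
      have fe (q : R) : q != 0 -> q / 4 * (4 * (B2 + sig2 / q)) = q * B2 + sig2.
        by move=> q0; field.
      by rewrite fe ?lt0r_neq0.
    by rewrite lerDr mulr_ge0 // ltW.
  by move: (\sum_o c o * _) => u; lra.
have -> : 4 * expR 2 * (P * B2 + sig2) = P * expR 2 / th.
  have fe (q e : R) : q != 0 -> 4 * e * (q * B2 + sig2) = q * e * (4 * (B2 + sig2 / q)).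
    by move=> q0; field.
  by rewrite fe ?lt0r_neq0 // /th invrK.
apply: (@le_trans _ _ (Ex (fun d => th ^- p.+1 * (p.+1`!%:R * texp p.+1 (th * Q d))))).
  apply: Ex_le => d; rewrite ler_pdivlMl ?exprn_gt0 // -exprMn.
  by apply: pow_le_texp; apply: mulr_ge0; [exact: ltW|exact: Q0].
rewrite 2!ExZ expr_div_n mulrC; apply: ler_wpM2r.
  by rewrite invr_ge0 exprn_ge0 // ltW.
rewrite exprMn; apply: ler_pM => //.
- by apply: Ex_ge0 => d; apply: texp_ge0; apply: mulr_ge0; [exact: ltW|exact: Q0].
- by rewrite /P -natrX ler_nat fact_le_expn.
- apply: le_trans b2 _; by rewrite mulrC expRM_natl.
Qed.

(** Among the four patterns obtained by flipping at m and m', exactly one contains m and omits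
    m'. *)
Lemma Ex_split_pair (m m' : Mt) : m' != m ->
  Ex (fun eta : {ffun Mt -> bool} => (eta m && ~~ eta m')%:R : R) = 4^-1.
Proof.
move=> ne; set F := fun eta : {ffun Mt -> bool} => (eta m && ~~ eta m')%:R : R.
have F1 : Ex (fun eta => F (flip m eta)) = Ex F := Ex_reindex F (flipK m).
have F2 : Ex (fun eta => F (flip m' eta)) = Ex F := Ex_reindex F (flipK m').
have F3 : Ex (fun eta => F (flip m (flip m' eta))) = Ex F.
  by rewrite (Ex_reindex (fun eta => F (flip m eta)) (flipK m')).
have : Ex (fun eta => F eta + F (flip m eta) + (F (flip m' eta) + F (flip m (flip m' eta)))) = 1.
  rewrite -[RHS](Ex_cst Mt 1); apply: eq_Ex => eta.
  rewrite /F !ffunE !eqxx (negPf ne) eq_sym (negPf ne).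
  by case: (eta m); case: (eta m'); rewrite /= ?addr0 ?add0r.
rewrite ExD !(ExD _ (fun eta => F (flip _ _))) F1 F2 F3.
by move: (Ex F) => x; lra.
Qed.

Variables (a b : nat).

Definition chaos (z : O -> Mt -> C) (A : O -> Mt -> 'M[C]_(a, b)) (d : dT) : 'M[C]_(a, b) :=
  \sum_o \sum_m \sum_(m' | m' != m) (toC (sg d o m * sg d o m') * z o m') *: A o m.

Definition half_chaos (eta : {ffun Mt -> bool}) z (A : O -> Mt -> 'M[C]_(a, b)) (d : dT) :=
  \sum_o \sum_(m | eta m) (toC (sg d o m) * halfform eta z o d) *: A o m.

Lemma half_chaosE eta z A d : half_chaos eta z A d =
  \sum_o \sum_m \sum_m' toC (eta m && ~~ eta m')%:R *:
     ((toC (sg d o m * sg d o m') * z o m') *: A o m).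
Proof.
apply: eq_bigr => o _; rewrite big_mkcond /=; apply: eq_bigr => m _.
case: (eta m); last by rewrite big1 // => m' _; rewrite (toCE 0) rmorph0 scale0r.
rewrite /halfform mulr_sumr scaler_suml big_mkcond; apply: eq_bigr => m' _ /=.
case: (eta m') => /=; first by rewrite (toCE 0) rmorph0 scale0r.
by rewrite (toCE 1) rmorph1 scale1r mulrA -toCM.
Qed.

(* Decoupling: a quarter of the splits [eta] separate an ordered pair of distinct columns. *)
Lemma chaos_decouple z A d : chaos z A d =
  toC (#|{: {ffun Mt -> bool}}|%:R)^-1 *: \sum_eta toC 4 *: half_chaos eta z A d.
Proof.
under [in RHS]eq_bigr do rewrite half_chaosE scaler_sumr.
rewrite exchange_big scaler_sumr; apply: eq_bigr => o _ /=.
under [in RHS]eq_bigr do rewrite scaler_sumr.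
rewrite exchange_big scaler_sumr; apply: eq_bigr => m _ /=.
under [in RHS]eq_bigr do rewrite scaler_sumr.
rewrite exchange_big scaler_sumr big_mkcond; apply: eq_bigr => m' _ /=.
under [in RHS]eq_bigr do rewrite scalerA.
rewrite -scaler_suml scalerA.
under [in RHS]eq_bigr do rewrite -toCM.
rewrite -toC_sum -toCM -mulr_sumr mulrCA [_^-1 * _]mulrC -/(Ex _).
case: ifP => [ne|/negbFE/eqP ->].
  by rewrite Ex_split_pair // mulfV ?pnatr_eq0 // (toCE 1) rmorph1 scale1r.
rewrite (@eq_Ex _ _ _ (fun=> 0)) ?Ex_cst ?mulr0 ?(toCE 0) ?rmorph0 ?scale0r //.
by move=> eta; rewrite andbN.
Qed.

(** The row and column matrix variances of the weighted family are bounded through finitely many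
    linear functionals [c j] of the weights. The weights will be random, and a maximum over a finite
    [J] costs only a factor #|J| in a moment bound, which a supremum over vectors does not allow. *)
Definition dominated (J : finType) (A : O -> Mt -> 'M[C]_(a, b)) (c : J -> O -> R) :=
  forall (w : O -> R) t, (forall o, 0 <= w o) ->
    (forall j, \sum_o c j o * w o <= t) ->
    (forall y : 'cV_b, \sum_o w o * \sum_m fn2 (A o m *m y) <= t * fn2 y) /\
    (forall x : 'cV_a, \sum_o w o * \sum_m fn2 (adjmx (A o m) *m x) <= t * fn2 x).

Lemma half_chaos_khintchine (J : finType) A (c : J -> O -> R) eta z (d : dT) p :
  dominated A c ->
  Ex (fun d' => rtr (dil (toC 4 *: half_chaos eta z A (mix (fun q => eta q.2) d d'))
        ^+ (2 * p))) <=
  (2 ^ p * p`!)%:R *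
  (16 * \big[Num.max/0]_j \sum_o c j o * nsq (halfform eta z o d)) ^+ p * (a + b)%:R.
Proof.
move=> domA; set t := \big[_/_]_j _.
have t0 : 0 <= t by apply: bigmax_ge_id.
pose B (q : O * Mt) : 'M[C]_(a, b) :=
  if eta q.2 then halfform eta z q.1 d *: A q.1 q.2 else 0.
have hmix o d' : halfform eta z o (mix (fun q => eta q.2) d d') = halfform eta z o d.
  by apply: eq_bigr => m /negPf em; rewrite ffunE /= em.
have eB d' : dil (toC 4 *: half_chaos eta z A (mix (fun q => eta q.2) d d')) =
    rademacher (fun q => dil (toC 4 *: B q)) d'.
  rewrite -dil_rademacher; congr dil; rewrite /rademacher sum_prod_type scaler_sumr.
  apply: eq_bigr => o _; rewrite scaler_sumr big_mkcond; apply: eq_bigr => m _.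
  rewrite /B /=; case: ifP => em; last by rewrite !scaler0.
  by rewrite hmix ffunE /= em !scalerA; congr (_ *: _); ring.
under eq_Ex do rewrite eB.
have [h1 h2] : (forall y : 'cV_b, \sum_o nsq (halfform eta z o d) *
                   \sum_m fn2 (A o m *m y) <= t * fn2 y) /\
    (forall x : 'cV_a, \sum_o nsq (halfform eta z o d) *
                   \sum_m fn2 (adjmx (A o m) *m x) <= t * fn2 x).
  apply: domA => [o|j]; first exact: nsq_ge0.
  exact: (le_bigmax _ (fun j => \sum_o c j o * nsq (halfform eta z o d))).
apply: khintchine => [|q|x]; first by rewrite mulr_ge0.
  exact: dil_adj.
rewrite -[x]vsubmxK; move: (usubmx x) (dsubmx x) => {}x y.
under eq_bigr do rewrite fn2_dil_mul adjmxZ -!scalemxAl !fn2Z nsqJ nsq_toC -mulrDr.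
rewrite -mulr_sumr big_split /= fn2_col_mx addrC mulrDr.
have -> : 4 ^+ 2 = 16 :> R by ring.
rewrite -mulrDr -mulrA; apply: ler_wpM2l => //.
rewrite mulrDr; apply: lerD.
  apply: le_trans (h2 x); rewrite sum_prod_type; apply: ler_sum => o _.
  rewrite mulr_sumr; apply: ler_sum => m _; rewrite /B /=; case: (eta m).
    by rewrite adjmxZ -scalemxAl fn2Z nsqJ.
  by rewrite adjmx0 mul0mx fn2_0 mulr_ge0 ?nsq_ge0 ?fn2_ge0.
apply: le_trans (h1 y); rewrite sum_prod_type; apply: ler_sum => o _.
rewrite mulr_sumr; apply: ler_sum => m _; rewrite /B /=; case: (eta m).
  by rewrite -scalemxAl fn2Z.
by rewrite mul0mx fn2_0 mulr_ge0 ?nsq_ge0 ?fn2_ge0.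
Qed.

Section ChaosBound.
Variables (J : finType) (A : O -> Mt -> 'M[C]_(a, b)) (c : J -> O -> R).
Variables (z : O -> Mt -> C) (sig2 B2 : R) (p : nat).
Hypotheses (domA : dominated A c) (c0 : forall j o, 0 <= c j o).
Hypotheses (B20 : 0 < B2) (sig20 : 0 <= sig2).
Hypothesis hsig : forall j, \sum_o c j o * \sum_m nsq (z o m) <= sig2.
Hypothesis hB : forall j o, c j o * \sum_m nsq (z o m) <= B2.

Let P : R := p.+1%:R.

Lemma half_chaos_moment eta :
  Ex (fun d => rtr (dil (toC 4 *: half_chaos eta z A d) ^+ (2 * p.+1))) <=
  (a + b)%:R * #|J|%:R * (128 * expR 2 * P * (P * B2 + sig2)) ^+ p.+1.
Proof.
rewrite -(Ex_mix (fun q => eta q.2)).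
apply: le_trans (Ex_le (fun d => half_chaos_khintchine eta z d p.+1 domA)) _.
pose Q j d := \sum_o c j o * nsq (halfform eta z o d).
have Q0 j d : 0 <= Q j d by apply: sumr_ge0 => o _; rewrite mulr_ge0 ?nsq_ge0.
pose K : R := (2 ^ p.+1 * p.+1`!)%:R * 16 ^+ p.+1 * (a + b)%:R.
have K0 : 0 <= K by rewrite !mulr_ge0 // exprn_ge0.
apply: (@le_trans _ _ (Ex (fun d => K * \sum_j Q j d ^+ p.+1))).
  apply: Ex_le => d; rewrite exprMn mulrA mulrAC -/K; apply: ler_wpM2l => //.
  by apply: bigmax_exp_le => j; exact: Q0.
rewrite ExZ Ex_sum.
have hQ j : Ex (fun d => Q j d ^+ p.+1) <= (4 * expR 2 * (P * B2 + sig2)) ^+ p.+1.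
  by apply: halfform_quad_moment => // o.
apply: le_trans (ler_wpM2l K0 (ler_sum _ (fun j _ => hQ j))) _.
rewrite sumr_const -[X in K * X]mulr_natl.
have PB : 0 <= P * B2 + sig2 by rewrite addr_ge0 // mulr_ge0 // ltW.
have -> : (128 * expR 2 * P * (P * B2 + sig2)) ^+ p.+1 =
   2 ^+ p.+1 * P ^+ p.+1 * 16 ^+ p.+1 * (4 * expR 2 * (P * B2 + sig2)) ^+ p.+1.
  by rewrite -!exprMn; congr (_ ^+ _); ring.
rewrite /K natrM natrX; set Y := (4 * _ * _) ^+ p.+1.
have Y0 : 0 <= Y by rewrite exprn_ge0 // !mulr_ge0 // expR_ge0.
clearbody Y.
have : p.+1`!%:R <= P ^+ p.+1 :> R by rewrite -natrX ler_nat fact_le_expn.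
have K'0 : 0 <= 2 ^+ p.+1 * 16 ^+ p.+1 * (a + b)%:R * (#|J|%:R * Y) by rewrite !mulr_ge0 ?exprn_ge0 //.
move=> /(ler_wpM2l K'0); congr (_ <= _); ring.
Qed.

(** By [chaos_decouple] the chaos is an average of half chaoses, and trace powers of even order are
    convex. *)
Lemma chaos_moment :
  Ex (fun d => rtr (dil (chaos z A d) ^+ (2 * p.+1))) <=
  (a + b)%:R * #|J|%:R * (128 * expR 2 * P * (P * B2 + sig2)) ^+ p.+1.
Proof.
pose X (d : dT) (eta : {ffun Mt -> bool}) := dil (toC 4 *: half_chaos eta z A d).
have hX d : dil (chaos z A d) = toC (#|{: {ffun Mt -> bool}}|%:R)^-1 *: \sum_eta X d eta.
  by rewrite chaos_decouple dilZ dil_sum.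
have J0 : (0 < #|{: {ffun Mt -> bool}}|)%N by rewrite -(ltr0n R); apply: card_ffun_gt0.
apply: (@le_trans _ _ (Ex (fun d => #|{: {ffun Mt -> bool}}|%:R^-1 *
    \sum_eta rtr (X d eta ^+ (2 * p.+1))))).
  by apply: Ex_le => d; rewrite hX; apply: rtr_pow_jensen => // eta; apply: dil_adj.
rewrite ExZ Ex_sum ler_pdivrMl ?ltr0n //.
apply: le_trans (ler_sum _ (fun eta _ => half_chaos_moment eta)) _.
by rewrite sumr_const -[X in X <= _]mulr_natl.
Qed.

(** Markov for the trace moment of order 2 (p + 1). The threshold exceeds the moment scale by a
    factor e, whose power p + 1 becomes exp (- P). *)
Lemma chaos_tail t : 0 < t -> expR 1 * (128 * expR 2 * P * (P * B2 + sig2)) <= t ->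
  Pr R (fun d => exists y : 'cV_b, t * fn2 y < fn2 (chaos z A d *m y)) <=
  (a + b)%:R * #|J|%:R * expR (- P).
Proof.
move=> t0; set E := 128 * _ * _ * _ => ht.
have E0 : 0 <= E.
  by rewrite !mulr_ge0 ?expR_ge0 // addr_ge0 // mulr_ge0 // ltW.
apply: le_trans (@markov_Pr _ _ (fun d => rtr (dil (chaos z A d) ^+ (2 * p.+1))) _
  (t ^+ p.+1) _ _ _) _.
- exact: exprn_gt0.
- by move=> d; apply: rtr_even_pow_ge0; apply: dil_adj.
- move=> d [y hy]; have y0 : 0 < fn2 y.
    rewrite lt_neqAle fn2_ge0 andbT eq_sym; apply/eqP => y0.
    by move: hy; rewrite (fn2_eq0 y0) mulmx0 !fn2_0 mulr0 ltxx.
  have := fn2_pow_le_dil (chaos z A d) y p; rewrite -ler_pdivrMr ?exprn_gt0 //.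
  apply: le_trans; rewrite ler_pdivlMr ?exprn_gt0 // -exprMn.
  by apply: lerXn2r; rewrite ?nnegrE ?fn2_ge0 ?mulr_ge0 ?fn2_ge0 // ltW.
rewrite ler_pdivrMr ?exprn_gt0 //; apply: le_trans chaos_moment _; rewrite -/E.
rewrite -[leRHS]mulrA; apply: ler_wpM2l; first by rewrite mulr_ge0.
have -> : expR (- P) = expR (- 1) ^+ p.+1 by rewrite -expRM_natl mulrN1.
rewrite -exprMn; apply: lerXn2r; rewrite ?nnegrE //.
  by rewrite mulr_ge0 ?expR_ge0 // ltW.
by rewrite expRN mulrC ler_pdivlMr ?expR_gt0 // mulrC.
Qed.
End ChaosBound.
End Chaos.

(** * Roots of unity, Parseval and Plancherel-Polya *)

Section SinBound.
Import numFieldNormedType.Exports.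

Lemma sin_abs_le (R : realType) (t : R) : 0 <= t -> `|sin t| <= t.
Proof.
move=> t0; have [|c _] := @MVT_segment R sin cos 0 t t0 (fun x _ => is_derive_sin x).
  by apply/continuous_subspaceT => x; exact: continuous_sin.
rewrite sin0 !subr0 => ->; rewrite normrM (ger0_norm t0) ler_piMl //.
exact: cos_max.
Qed.
End SinBound.

Section Roots.
Variable R : realType.
Local Notation C := R[i].
Local Notation toC := (@toC R).

Lemma pi_le4 : pi <= 4 :> R.
Proof. by have [/andP[_ h] _] := pihalf_02_cos_pihalf R; lra. Qed.

Lemma expiD (s t : R) : expi (s + t) = expi s * expi t.
Proof.
apply/eqP; rewrite eq_complex /= cosD sinD; apply/andP; split; apply/eqP; ring.
Qed.
Lemma expi0 : expi 0 = 1 :> C.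
Proof. by rewrite /expi cos0 sin0. Qed.
Lemma expiX (t : R) n : expi t ^+ n = expi (t *+ n).
Proof. by elim: n => [|n IH]; rewrite ?mulr0n ?expi0 // exprS IH -expiD mulrS. Qed.
Lemma conj_expi (t : R) : conjc (expi t) = expi (- t).
Proof. by rewrite /expi cosN sinN. Qed.
Lemma nsq_expi (t : R) : nsq (expi t) = 1.
Proof. by rewrite /nsq /= cos2Dsin2. Qed.
Lemma nsq_expiB1 (t : R) : nsq (expi t - 1) = 2 - 2 * cos t.
Proof.
rewrite /nsq /=; have := cos2Dsin2 t; move: (cos t) (sin t) => c s h.
by transitivity (c ^+ 2 + s ^+ 2 + 1 - 2 * c); [ring|rewrite h; ring].
Qed.

Lemma nsq_expiB1_le (t : R) : 0 <= t -> nsq (expi t - 1) <= t ^+ 2.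
Proof.
move=> t0; rewrite nsq_expiB1; have e : t = (t / 2) *+ 2 by rewrite -[RHS]mulr_natr divfK ?pnatr_eq0.
have : `|sin (t / 2)| <= t / 2 by apply: sin_abs_le; rewrite divr_ge0.
rewrite [in cos t]e cos_mulr2n cos2sin2 => /(@lerXn2r _ 2 _ _ (normr_ge0 _)).
rewrite nnegrE divr_ge0 // real_normK ?num_real // => /(_ isT).
set u := sin _ ^+ 2; set v := (t / 2) ^+ 2.
have -> : t ^+ 2 = 4 * v by rewrite /v; field.
by clearbody u v; rewrite mulr2n; lra.
Qed.

Definition zeta (Om : nat) : C := expi (- (2 * pi / Om%:R)).

Lemma nsq_zeta Om : nsq (zeta Om) = 1.
Proof. exact: nsq_expi. Qed.

Lemma nsqX (z : C) n : nsq (z ^+ n) = nsq z ^+ n.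
Proof. by elim: n => [|n IH]; rewrite ?nsq1 // !exprS nsqM IH. Qed.

Lemma zetaJ Om n : conjc (zeta Om) ^+ n * zeta Om ^+ n = 1.
Proof. by rewrite -exprMn -nsqE nsq_zeta (toCE 1) rmorph1 expr1n. Qed.

Lemma zetaX Om n : (0 < Om)%N -> zeta Om ^+ n = conjc (expi (2 * pi * n%:R / Om%:R)).
Proof.
move=> Om0; rewrite /zeta expiX conj_expi; congr expi.
by rewrite mulNrn -[_ *+ n]mulr_natr; congr (- _); rewrite mulrAC.
Qed.

Lemma zeta_Om Om : (0 < Om)%N -> zeta Om ^+ Om = 1.
Proof.
move=> Om0; rewrite zetaX // mulfK ?pnatr_eq0 -?lt0n // /expi.
by rewrite (_ : 2 * pi = pi *+ 2) ?cos2pi ?sin2pi /= ?oppr0 // mulr_natl.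
Qed.

Lemma nsq_zetaB1 Om n : (0 < Om)%N ->
  nsq (zeta Om ^+ n - 1) = 2 - 2 * cos (2 * pi * n%:R / Om%:R).
Proof.
move=> Om0; rewrite zetaX // -nsq_expiB1 -[RHS]nsqJ; congr nsq.
by rewrite rmorphB /= oppr0.
Qed.

Lemma zeta_neq1 Om n : (0 < n < Om)%N -> zeta Om ^+ n != 1.
Proof.
move=> /andP[n0 nOm]; have Om0 : (0 < Om)%N by apply: leq_ltn_trans nOm.
rewrite -subr_eq0 -nsq_eq0 nsq_zetaB1 //.
pose x : R := pi * n%:R / Om%:R; have e : 2 * pi * n%:R / Om%:R = x *+ 2.
  by rewrite mulr2n /x; ring.
have OmR : 0 < Om%:R :> R by rewrite ltr0n.
have sx : 0 < sin x.
  apply: sin_gt0_pi; rewrite divr_gt0 ?mulr_gt0 ?pi_gt0 ?ltr0n //=.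
  by rewrite ltr_pdivrMr // ltr_pM2l ?pi_gt0 // ltr_nat.
rewrite e cos_mulr2n cos2sin2; have -> : 2 - 2 * ((1 - sin x ^+ 2) *+ 2 - 1) = 4 * sin x ^+ 2.
  by rewrite mulr2n; ring.
by rewrite mulf_neq0 ?pnatr_eq0 // expf_neq0 // lt0r_neq0.
Qed.

Lemma sum_unity_root Om (xi : C) : xi ^+ Om = 1 -> xi != 1 -> \sum_(n < Om) xi ^+ n = 0.
Proof.
move=> h1 h2; have := subrX1 xi Om; rewrite h1 subrr => /esym/eqP.
by rewrite mulf_eq0 subr_eq0 (negPf h2) => /eqP.
Qed.

(** Only the difference of the exponents matters, and its sign only up to conjugation; this reduces
    later estimates to positive powers of [zeta]. *)
Lemma zeta_unitary_cases Om a b : (a != b) ->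
  exists u, [/\ (0 < u)%N, (u <= maxn a b)%N &
    zeta Om ^+ a * conjc (zeta Om) ^+ b = zeta Om ^+ u \/
    zeta Om ^+ a * conjc (zeta Om) ^+ b = conjc (zeta Om ^+ u)].
Proof.
have e n : zeta Om ^+ n * conjc (zeta Om) ^+ n = 1 by rewrite mulrC zetaJ.
case: ltngtP => // ab _.
  exists (b - a)%N; split; [by rewrite subn_gt0|exact: leq_subr|right].
  by rewrite -{1}(subnK (ltnW ab)) exprD mulrCA e mulr1 rmorphXn.
exists (a - b)%N; split; [by rewrite subn_gt0|exact: leq_subr|left].
by rewrite -{1}(subnK (ltnW ab)) exprD -mulrA e mulr1.
Qed.

Lemma zeta_unitary_neq1 Om a b : (a != b) -> (a < Om)%N -> (b < Om)%N ->
  zeta Om ^+ a * conjc (zeta Om) ^+ b != 1.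
Proof.
move=> ab aO bO; have [u [u0 um h]] := zeta_unitary_cases Om ab.
have h1 : zeta Om ^+ u != 1.
  by apply: zeta_neq1; rewrite u0 (leq_ltn_trans um) // gtn_max aO bO.
by case: h => -> //; rewrite -(inj_eq (inv_inj (@conjcK R))) conjcK conjc1.
Qed.

Lemma zeta_unitary_Om Om a b : (0 < Om)%N ->
  (zeta Om ^+ a * conjc (zeta Om) ^+ b) ^+ Om = 1.
Proof.
move=> Om0; have e : conjc (zeta Om) ^+ Om = 1.
  by rewrite -(rmorphXn (@conjc R)) /= zeta_Om // conjc1.
by rewrite exprMn exprAC zeta_Om // expr1n exprAC e expr1n mulr1.
Qed.

(** [fcol] indexed by all natural numbers, so that windows of frequencies may run past [Om]. *)
Definition fvec (W Om n : nat) : 'cV[C]_W :=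
  \col_w (toC (Num.sqrt Om%:R)^-1 * zeta Om ^+ (w * n)).

Lemma fcolE W Om (om : 'I_Om) : fcol R W om = fvec W Om om.
Proof.
apply/matrixP => w j; rewrite !mxE; congr (_ * _).
rewrite /zeta expiX; congr expi; rewrite mulNrn -[_ *+ (_ * _)]mulr_natr natrM.
by congr (- _); rewrite mulrAC.
Qed.

Lemma sqrt_inv_sqr Om : ((Num.sqrt Om%:R)^-1 : R) ^+ 2 = Om%:R^-1.
Proof. by rewrite exprVn sqr_sqrtr. Qed.

Lemma fn2_fvec W Om n : fn2 (fvec W Om n) = W%:R / Om%:R.
Proof.
rewrite fn2_col; under eq_bigr do rewrite mxE nsqM nsq_toC sqrt_inv_sqr nsqX nsq_zeta expr1n mulr1.
by rewrite sumr_const card_ord mulr_natl.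
Qed.

Lemma fvec_periodic W Om n : (0 < Om)%N -> fvec W Om (n + Om) = fvec W Om n.
Proof.
move=> Om0; apply/matrixP => w j; rewrite !mxE mulnDr exprD (mulnC w Om).
by rewrite (exprM _ Om) zeta_Om // expr1n mulr1.
Qed.

Lemma fvec_outer W Om n a b : (fvec W Om n *m adjmx (fvec W Om n)) a b =
  toC Om%:R^-1 * (zeta Om ^+ a * conjc (zeta Om) ^+ b) ^+ n.
Proof.
rewrite mxE big_ord1 adjmxE !mxE rmorphM /= rmorphXn /= oppr0 -sqrt_inv_sqr.
rewrite mulrACA -[Complex _ 0 * _]toCM -expr2; congr (_ * _).
by rewrite exprMn -!exprM.
Qed.

Lemma sum_fvec_outer W Om : (W <= Om)%N -> (0 < Om)%N ->
  \sum_(n < Om) fvec W Om n *m adjmx (fvec W Om n) = 1%:M.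
Proof.
move=> WO Om0; apply/matrixP => a b; rewrite summxE.
under eq_bigr do rewrite fvec_outer.
rewrite -mulr_sumr mxE; have lo (c : 'I_W) : (c < Om)%N := leq_trans (ltn_ord c) WO.
case: eqVneq => [->|ab].
  under eq_bigr do rewrite mulrC zetaJ expr1n.
  rewrite sumr_const card_ord; have -> : 1 *+ Om = toC Om%:R by rewrite toCE rmorph_nat.
  by rewrite -toCM mulVf ?pnatr_eq0 -?lt0n // (toCE 1) rmorph1.
rewrite sum_unity_root ?mulr0 ?zeta_unitary_Om //.
exact: zeta_unitary_neq1.
Qed.

Lemma parseval W Om m (X : 'M[C]_(m, W)) : (W <= Om)%N -> (0 < Om)%N ->
  \sum_(n < Om) fn2 (X *m fvec W Om n) = fn2 X.
Proof.
move=> WO Om0; under eq_bigr do rewrite -ripE rip_mulr -mulmxA.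
by rewrite -rip_sumr -mulmx_sumr sum_fvec_outer // mulmx1 ripE.
Qed.

Lemma parseval2 W Om m (X : 'M[C]_(m, W)) : (W <= Om)%N -> (0 < Om)%N ->
  \sum_(n < Om + Om) fn2 (X *m fvec W Om n) = 2 * fn2 X.
Proof.
move=> WO Om0; rewrite big_split_ord /= parseval //.
under eq_bigr do rewrite addnC fvec_periodic //.
by rewrite parseval // mulrDl mul1r.
Qed.

Lemma fn2_sum_CS m n t (e : 'I_t -> 'M[C]_(m, n)) :
  fn2 (\sum_i e i) <= t%:R * \sum_i fn2 (e i).
Proof.
elim: t e => [|t IH] e; first by rewrite !big_ord0 fn2_0 mulr0.
rewrite !big_ord_recr /= fn2D; have := IH (fun i => e (widen_ord (leqnSn t) i)).
set S := \sum_i _; set Q := \sum_i fn2 _; set x := e ord_max => h.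
have : 2 * rip S x <= Q + t%:R * fn2 x.
  rewrite /S rip_suml mulr_sumr mulr_natl -[X in fn2 x *+ X]card_ord -sumr_const.
  rewrite /Q -big_split; apply: ler_sum => i _ /=; set y := e _.
  by have := fn2_ge0 (y - x); rewrite fn2D ripNr fn2N; lra.
rewrite -natr1; lra.
Qed.

(** v n differs from each of the next l values by increments inside the window, whose sum is bounded
    by Cauchy-Schwarz; averaging over the l values gives the claim. *)
Lemma discrete_sobolev m (v : nat -> 'cV[C]_m) n l : (0 < l)%N ->
  fn2 (v n) <= \sum_(t < l) (2 / l%:R * fn2 (v (n + t)%N)
     + 2 * l%:R * fn2 (v (n + t).+1 - v (n + t)%N)).
Proof.
move=> l0; have lR : 0 < l%:R :> R by rewrite ltr0n.
set D := \sum_(t < l) fn2 (v (n + t).+1 - v (n + t)%N).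
have h (t : 'I_l) : fn2 (v n) <= 2 * fn2 (v (n + t)%N) + 2 * l%:R * D.
  have -> : v n = v (n + t)%N + - \sum_(s < t) (v (n + s).+1 - v (n + s)%N).
    have -> : \sum_(s < t) (v (n + s).+1 - v (n + s)%N) = v (n + t)%N - v n.
      elim: (nat_of_ord t) => [|k IH]; first by rewrite big_ord0 addn0 subrr.
      by rewrite big_ord_recr /= IH addnS addrC addrA subrK.
    by rewrite opprB addrC subrK.
  apply: le_trans (fn2D_le _ _) _; rewrite fn2N lerD2l -mulrA ler_pM2l //.
  apply: le_trans (fn2_sum_CS _) _; apply: ler_pM => //.
  - by apply: sumr_ge0 => s _; apply: fn2_ge0.
  - by rewrite ler_nat ltnW.
  rewrite (big_ord_widen l (fun s => fn2 (v (n + s).+1 - v (n + s)%N))) ?(ltnW (ltn_ord t)) //.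
  by rewrite big_mkcond; apply: ler_sum => s _; case: ifP => // _; apply: fn2_ge0.
have : \sum_(t < l) fn2 (v n) <= \sum_(t < l) (2 * fn2 (v (n + t)%N) + 2 * l%:R * D).
  by apply: ler_sum => t _; apply: h.
rewrite big_split /= !sumr_const card_ord -[fn2 _ *+ _]mulr_natl -[_ * D *+ _]mulr_natl.
rewrite -mulr_sumr big_split /= -!mulr_sumr -/D => {}h.
rewrite -(ler_pM2l lR); apply: le_trans h _.
rewrite le_eqVlt; apply/orP; left; apply/eqP; field; exact: lt0r_neq0.
Qed.

(** A chord is at most its angle 2 pi w / Om, and pi <= 4 gives 64. *)
Lemma nsq_zeta_sub1_le Om (w : nat) : (0 < Om)%N ->
  nsq (zeta Om ^+ w - 1) <= 64 * w%:R ^+ 2 / Om%:R ^+ 2.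
Proof.
move=> Om0; have OmR : 0 < Om%:R :> R by rewrite ltr0n.
rewrite nsq_zetaB1 // -nsq_expiB1; apply: le_trans (nsq_expiB1_le _) _.
  by rewrite divr_ge0 // !mulr_ge0 // pi_ge0.
rewrite expr_div_n ler_pM2r ?invr_gt0 ?exprn_gt0 //.
have -> : 64 * w%:R ^+ 2 = (8 * w%:R) ^+ 2 :> R by ring.
apply: lerXn2r; rewrite ?nnegrE ?mulr_ge0 ?pi_ge0 //.
by apply: ler_wpM2r => //; have := pi_le4; lra.
Qed.

(* Plancherel-Polya: [n |-> X f_n] is a trigonometric polynomial of degree
   less than W, hence essentially constant at scale [Om / W]. *)
Lemma plancherel_polya W Om m l (X : 'M[C]_(m, W)) (a : 'I_Om -> R) T :
  (W <= Om)%N -> (0 < l <= Om)%N -> (forall om, 0 <= a om) ->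
  (forall n : nat, \sum_(om < Om | (om <= n)%N && (n < om + l)%N) a om <= T) ->
  \sum_om a om * fn2 (X *m fvec W Om om) <=
  T * (4 / l%:R + 256 * l%:R * W%:R ^+ 2 / Om%:R ^+ 2) * fn2 X.
Proof.
move=> WO /andP[l0 lO] a0 hT; have Om0 : (0 < Om)%N by apply: leq_trans lO.
have OmR : 0 < Om%:R :> R by rewrite ltr0n.
have lR : 0 < l%:R :> R by rewrite ltr0n.
pose g n := 2 / l%:R * fn2 (X *m fvec W Om n)
  + 2 * l%:R * fn2 (X *m fvec W Om n.+1 - X *m fvec W Om n).
have g0 n : 0 <= g n.
  by apply: addr_ge0; rewrite !mulr_ge0 ?fn2_ge0 ?invr_ge0.
apply: (@le_trans _ _ (\sum_om a om * \sum_(t < l) g (om + t)%N)).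
  apply: ler_sum => om _; apply: ler_wpM2l => //.
  exact: (discrete_sobolev (fun n => X *m fvec W Om n)).
(* After exchanging the sums, g n is weighted by the mass of the window of length l ending at n.
   Since om + t may exceed Om, n runs over two periods, at the price of a factor 2 in Parseval. *)
have -> : \sum_om a om * \sum_(t < l) g (om + t)%N =
    \sum_(n < Om + Om) (\sum_(om < Om | (om <= n)%N && (n < om + l)%N) a om) * g n.
  under [RHS]eq_bigr do rewrite big_mkcond mulr_suml.
  rewrite exchange_big; apply: eq_bigr => om _ /=; rewrite mulr_sumr.
  transitivity (\sum_(n < Om + Om | (om <= n)%N && (n < om + l)%N) a om * g n).
    rewrite -(big_mkord xpredT (fun t => a om * g (om + t)%N)).
    rewrite -(big_mkord (fun n => (om <= n)%N && (n < om + l)%N) (fun n => a om * g n)).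
    transitivity (\sum_(om <= n < om + l) a om * g n).
      have -> : \sum_(om <= n < om + l) a om * g n =
        \sum_(0 + om <= n < om + l) a om * g n by [].
      rewrite big_addn addKn; apply: eq_bigr => t _; by rewrite addnC.
    rewrite (big_nat_widenl om 0 (om + l) xpredT) //.
    apply: big_nat_widen; apply: leq_add => //; exact: ltnW.
  rewrite big_mkcond; apply: eq_bigr => n _; case: ifP => // _; by rewrite mul0r.
apply: (@le_trans _ _ (\sum_(n < Om + Om) T * g n)).
  by apply: ler_sum => n _; apply: ler_wpM2r.
rewrite -mulr_sumr -mulrA; have T0 : 0 <= T.
  by apply: le_trans (hT 0%N); apply: sumr_ge0.
apply: ler_wpM2l => //; rewrite big_split /= -!mulr_sumr parseval2 //.
(* Passing from n to n + 1 multiplies coordinate w of f_n by zeta^w, so increments of X f_n have the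
   same form with X D; the smallness of D is a Bernstein inequality. *)
pose D : 'M[C]_W := \matrix_(i, j) ((zeta Om ^+ i - 1) *+ (i == j)).
have eD n : X *m fvec W Om n.+1 - X *m fvec W Om n = X *m D *m fvec W Om n.
  rewrite -mulmxBr -mulmxA; congr (_ *m _); apply/matrixP => w j.
  rewrite !mxE (bigD1 w) //= big1 ?addr0 => [|k kw]; last first.
    by rewrite !mxE eq_sym (negPf kw) mulr0n mul0r.
  rewrite !mxE eqxx mulr1n mulnS exprD; ring.
under [X in _ + _ * X <= _]eq_bigr do rewrite eD.
rewrite parseval2 //.
have : fn2 (X *m D) <= 64 * W%:R ^+ 2 / Om%:R ^+ 2 * fn2 X.
  rewrite /fn2 mulr_sumr; apply: ler_sum => i _; rewrite mulr_sumr; apply: ler_sum => j _.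
  rewrite mxE (bigD1 j) //= big1 ?addr0 => [|k kj]; last first.
    by rewrite mxE (negPf kj) mulr0n mulr0.
  rewrite mxE eqxx mulr1n nsqM mulrC; apply: ler_wpM2r; first exact: nsq_ge0.
  apply: le_trans (nsq_zeta_sub1_le _ Om0) _.
  rewrite ler_pM2r ?invr_gt0 ?exprn_gt0 // ler_pM2l //.
  by apply: lerXn2r; rewrite ?nnegrE ?ler_nat // ltnW.
move=> /(ler_wpM2l (mulr_ge0 (mulr_ge0 (ler0n R 4) (ler0n R l)) (ler01))) h.
set F := fn2 (X *m D) in h *; set F0 := fn2 X in h *.
have -> : (4 / l%:R + 256 * l%:R * W%:R ^+ 2 / Om%:R ^+ 2) * F0 =
  2 / l%:R * (2 * F0) + 4 * l%:R * 1 * (64 * W%:R ^+ 2 / Om%:R ^+ 2 * F0).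
  by field; rewrite !lt0r_neq0.
by apply: lerD => //; move: h; rewrite mulr1 mulrA; lra.
Qed.
End Roots.

(** * Exact quadrature on a residue class *)

Section ExactQuadrature.
Variable R : realType.
Local Notation C := R[i].
Local Notation toC := (@toC R).

Import ComplexField.Normc.

Lemma normcE (z : C) : normc z = Num.sqrt (nsq z).
Proof. by case: z. Qed.
Lemma normc_toC (x : R) : normc (toC x) = `|x|.
Proof. by rewrite normcE nsq_toC sqrtr_sqr. Qed.
Lemma normc_ge0' (z : C) : 0 <= normc z.
Proof. by rewrite normcE sqrtr_ge0. Qed.
Lemma normcD_le (x y : C) : normc (x + y) <= normc x + normc y.
Proof. exact: (@le_normcD R x y). Qed.
Lemma normc_opp (x : C) : normc (- x) = normc x.
Proof. by rewrite !normcE nsqN. Qed.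
Lemma normc_sum_le I (r : seq I) (P : pred I) (F : I -> C) :
  normc (\sum_(i <- r | P i) F i) <= \sum_(i <- r | P i) normc (F i).
Proof.
apply: (big_ind2 (fun x y => normc x <= y)) => //; first by rewrite normc0.
by move=> x1 x2 y1 y2 h1 h2; apply: le_trans (normcD_le _ _) (lerD h1 h2).
Qed.
Lemma normc_unit (z : C) : nsq z = 1 -> normc z = 1.
Proof. by rewrite normcE => ->; rewrite sqrtr1. Qed.

(** The column sums say that 1 - T halves the l1 norm. Hence T is injective, so invertible, and the
    solution satisfies |c| <= |e| + |c| / 2 in that norm. *)
Lemma near_identity_solve n (T : 'M[C]_n) (e : 'cV[C]_n) :
  (forall i, \sum_l normc ((1%:M - T) l i) <= 2^-1) ->
  exists2 c : 'cV[C]_n, T *m c = e &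
    \sum_i normc (c i ord0) <= 2 * \sum_i normc (e i ord0).
Proof.
move=> hT.
have contr (c : 'cV[C]_n) :
    \sum_i normc (((1%:M - T) *m c) i ord0) <= 2^-1 * \sum_i normc (c i ord0).
  apply: (@le_trans _ _ (\sum_i \sum_j normc ((1%:M - T) i j) * normc (c j ord0))).
    apply: ler_sum => i _; rewrite mxE; apply: le_trans (normc_sum_le _ _ _) _.
    by apply: ler_sum => j _; rewrite normcM.
  rewrite exchange_big mulr_sumr; apply: ler_sum => j _.
  by rewrite -mulr_suml; apply: ler_wpM2r => //; apply: normc_ge0'.
have sub (c : 'cV[C]_n) : c = T *m c + (1%:M - T) *m c.
  by rewrite -mulmxDl addrC subrK mul1mx.
have inj (c : 'cV[C]_n) : T *m c = 0 -> c = 0.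
  move=> Tc; have := contr c; rewrite {1}(_ : (1%:M - T) *m c = c); last first.
    by rewrite [RHS]sub Tc add0r.
  set N := \sum_i _ => hN.
  have N0 : 0 <= N by apply: sumr_ge0 => i _; apply: normc_ge0'.
  have Nz : N = 0 by apply/eqP; rewrite eq_le N0 andbT; move: hN N0; clear; lra.
  apply/matrixP => i j; rewrite ord1 mxE; apply: eq0_normc; apply/eqP.
  have /eqP := Nz; rewrite psumr_eq0 => [/allP/(_ i)|k _]; last exact: normc_ge0'.
  by rewrite mem_index_enum => /(_ isT).
have Tu : T \in unitmx.
  rewrite -unitmx_tr -row_free_unit -kermx_eq0; apply/eqP/row_matrixP => i.
  have h : row i (kermx T^T) *m T^T = 0 by apply/sub_kermxP; apply: row_sub.
  rewrite row0; apply: trmx_inj; rewrite trmx0; apply: inj; apply: trmx_inj.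
  by rewrite trmx_mul trmxK h trmx0.
exists (invmx T *m e); first by rewrite mulKVmx.
set c := invmx T *m e; have Tc : T *m c = e by rewrite mulKVmx.
have : \sum_i normc (c i ord0) <=
    \sum_i normc (e i ord0) + \sum_i normc (((1%:M - T) *m c) i ord0).
  rewrite -big_split; apply: ler_sum => i _ /=; rewrite {1}(sub c) Tc mxE.
  exact: normcD_le.
have := contr c; clear; lra.
Qed.

(** The sum is a quotient of two chords; xi^Om = 1 turns the numerator into the chord of the
    remainder Om mod kap, assumed no longer than the denominator. *)
Lemma geometric_gap (xi : C) Om kap : (0 < kap)%N ->
  xi ^+ Om = 1 -> nsq xi = 1 -> xi ^+ kap != 1 ->
  nsq (xi ^+ (Om %% kap) - 1) <= nsq (xi ^+ kap - 1) ->
  nsq (\sum_(j < Om %/ kap) (xi ^+ kap) ^+ j) <= 1.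
Proof.
move=> k0 hO h1 hk hr; set q := (Om %/ kap)%N; set S := \sum_j _.
have hS : (xi ^+ kap) ^+ q - 1 = (xi ^+ kap - 1) * S := subrX1 _ _.
have D0 : 0 < nsq (xi ^+ kap - 1).
  by rewrite lt_neqAle nsq_ge0 andbT eq_sym nsq_eq0 subr_eq0.
have e : ((xi ^+ kap) ^+ q - 1) * xi ^+ (Om %% kap) = - (xi ^+ (Om %% kap) - 1).
  rewrite mulrBl mul1r -exprM -exprD mulnC -divn_eq hO; ring.
rewrite -(ler_pM2l D0) mulr1 -nsqM -hS; apply: le_trans hr.
by rewrite -[leRHS]nsqN -e nsqM [X in _ * X]nsqX h1 expr1n mulr1.
Qed.

(** Chords grow with the angle on [0, pi], and 2 u kap <= Om keeps both angles there. *)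
Lemma zeta_pow_gap Om kap u r : (0 < Om)%N -> (2 * (u * kap) <= Om)%N -> (r <= kap)%N ->
  nsq (zeta R Om ^+ (u * r) - 1) <= nsq (zeta R Om ^+ (u * kap) - 1).
Proof.
move=> Om0 h rk; have OmR : 0 < Om%:R :> R by rewrite ltr0n.
rewrite !nsq_zetaB1 // lerD2l lerN2 ler_pM2l //.
have itv (t : nat) : (t <= u * kap)%N -> (2 * pi * t%:R / Om%:R : R) \in `[0, pi].
  move=> tk; rewrite in_itv /= divr_ge0 ?mulr_ge0 ?pi_ge0 //=.
  rewrite ler_pdivrMr // (mulrC 2 pi) -mulrA ler_pM2l ?pi_gt0 // -natrM ler_nat.
  by apply: leq_trans h; rewrite leq_mul2l tk orbT.
have ru : (u * r <= u * kap)%N by rewrite leq_mul2l rk orbT.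
rewrite leNgt ltr_cos ?itv // -leNgt ler_pM2r ?invr_gt0 // ler_wpM2l //.
  by rewrite mulr_ge0 ?pi_ge0.
by rewrite ler_nat.
Qed.

(** Over a complete set of equispaced nodes the sum would vanish; one irregular gap leaves at most
    1, to be compared with the Om / kap terms of the sum. *)
Lemma node_sum_le Om kap W k i l (xi : C) : (0 < kap)%N -> (4 * (W * kap) <= Om)%N ->
  (i < 2 * W)%N -> (l < 2 * W)%N -> i != l ->
  xi = zeta R Om ^+ i * conjc (zeta R Om) ^+ l ->
  nsq (\sum_(j < Om %/ kap) xi ^+ (k + kap * j)) <= 1.
Proof.
move=> k0 hO hi hl il xiE.
have Om0 : (0 < Om)%N.
  by apply: leq_trans hO; rewrite !muln_gt0 k0 andbT /=; case: (W) hi.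
have nx : nsq xi = 1 by rewrite xiE nsqM !nsqX nsqJ nsq_zeta !expr1n mulr1.
have -> : \sum_(j < Om %/ kap) xi ^+ (k + kap * j) =
    xi ^+ k * \sum_(j < Om %/ kap) (xi ^+ kap) ^+ j.
  by rewrite mulr_sumr; apply: eq_bigr => j _; rewrite exprD exprM.
rewrite nsqM nsqX nx expr1n mul1r.
have [u [u0 um hu]] := zeta_unitary_cases R Om il.
have uW : (u < 2 * W)%N by apply: leq_ltn_trans um _; rewrite gtn_max hi hl.
have uk : (2 * (u * kap) <= Om)%N.
  apply: leq_trans hO; rewrite (_ : 4 = 2 * 2)%N // -mulnA leq_mul2l /=.
  by rewrite mulnA leq_mul2r (ltnW uW) orbT.
have xiX t : nsq (xi ^+ t - 1) = nsq (zeta R Om ^+ (u * t) - 1).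
  rewrite xiE; case: hu => ->; rewrite exprM //.
  by rewrite -nsqJ rmorphB /= rmorphXn /= conjcK oppr0.
have xk : xi ^+ kap != 1.
  rewrite -subr_eq0 -nsq_eq0 xiX nsq_eq0 subr_eq0; apply: zeta_neq1.
  rewrite muln_gt0 u0 k0 /=; apply: leq_trans uk.
  by rewrite mul2n -addnn -addn1 leq_add2l muln_gt0 u0.
apply: geometric_gap => //; first by rewrite xiE; apply: zeta_unitary_Om.
by rewrite !xiX; apply: zeta_pow_gap => //; apply: ltnW; rewrite ltn_mod.
Qed.

(* The nodes [k, k + kap, ...] are equispaced up to a single gap, so the
   plain average over them is so close to exact that a correction by a
   trigonometric polynomial makes it exact. *)
Lemma exact_weights W Om kap k : (0 < W)%N -> (0 < kap)%N -> (k < kap)%N ->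
  (4 * (W * kap) <= Om)%N ->
  exists w : 'I_Om -> C,
    [/\ forall om, w om != 0 -> (om %% kap = k)%N,
        forall om, nsq (w om) <= 4 * kap%:R ^+ 2
      & \sum_om w om *: (fvec R W Om om *m adjmx (fvec R W Om om)) = 1%:M].
Proof.
move=> W0 k0 kk hO.
have Om0 : (0 < Om)%N by apply: leq_trans hO; rewrite !muln_gt0 W0 k0.
have OmR : 0 < Om%:R :> R by rewrite ltr0n.
(* The entries of f f^* involve only the 2 W - 1 frequency differences, indexed from 0 by adding W -
   1. *)
set q := (Om %/ kap)%N; pose n := (2 * W).-1.
have nE : n.+1 = (2 * W)%N by rewrite prednK // muln_gt0.
have nlt (i : 'I_n) : (i < 2 * W)%N by rewrite -nE ltnS ltnW.
pose xi i l := zeta R Om ^+ i * conjc (zeta R Om) ^+ l.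
(* [T] is the Gram matrix of these exponentials for the plain average over the nodes; [e] singles
   out the difference 0, the only one whose weighted sum must not vanish. *)
pose T : 'M[C]_n := \matrix_(l, i)
  (toC (kap%:R / Om%:R) * \sum_(j < q) xi i l ^+ (k + kap * j)).
pose e : 'cV[C]_n := \col_l (nat_of_ord l == W.-1)%:R.
have kO : kap%:R / Om%:R <= (4 * W%:R)^-1 :> R.
  rewrite ler_pdivrMr // ler_pdivlMl ?mulr_gt0 ?ltr0n //.
  by rewrite -!natrM ler_nat -mulnA.
have Tb l i : normc ((1%:M - T) l i) <= kap%:R / Om%:R.
  rewrite !mxE; case: eqVneq => [->|li].
    rewrite mulr1n; have -> : \sum_(j < q) xi i i ^+ (k + kap * j) = toC q%:R.
      under eq_bigr do rewrite /xi mulrC zetaJ expr1n.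
      by rewrite sumr_const card_ord toCE rmorph_nat.
    rewrite -toCM (_ : 1 = toC 1) //.
    rewrite (_ : toC 1 - toC (kap%:R / Om%:R * q%:R) = toC (1 - kap%:R / Om%:R * q%:R)); last first.
      exact/esym/(rmorphB (real_complex R)).
    rewrite normc_toC; have := divn_eq Om kap; rewrite -/q => eO.
    have -> : 1 - kap%:R / Om%:R * q%:R = (Om %% kap)%:R / Om%:R :> R.
      have -> : (Om %% kap)%:R = Om%:R - q%:R * kap%:R :> R.
        by rewrite {2}eO natrD natrM addrAC subrr add0r.
      by field; rewrite lt0r_neq0.
    rewrite ger0_norm ?divr_ge0 // ler_pM2r ?invr_gt0 // ler_nat ltnW //.
    by rewrite ltn_mod.
  rewrite mulr0n sub0r normc_opp normcM normc_toC ger0_norm ?divr_ge0 //.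
  rewrite ler_piMr ?divr_ge0 // normcE -[leRHS]sqrtr1 ler_sqrt //.
  by apply: (node_sum_le k k0 hO _ _ _ (erefl _)) => //; rewrite eq_sym.
have [i|c hc cn] := @near_identity_solve n T e.
  apply: (@le_trans _ _ (\sum_(l < n) (4 * W%:R)^-1)).
    by apply: ler_sum => l _; apply: le_trans (Tb l i) kO.
  rewrite sumr_const card_ord -[_ *+ n]mulr_natl ler_pdivrMr ?mulr_gt0 ?ltr0n //.
  have -> : 2^-1 * (4 * W%:R) = (2 * W)%:R :> R by rewrite natrM; field.
  by rewrite ler_nat -nE.
have W1 : (W.-1 < n)%N.
  by rewrite -ltnS nE prednK // mul2n -addnn -{1}(add0n W) ltn_add2r.
have {}cn : \sum_i normc (c i ord0) <= 2.
  apply: le_trans cn _; rewrite (bigD1 (Ordinal W1)) //= big1 ?addr0 => [|i ne].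
    by rewrite mxE /= eqxx (normc_unit (nsq1 R)) mulr1.
  rewrite mxE; case: eqP => [h|_]; last exact: normc0.
  by case/eqP: ne; apply: val_inj.
(* The correcting trigonometric polynomial, recentred by W - 1. Its coefficients have l1 norm at
   most 2, whence weights of modulus at most 2 kap. *)
pose phi (m : nat) := (\sum_i c i ord0 * zeta R Om ^+ (i * m)) * conjc (zeta R Om) ^+ (W.-1 * m).
have phib m : normc (phi m) <= 2.
  rewrite /phi normcM [X in _ * X]normc_unit ?mulr1; last first.
    by rewrite nsqX nsqJ nsq_zeta expr1n.
  apply: le_trans (normc_sum_le _ _ _) (le_trans _ cn).
  apply: ler_sum => i _; rewrite normcM [X in _ * X]normc_unit ?mulr1 //.
  by rewrite nsqX nsq_zeta expr1n.
pose w (om : 'I_Om) := if (om %% kap == k)%N && (om %/ kap < q)%N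
  then toC kap%:R * phi om else 0.
exists w; split.
- by move=> om; rewrite /w; case: ifP => [/andP[/eqP]|]; rewrite ?eqxx.
- move=> om; rewrite /w; case: ifP => _; last by rewrite nsq0 mulr_ge0 ?sqr_ge0.
  rewrite nsqM nsq_toC mulrC; apply: ler_wpM2r; first exact: sqr_ge0.
  have := phib om; rewrite normcE => h.
  rewrite -(sqr_sqrtr (nsq_ge0 (phi om))) (_ : 4 = 2 ^+ 2); last by ring.
  by apply: lerXn2r; rewrite ?nnegrE ?sqrtr_ge0.
apply/matrixP => a b; rewrite summxE.
have -> : \sum_om (w om *: (fvec R W Om om *m adjmx (fvec R W Om om))) a b =
    \sum_(j < q) toC (kap%:R / Om%:R) * (phi (k + kap * j)%N * xi a b ^+ (k + kap * j)).
  transitivity (\sum_(om < Om | (om %% kap == k)%N && (om %/ kap < q)%N)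
     toC (kap%:R / Om%:R) * (phi om * xi a b ^+ om)).
    rewrite [RHS]big_mkcond; apply: eq_bigr => om _; rewrite mxE fvec_outer /w /xi.
    case: ifP => _; last by rewrite mul0r.
    rewrite toCM; ring.
  have hb (j : 'I_q) : (k + kap * j < Om)%N.
    apply: (@leq_trans (kap + kap * j)); first by rewrite ltn_add2r.
    by rewrite -mulnS; apply: leq_trans (leq_divM Om kap); rewrite mulnC leq_mul2r ltn_ord orbT.
  have q0 : (0 < q)%N.
    rewrite divn_gt0 //; apply: leq_trans hO; rewrite mulnA leq_pmull // muln_gt0 W0 //.
  pose h j : 'I_Om := Ordinal (hb j).
  pose h' (om : 'I_Om) : 'I_q := insubd (Ordinal q0) (om %/ kap)%N.
  have hdiv (j : 'I_q) : ((k + kap * j) %/ kap = j)%N.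
    by rewrite addnC mulnC divnMDl // divn_small // addn0.
  rewrite (reindex_onto h h') /=; last first.
    move=> om /andP[/eqP h1 h2]; apply: val_inj => /=.
    by rewrite val_insubd h2 -h1 addnC mulnC -divn_eq.
  apply: eq_bigl => j; rewrite /= hdiv ltn_ord andbT addnC mulnC modnMDl modn_small // eqxx /=.
  by apply/eqP; apply: val_inj; rewrite val_insubd /= hdiv ltn_ord.
have lW : (W.-1 + b - a < n)%N.
  by have := ltn_ord b; rewrite /n; lia.
have laW : (W.-1 + b - a + a = W.-1 + b)%N by have := ltn_ord a; lia.
pose l := Ordinal lW.
have key m : phi m * xi a b ^+ m = \sum_i c i ord0 * xi i l ^+ m.
  rewrite /phi mulrAC mulr_suml mulr_suml; apply: eq_bigr => i _.
  rewrite /xi !exprMn -!exprM.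
  have <- : zeta R Om ^+ (a * m) * conjc (zeta R Om) ^+ (b * m) * conjc (zeta R Om) ^+ (W.-1 * m)
     = conjc (zeta R Om) ^+ (l * m).
    rewrite -mulrA -exprD -mulnDl addnC -laW mulnDl exprD mulrCA.
    by rewrite (mulrC (zeta R Om ^+ _)) zetaJ mulr1.
  move: (zeta R Om ^+ (i * m)) (zeta R Om ^+ (a * m)) (conjc (zeta R Om) ^+ (b * m)).
  by move: (conjc (zeta R Om) ^+ (W.-1 * m)) => *; ring.
transitivity ((T *m c) l ord0).
  rewrite mxE; under [RHS]eq_bigr do rewrite mxE -mulrA mulr_suml mulr_sumr.
  rewrite exchange_big /=; apply: eq_bigr => j _.
  rewrite key mulr_sumr; apply: eq_bigr => i _; congr (_ * _); exact: mulrC.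
rewrite hc !mxE /=; congr (nat_of_bool _)%:R; apply/eqP/eqP => [h|->].
  by apply: val_inj => /=; move: laW; rewrite h => /addnI.
by rewrite addnK.
Qed.

(** Members of one residue class differ by multiples of kap, so the quotient of n - om by kap tells
    them apart. *)
Lemma residue_window_card Om kap k n l : (0 < kap)%N ->
  (#|[pred om : 'I_Om | [&& om %% kap == k, om <= n & n < om + l]%N]| <= (l %/ kap).+1)%N.
Proof.
move=> k0; set A := [pred om : 'I_Om | _].
pose h (om : 'I_Om) : 'I_(l %/ kap).+1 := inord ((n - om) %/ kap)%N.
have hv om : om \in A -> h om = ((n - om) %/ kap)%N :> nat.
  rewrite inE => /and3P[_ h1 h2]; rewrite /h inordK // ltnS leq_div2r //; lia.
rewrite -[leqRHS]card_ord -(card_in_imset (f := h) (D := A)); first exact: max_card.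
move=> x y xA yA /(congr1 val) /=; rewrite !hv // => hxy; apply: val_inj => /=.
move: xA yA; rewrite !inE => /and3P[/eqP mx hx _] /and3P[/eqP my hy _].
have : (n - x = n - y %[mod kap])%N.
  apply/eqP; rewrite -(eqn_modDl x) subnKC // -modnDml mx -my modnDml subnKC //.
move=> hm; have : (n - x = n - y)%N by rewrite (divn_eq (n - x) kap) hxy hm -divn_eq.
lia.
Qed.
End ExactQuadrature.

(** * Measurement noise as a chaos and its tails *)

Section MeasurementNoise.
Variable R : realType.
Local Notation C := R[i].
Local Notation toC := (@toC R).
Variables (M W Om : nat).
Local Notation dT := {ffun 'I_Om * 'I_M -> bool}.
Local Notation fv om := (fvec R W Om om).

Definition signs (d : dT) (om : 'I_Om) : 'cV[C]_M :=
  \col_m toC (sgnR R (d (om, m))).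

(* Fluctuation of one batch of measurements around its mean [Z]. *)
Definition noise (w : 'I_Om -> C) (Z : 'M[C]_(M, W)) (d : dT) : 'M[C]_(M, W) :=
  \sum_om w om *: ((signs d om *m adjmx (signs d om) - 1%:M) *m (Z *m fv om)
     *m adjmx (fv om)).

Definition noise_coef (w : 'I_Om -> C) (Z : 'M[C]_(M, W)) (om : 'I_Om) (m : 'I_M) : C :=
  w om * (Z *m fv om) m ord0.

Definition noise_atom (om : 'I_Om) (m : 'I_M) : 'M[C]_(M, W) :=
  delta_mx m (ord0 : 'I_1) *m adjmx (fv om).

Lemma noise_coef_sqr w Z om :
  \sum_m nsq (noise_coef w Z om m) = nsq (w om) * fn2 (Z *m fv om).
Proof.
by rewrite fn2_col mulr_sumr; apply: eq_bigr => m _; rewrite nsqM.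
Qed.

Lemma noise_atomE om m0 m j :
  noise_atom om m0 m j = (m == m0)%:R * adjmx (fv om) ord0 j.
Proof. by rewrite mxE big_ord1 mxE eqxx andbT. Qed.

Lemma centered_signsE d om (u : 'cV[C]_M) m :
  ((signs d om *m adjmx (signs d om) - 1%:M) *m u) m ord0 =
  \sum_(m' | m' != m) toC (sgnR R (d (om, m)) * sgnR R (d (om, m'))) * u m' ord0.
Proof.
have e m' : (signs d om *m adjmx (signs d om) - 1%:M) m m' =
    toC (sgnR R (d (om, m)) * sgnR R (d (om, m'))) - (m == m')%:R.
  by rewrite mxE [(_ *m _) _ _]mxE big_ord1 adjmxE !mxE conjc_real -toCM.
rewrite mxE (bigD1 m) //= e eqxx -expr2 sgnR_sqr (_ : toC 1 = 1) // subrr mul0r add0r.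
by apply: eq_bigr => m' ne; rewrite e eq_sym (negPf ne) subr0.
Qed.

(** Squared signs are 1, so subtracting the identity removes exactly the diagonal of d d^* and
    leaves the pairs of distinct indices. *)
Lemma noiseE w Z d : noise w Z d = chaos (noise_coef w Z) noise_atom d.
Proof.
apply: eq_bigr => om _; under [RHS]eq_bigr do rewrite -scaler_suml.
apply/matrixP => m j; rewrite summxE [RHS](bigD1 m) //= [X in _ = _ + X]big1 ?addr0; last first.
  by move=> m' ne; rewrite mxE noise_atomE eq_sym (negPf ne) mul0r mulr0.
rewrite mxE [RHS]mxE noise_atomE eqxx mul1r [in LHS]mxE big_ord1 centered_signsE mulrA.
congr (_ * _); rewrite mulr_sumr; apply: eq_bigr => m' _.
by rewrite /noise_coef mulrCA.
Qed.

Lemma chaos_linear a b (g : 'M[C]_(M, W) -> 'M[C]_(a, b)) (z : 'I_Om -> 'I_M -> C)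
    (A : 'I_Om -> 'I_M -> 'M[C]_(M, W)) d :
  {morph g : x y / x + y} -> (forall (c : C) x, g (c *: x) = c *: g x) ->
  g (chaos z A d) = chaos z (fun o m => g (A o m)) d.
Proof.
move=> gD gZ; have g0 : g 0 = 0 by rewrite -(scale0r 0) gZ scale0r.
rewrite /chaos (big_morph g gD g0); apply: eq_bigr => o _.
rewrite (big_morph g gD g0); apply: eq_bigr => m _.
by rewrite (big_morph g gD g0); apply: eq_bigr => m' _.
Qed.

Definition chaos_const : R := expR 1 * (128 * expR 2).

Lemma fn2_col_row a b (x : 'cV[C]_a) (y : 'rV[C]_b) : fn2 (x *m y) = fn2 x * fn2 y.
Proof. by rewrite -(fn2_adj y) -fn2_outer adjmxK. Qed.

Lemma fn2_mxvec a b (X : 'M[C]_(a, b)) : fn2 ((mxvec X)^T) = fn2 X.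
Proof.
rewrite fn2_col /fn2 pair_bigA /=.
rewrite (reindex _ (curry_mxvec_bij _ _)) /=.
by apply: eq_bigr => -[i j] _ /=; rewrite mxE mxvecE.
Qed.

(** Vectorising B N D turns its Frobenius norm into the operator norm of one column. Both variances
    are then at most a sum of squared norms, so a single functional dominates them. *)
Lemma noise_frobenius_tail a b (B : 'M[C]_(a, M)) (D : 'M[C]_(W, b))
    (w : 'I_Om -> C) Z p (sig2 B2 t : R) :
  0 < B2 -> 0 <= sig2 ->
  \sum_(om < Om) fn2 B * fn2 (adjmx (fv om) *m D) * (nsq (w om) * fn2 (Z *m fv om)) <= sig2 ->
  (forall om : 'I_Om, fn2 B * fn2 (adjmx (fv om) *m D) * (nsq (w om) * fn2 (Z *m fv om)) <= B2) ->
  0 < t -> chaos_const * (p.+1%:R * (p.+1%:R * B2 + sig2)) <= t ->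
  Pr R (fun d => t < fn2 (B *m noise w Z d *m D)) <= (a * b + 1)%:R * expR (- p.+1%:R).
Proof.
move=> B20 s0 hs hB t0 ht.
pose g (X : 'M[C]_(M, W)) : 'cV[C]_(a * b) := (mxvec (B *m X *m D))^T.
have gD : {morph g : x y / x + y}.
  by move=> x y; rewrite /g mulmxDr mulmxDl linearD /= linearD.
have gZ c x : g (c *: x) = c *: g x.
  by rewrite /g -scalemxAr -scalemxAl linearZ /= linearZ.
have gA om : \sum_m fn2 (g (noise_atom om m)) = fn2 B * fn2 (adjmx (fv om) *m D).
  rewrite fn2_cols mulr_suml; apply: eq_bigr => m _.
  rewrite /g fn2_mxvec /noise_atom mulmxA -mulmxA -colE.
  exact: fn2_col_row.
pose c (_ : unit) (om : 'I_Om) := fn2 B * fn2 (adjmx (fv om) *m D).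
have c0 j om : 0 <= c j om by rewrite mulr_ge0 ?fn2_ge0.
have dom : dominated (fun o m => g (noise_atom o m)) c.
  move=> v s v0 hv; split=> x; apply: (@le_trans _ _ (\sum_(om < Om) c tt om * v om * fn2 x)).
  - apply: ler_sum => om _; rewrite (mulrC (c tt om)) -mulrA; apply: ler_wpM2l => //.
    rewrite /c -gA mulr_suml; apply: ler_sum => m _; exact: opb_fn2.
  - by rewrite -mulr_suml; apply: ler_wpM2r; rewrite ?fn2_ge0.
  - apply: ler_sum => om _; rewrite (mulrC (c tt om)) -mulrA; apply: ler_wpM2l => //.
    rewrite /c -gA mulr_suml; apply: ler_sum => m _.
    by rewrite -[X in _ <= X * _]fn2_adj; exact: opb_fn2.
  by rewrite -mulr_suml; apply: ler_wpM2r; rewrite ?fn2_ge0.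
have := @chaos_tail R _ _ _ _ unit _ c (noise_coef w Z) sig2 B2 p dom c0 B20 s0 _ _ t t0.
rewrite card_unit mulr1 => tail; apply: le_trans (tail _ _ _).
- apply: Pr_sub => d hd; exists 1%:M; rewrite mulmx1 -chaos_linear // -noiseE.
  rewrite /g fn2_mxvec; have -> : fn2 (1%:M : 'cV[C]_1) = 1.
    by rewrite fn2_col big_ord1 mxE eqxx nsq1.
  by rewrite mulr1.
- by move=> j; under eq_bigr do rewrite noise_coef_sqr.
- by move=> j om; rewrite noise_coef_sqr; apply: hB.
by apply: le_trans ht; rewrite /chaos_const le_eqVlt; apply/orP; left; apply/eqP; ring.
Qed.

(** On the adjoint side each atom contributes through |f_om|^2 = W / Om, which gives the functional
    [None]. On the other side sum_om v_om |x^* f_om|^2 is bounded by Plancherel-Polya through window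
    masses, one functional for each n < 2 Om. *)
Lemma noise_operator_tail l (w : 'I_Om -> C) Z p (sig2 B2 t Cc : R) :
  (0 < M)%N -> (W <= Om)%N -> (0 < l <= Om)%N ->
  Cc = 4 / l%:R + 256 * l%:R * W%:R ^+ 2 / Om%:R ^+ 2 ->
  0 < B2 -> 0 <= sig2 ->
  W%:R / Om%:R * \sum_(om < Om) nsq (w om) * fn2 (Z *m fv om) <= sig2 ->
  (forall n, M%:R * Cc * \sum_(om < Om | (om <= n)%N && (n < om + l)%N)
     nsq (w om) * fn2 (Z *m fv om) <= sig2) ->
  (forall om : 'I_Om, W%:R / Om%:R * (nsq (w om) * fn2 (Z *m fv om)) <= B2) ->
  (forall om : 'I_Om, M%:R * Cc * (nsq (w om) * fn2 (Z *m fv om)) <= B2) ->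
  0 < t -> chaos_const * (p.+1%:R * (p.+1%:R * B2 + sig2)) <= t ->
  Pr R (fun d => exists y : 'cV_W, t * fn2 y < fn2 (noise w Z d *m y)) <=
    ((M + W) * (Om + Om).+1)%:R * expR (- p.+1%:R).
Proof.
move=> M0 WO lO CcE B20 s0 hs1 hs2 hB1 hB2 t0 ht.
have Om0 : (0 < Om)%N by case/andP: lO => h1 h2; apply: leq_trans h2.
have Cc0 : 0 < Cc.
  rewrite CcE ltr_pwDl ?divr_gt0 ?ltr0n //; first by case/andP: lO.
  by rewrite divr_ge0 ?mulr_ge0 ?sqr_ge0.
have MR : 0 < M%:R :> R by rewrite ltr0n.
pose c (j : option 'I_(Om + Om)) (om : 'I_Om) : R :=
  if j is Some n then if (om <= n)%N && (n < om + l)%N then M%:R * Cc else 0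
  else W%:R / Om%:R.
have c0 j om : 0 <= c j om.
  rewrite /c; case: j => [n|]; last by rewrite divr_ge0.
  by case: ifP => // _; rewrite mulr_ge0 // ltW.
have dom : dominated noise_atom c.
  move=> v s v0 hv; have s0' : 0 <= s.
    by apply: le_trans (hv None); apply: sumr_ge0 => om _; rewrite mulr_ge0.
  split=> x.
    have e om : \sum_m fn2 (noise_atom om m *m x) = M%:R * fn2 (adjmx x *m fv om).
      rewrite -[adjmx x *m _]adjmxK adjmxM adjmxK fn2_adj.
      rewrite mulr_natl -[X in _ *+ X]card_ord -sumr_const; apply: eq_bigr => m _.
      rewrite /noise_atom -mulmxA fn2_col_row.
      rewrite fn2_col (bigD1 m) //= mxE !eqxx nsq1 big1 ?addr0 ?mul1r // => k km.
      by rewrite mxE (negPf km) nsq0.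
    under eq_bigr do rewrite e mulrCA.
    rewrite -mulr_sumr.
    have win n : \sum_(om < Om | (om <= n)%N && (n < om + l)%N) v om <= s / (M%:R * Cc).
      have [nO|nO] := ltnP n (Om + Om); last first.
        rewrite big1 ?divr_ge0 ?mulr_ge0 // ?ltW // => om /andP[_ h].
        have : (om + l <= Om + Om)%N by case/andP: lO => _ h2; apply: leq_add => //; apply: ltnW.
        by move=> /(leq_trans h); rewrite ltnNge nO.
      rewrite ler_pdivlMr ?mulr_gt0 // mulrC mulr_sumr.
      apply: le_trans (hv (Some (Ordinal nO))); rewrite le_eqVlt; apply/orP; left; apply/eqP.
      rewrite big_mkcond; apply: eq_bigr => om _ /=.
      by case: ifP => // _; rewrite mul0r.
    have := plancherel_polya (adjmx x) WO lO v0 win; rewrite -CcE => /(ler_wpM2l (ltW MR)).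
    move=> h; apply: le_trans h _; rewrite fn2_adj mulrA mulrCA -mulrA.
    by rewrite le_eqVlt; apply/orP; left; apply/eqP; field; rewrite !lt0r_neq0.
  have e om : \sum_m fn2 (adjmx (noise_atom om m) *m x) = W%:R / Om%:R * fn2 x.
    rewrite -(fn2_fvec R W Om om) (fn2_col x) mulr_sumr; apply: eq_bigr => m _.
    rewrite /noise_atom adjmxM adjmxK -mulmxA fn2_col_row.
    congr (_ * _); rewrite fn2_col big_ord1; congr nsq.
    rewrite mxE (bigD1 m) //= adjmxE mxE !eqxx conjc1 mul1r big1 ?addr0 // => k km.
    by rewrite adjmxE mxE (negPf km) conjc0 mul0r.
  under eq_bigr do rewrite e mulrA.
  rewrite -mulr_suml; apply: ler_wpM2r; first exact: fn2_ge0.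
  by apply: le_trans (hv None); rewrite le_eqVlt; apply/orP; left; apply/eqP;
     apply: eq_bigr => om _; rewrite mulrC.
have := @chaos_tail R _ _ _ _ (option 'I_(Om + Om)) _ c (noise_coef w Z) sig2 B2 p dom c0 B20 s0 _ _ t t0.
rewrite card_option card_ord => tail; rewrite natrM; apply: le_trans (tail _ _ _).
- by apply: Pr_sub => d [y hy]; exists y; rewrite -noiseE.
- case=> [n|]; under eq_bigr do rewrite noise_coef_sqr; last by rewrite /c -mulr_sumr.
  apply: le_trans (hs2 n); rewrite mulr_sumr [leRHS]big_mkcond.
  by apply: ler_sum => om _; rewrite /c; case: ifP => // _; rewrite mul0r.
- move=> j om; rewrite noise_coef_sqr; case: j => [n|] //=.
  by case: ifP => // _; rewrite mul0r ltW.
by apply: le_trans ht; rewrite /chaos_const le_eqVlt; apply/orP; left; apply/eqP; ring.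
Qed.
End MeasurementNoise.

(** * One golfing stage *)

Section GolfingStep.
Variable R : realType.
Local Notation C := R[i].
Variables (M W Om r : nat) (U : 'M[C]_(M, r)) (V : 'M[C]_(W, r)).
Hypotheses (hU : adjmx U *m U = 1%:M) (hV : adjmx V *m V = 1%:M).
Local Notation dT := {ffun 'I_Om * 'I_M -> bool}.
Local Notation fv om := (fvec R W Om om).

Lemma isom_rank m n (A : 'M[C]_(m, n)) : adjmx A *m A = 1%:M -> (n <= m)%N.
Proof.
move=> h; have := mxrankM_maxr (adjmx A) A; rewrite h mxrank1 => h'.
exact: leq_trans h' (rank_leq_row _).
Qed.

Lemma fn2_isom_adj m n (A : 'M[C]_(m, n)) : adjmx A *m A = 1%:M -> fn2 (adjmx A) = n%:R.
Proof.
move=> h; apply: toC_inj; rewrite -fn2E mxtrace_mulC adjmxK h mxtrace1.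
by rewrite toCE rmorph_nat.
Qed.

Lemma fn2_1 n : fn2 (1%:M : 'M[C]_n) = n%:R.
Proof. by rewrite -[1%:M]adjmx1 fn2_isom_adj // adjmx1 mulmx1. Qed.

Lemma fn2_fvec_swap m (X : 'M[C]_(W, m)) n :
  fn2 (adjmx (fvec R W Om n) *m X) = fn2 (adjmx X *m fvec R W Om n).
Proof. by rewrite -fn2_adj adjmxM adjmxK. Qed.

Variables (kap p : nat) (w : 'I_Om -> C) (rho2 T a : R).
Let l := (Om %/ W)%N.
(** 264 = 8 + 256: l >= Om / (2 W) bounds the first term of [window_const] by 8 W / Om, and l W <=
    Om bounds the second by 256 W / Om. *)
Definition sampling_const : R := 264.
(** 2112 = 264 * 4 * 2: squared weights are at most 4 kap^2, and a window meets the batch in at most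
    2 Om / (W kap) points. *)
Definition energy_const : R := 2112.
Definition window_const : R := 4 / l%:R + 256 * l%:R * W%:R ^+ 2 / Om%:R ^+ 2.

Hypotheses (M0 : (0 < M)%N) (W0 : (0 < W)%N) (r0 : (0 < r)%N) (kap0 : (0 < kap)%N).
Hypotheses (hO : (4 * (W * kap) <= Om)%N).

Lemma Om_gt0 : (0 < Om)%N.
Proof. by apply: leq_trans hO; rewrite !muln_gt0 W0 kap0. Qed.
Lemma W_le_Om : (W <= Om)%N.
Proof. by apply: leq_trans hO; nia. Qed.
Lemma l_bounds : (0 < l <= Om)%N.
Proof. by rewrite /l divn_gt0 // W_le_Om leq_div. Qed.

Lemma window_const_le : window_const <= sampling_const * (W%:R / Om%:R).
Proof.
have OmR : 0 < Om%:R :> R by rewrite ltr0n Om_gt0.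
have lR : 0 < l%:R :> R by rewrite ltr0n; case/andP: l_bounds.
have WR : 0 < W%:R :> R by rewrite ltr0n.
have h1 : l%:R * W%:R <= Om%:R :> R by rewrite -natrM ler_nat leq_divM.
have h2 : Om%:R <= 2 * (l%:R * W%:R) :> R.
  rewrite -!natrM ler_nat; have := ltn_ceil Om W0; rewrite -/l.
  by case/andP: l_bounds => l0 _; nia.
have -> : sampling_const * (W%:R / Om%:R) = 8 * (W%:R / Om%:R) + 256 * (W%:R / Om%:R).
  by rewrite /sampling_const; ring.
apply: lerD.
  rewrite ler_pdivrMr //; have -> : 8 * (W%:R / Om%:R) * l%:R = 8 * (l%:R * W%:R) / Om%:R :> R.
    by field; rewrite lt0r_neq0.
  by rewrite ler_pdivlMr //; lra.
have -> : 256 * l%:R * W%:R ^+ 2 / Om%:R ^+ 2 = 256 * (W%:R / Om%:R) * (l%:R * W%:R / Om%:R) :> R.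
  by field; rewrite lt0r_neq0.
apply: ler_piMr; first by rewrite mulr_ge0 // divr_ge0.
by rewrite ler_pdivrMr // mul1r.
Qed.

Hypothesis w_residue : exists k, forall om, w om != 0 -> (om %% kap = k)%N.
Hypothesis w_le : forall om, nsq (w om) <= 4 * kap%:R ^+ 2.

Lemma window_const_gt0 : 0 < window_const.
Proof.
rewrite ltr_pwDl // ?divr_gt0 ?ltr0n //; first by case/andP: l_bounds.
by rewrite divr_ge0 ?mulr_ge0 ?sqr_ge0.
Qed.

Lemma batch_window n :
  window_const * \sum_(om < Om | (om <= n)%N && (n < om + l)%N) nsq (w om) <= energy_const * kap%:R.
Proof.
have [k hk] := w_residue.
have OmR : 0 < Om%:R :> R by rewrite ltr0n Om_gt0.
have kR : 0 < kap%:R :> R by rewrite ltr0n.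
have h : \sum_(om < Om | (om <= n)%N && (n < om + l)%N) nsq (w om) <=
    (l %/ kap).+1%:R * (4 * kap%:R ^+ 2).
  apply: (@le_trans _ _ (\sum_(om < Om | [&& om %% kap == k, om <= n & n < om + l]%N) (4 * kap%:R ^+ 2))).
    rewrite [leLHS]big_mkcond [leRHS]big_mkcond; apply: ler_sum => om _.
    case: (boolP ((om <= n)%N && (n < om + l)%N)) => _; last by rewrite andbF.
    rewrite andbT; case: eqP => // hr.
    have [->|/hk//] := eqVneq (w om) 0; by rewrite nsq0.
  rewrite sumr_const -[_ *+ _]mulr_natl; apply: ler_wpM2r; first by rewrite mulr_ge0 ?sqr_ge0.
  by rewrite ler_nat; apply: residue_window_card.
apply: le_trans (ler_wpM2l (ltW window_const_gt0) h) _.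
apply: le_trans (ler_wpM2r _ window_const_le) _; first by rewrite !mulr_ge0 ?sqr_ge0.
have h2 : (l %/ kap).+1%:R * kap%:R * W%:R <= 2 * Om%:R :> R.
  rewrite -!natrM ler_nat mulSn.
  have h3 : (kap <= l)%N by rewrite /l leq_divRL //; nia.
  have := leq_divM l kap; have := leq_divM Om W; rewrite -/l; nia.
have -> : sampling_const * (W%:R / Om%:R) * ((l %/ kap).+1%:R * (4 * kap%:R ^+ 2)) =
   1056 * kap%:R * ((l %/ kap).+1%:R * kap%:R * W%:R) / Om%:R.
  by rewrite /sampling_const; field; rewrite lt0r_neq0.
rewrite ler_pdivrMr // /energy_const.
have -> : 2112 * kap%:R * Om%:R = 1056 * kap%:R * (2 * Om%:R) :> R by ring.
by rewrite ler_wpM2l // mulr_ge0.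
Qed.

(** Weights of size kap sit on a fraction 1 / kap of the frequencies, so their squares cost one
    factor kap compared with Parseval. *)
Lemma batch_energy m (X : 'M[C]_(m, W)) :
  \sum_om nsq (w om) * fn2 (X *m fv om) <= energy_const * kap%:R * fn2 X.
Proof.
have h n : \sum_(om < Om | (om <= n)%N && (n < om + l)%N) nsq (w om) <=
   energy_const * kap%:R / window_const.
  by rewrite ler_pdivlMr ?window_const_gt0 // mulrC batch_window.
have := plancherel_polya X W_le_Om l_bounds (fun om => nsq_ge0 (w om)) h.
by rewrite -/window_const divfK // lt0r_neq0 // window_const_gt0.
Qed.

Hypotheses (rho20 : 0 < rho2) (rho2W : rho2 <= W%:R / Om%:R).
Hypothesis hrho : forall om : 'I_Om, fn2 (adjmx V *m fv om) <= rho2.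
Hypothesis TE : T = M%:R * rho2 + r%:R * (W%:R / Om%:R).
Hypothesis hT : kap%:R * p.+1%:R * T <= a.
Hypotheses (a1 : a <= 1) (ha : chaos_const R * ((energy_const + 4 * sampling_const) * a) <= 16^-1).

Let P : R := p.+1%:R.
Let WO : R := W%:R / Om%:R.
(** [B2 s] bounds the largest term and [sig2 s] the total in the variance of the chaos when Z has
    squared size s; T dominates each combination of norms that occurs. *)
Let B2 s := 4 * sampling_const * kap%:R ^+ 2 * T ^+ 2 * s.
Let sig2 s := energy_const * kap%:R * T * s.

Lemma step_facts : [/\ 1 <= M%:R :> R, 1 <= r%:R :> R, 1 <= kap%:R :> R & 0 < WO].
Proof.
have OmR : 0 < Om%:R :> R by rewrite ltr0n Om_gt0.
by split; rewrite ?ler1n // divr_gt0 // ltr0n.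
Qed.

Lemma step_T : [/\ 0 < T, M%:R * rho2 <= T, r%:R * WO <= T, WO <= T & rho2 <= T].
Proof.
have [M1 r1 k1 WO0] := step_facts.
have h1 : 0 < M%:R * rho2 by rewrite mulr_gt0 // (lt_le_trans ltr01).
have h2 : 0 < r%:R * WO by rewrite mulr_gt0 // (lt_le_trans ltr01).
have h3 : rho2 <= M%:R * rho2 by rewrite ler_peMl // ltW.
have h4 : WO <= r%:R * WO by rewrite ler_peMl // ltW.
rewrite TE -/WO; split; lra.
Qed.

Lemma B2_gt0 s : 0 < s -> 0 < B2 s.
Proof.
have [_ _ k1 _] := step_facts; have [T0 _ _ _ _] := step_T.
by move=> s0; rewrite /B2 !mulr_gt0 ?exprn_gt0 ?ltr0n.
Qed.

Lemma sig2_ge0 s : 0 < s -> 0 <= sig2 s.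
Proof.
have [T0 _ _ _ _] := step_T.
by move=> s0; rewrite /sig2 !mulr_ge0 // ltW.
Qed.

(** kap, P and T enter only through y = kap P T <= a, once quadratically and once linearly; a <= 1
    makes both linear in a, and [ha] concludes. *)
Lemma step_threshold s : 0 < s -> chaos_const R * (P * (P * B2 s + sig2 s)) <= s / 16.
Proof.
move=> s0; have [T0 _ _ _ _] := step_T.
set y := kap%:R * P * T; have y0 : 0 <= y by rewrite !mulr_ge0 // ltW.
have -> : chaos_const R * (P * (P * B2 s + sig2 s)) =
  chaos_const R * (4 * sampling_const * y ^+ 2 + energy_const * y) * s.
  by rewrite /B2 /sig2 /y; ring.
rewrite mulrC; apply: ler_wpM2l; first exact: ltW.
have K0 : 0 <= chaos_const R by rewrite /chaos_const !mulr_ge0 ?expR_ge0.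
apply: le_trans ha; apply: ler_wpM2l => //.
have -> : (energy_const + 4 * sampling_const) * a = 4 * sampling_const * a + energy_const * a by ring.
apply: lerD; last by apply: ler_wpM2l.
apply: ler_wpM2l; first by rewrite mulr_ge0.
by rewrite expr2; apply: le_trans (ler_wpM2r y0 (le_trans hT a1)) _; rewrite mul1r.
Qed.

Lemma step_sum_ineq (x s y : R) : 0 <= s -> x <= T -> y <= energy_const * kap%:R * s ->
  0 <= x -> x * y <= sig2 s.
Proof.
move=> s0 xT ys x0; apply: le_trans (ler_wpM2l x0 ys) _.
have -> : x * (energy_const * kap%:R * s) = energy_const * kap%:R * s * x by ring.
have -> : sig2 s = energy_const * kap%:R * s * T by rewrite /sig2; ring.
by apply: ler_wpM2l; rewrite // !mulr_ge0.
Qed.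

Lemma step_max_ineq (x y z s : R) om : 0 <= x -> 0 <= y -> 0 <= s ->
  x * y <= T ^+ 2 -> z <= y * s -> x * (nsq (w om) * z) <= B2 s.
Proof.
move=> x0 y0 s0 h hz.
apply: (@le_trans _ _ (x * (4 * kap%:R ^+ 2 * (y * s)))).
  apply: ler_wpM2l => //; apply: (@le_trans _ _ (nsq (w om) * (y * s))).
    by apply: ler_wpM2l => //; apply: nsq_ge0.
  by apply: ler_wpM2r => //; rewrite mulr_ge0.
have -> : x * (4 * kap%:R ^+ 2 * (y * s)) = 4 * kap%:R ^+ 2 * s * (x * y) by ring.
apply: (@le_trans _ _ (4 * kap%:R ^+ 2 * s * T ^+ 2)).
  by apply: ler_wpM2l => //; rewrite !mulr_ge0 ?sqr_ge0.
have -> : B2 s = sampling_const * (4 * kap%:R ^+ 2 * s * T ^+ 2) by rewrite /B2; ring.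
apply: ler_peMl; last by rewrite /sampling_const ler1n.
by rewrite !(sqr_ge0, mulr_ge0).
Qed.

Lemma fn2_mul_fvec_le m (X : 'M[C]_(m, W)) om : fn2 (X *m fv om) <= WO * fn2 X.
Proof. by rewrite /WO mulrC -(fn2_fvec R W Om om) fn2M. Qed.

Lemma mul_T_le (x y : R) : 0 <= x -> 0 <= y -> x <= T -> y <= T -> x * y <= T ^+ 2.
Proof. by move=> x0 y0 xT yT; rewrite expr2; apply: ler_pM. Qed.

(** By [fn2_PT_le] a tangent part is controlled by U^* N and N V. Their variance factors are r W /
    Om and M rho2, the two summands of T. *)
Lemma step_left_tail (Z : 'M[C]_(M, W)) F : 0 < F -> fn2 Z <= F ->
  Pr R (fun d => F / 16 < fn2 (adjmx U *m noise w Z d)) <= (r * W + 1)%:R * expR (- P).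
Proof.
move=> F0 ZF; have [M1 r1 k1 WO0] := step_facts; have [T0 h1 h2 h3 h4] := step_T.
have F16 : 0 < F / 16 by rewrite divr_gt0.
have := @noise_frobenius_tail R M W Om r W (adjmx U) 1%:M w Z p (sig2 F) (B2 F) (F / 16)
  (B2_gt0 F0) (sig2_ge0 F0) _ _ F16 (step_threshold F0).
have e om : fn2 (adjmx U) * fn2 (adjmx (fv om) *m 1%:M) = r%:R * WO.
  by rewrite fn2_isom_adj // mulmx1 fn2_adj fn2_fvec.
have rW0 : 0 <= r%:R * WO by rewrite mulr_ge0 // ltW.
move=> tail; apply: le_trans (tail _ _).
- by apply: Pr_sub => d; rewrite mulmx1.
- under eq_bigr do rewrite e; rewrite -mulr_sumr; apply: step_sum_ineq => //; first exact: ltW.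
  apply: le_trans (batch_energy Z) _; apply: ler_wpM2l => //.
  by rewrite mulr_ge0 // /energy_const; lra.
move=> om; rewrite e; have WO0' := ltW WO0.
apply: (@step_max_ineq _ WO); [exact: rW0|exact: WO0'|exact: ltW|exact: mul_T_le|].
by apply: le_trans (fn2_mul_fvec_le _ _) _; apply: ler_wpM2l.
Qed.

Lemma step_right_tail (Z : 'M[C]_(M, W)) F : 0 < F -> fn2 Z <= F ->
  Pr R (fun d => F / 16 < fn2 (noise w Z d *m V)) <= (M * r + 1)%:R * expR (- P).
Proof.
move=> F0 ZF; have [M1 r1 k1 WO0] := step_facts; have [T0 h1 h2 h3 h4] := step_T.
have F16 : 0 < F / 16 by rewrite divr_gt0.
have := @noise_frobenius_tail R M W Om M r 1%:M V w Z p (sig2 F) (B2 F) (F / 16)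
  (B2_gt0 F0) (sig2_ge0 F0) _ _ F16 (step_threshold F0).
have e (om : 'I_Om) : fn2 (1%:M : 'M[C]_M) * fn2 (adjmx (fv om) *m V) <= M%:R * rho2.
  by rewrite fn2_1 fn2_fvec_swap; apply: ler_wpM2l.
have Mr0 : 0 <= M%:R * rho2 by rewrite mulr_ge0 // ltW.
have z0 (om : 'I_Om) : 0 <= nsq (w om) * fn2 (Z *m fv om).
  by rewrite mulr_ge0 ?nsq_ge0 ?fn2_ge0.
move=> tail; apply: le_trans (tail _ _).
- by apply: Pr_sub => d; rewrite mul1mx.
- apply: (@le_trans _ _ (M%:R * rho2 * \sum_om nsq (w om) * fn2 (Z *m fv om))).
    by rewrite mulr_sumr; apply: ler_sum => om _; apply: ler_wpM2r.
  apply: step_sum_ineq => //; first exact: ltW.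
  by apply: le_trans (batch_energy Z) _; apply: ler_wpM2l => //; rewrite mulr_ge0.
move=> om; apply: le_trans (ler_wpM2r (z0 om) (e om)) _; have WO0' := ltW WO0.
apply: (@step_max_ineq _ WO); [exact: Mr0|exact: WO0'|exact: ltW|exact: mul_T_le|].
by apply: le_trans (fn2_mul_fvec_le _ _) _; apply: ler_wpM2l.
Qed.

Lemma Pr_not_le (G : dT -> R) (t s u q1 q2 : R) (G1 G2 : dT -> R) :
  (forall d, G1 d <= s -> G2 d <= u -> G d <= t) ->
  Pr R (fun d => s < G1 d) <= q1 -> Pr R (fun d => u < G2 d) <= q2 ->
  Pr R (fun d => ~ G d <= t) <= q1 + q2.
Proof.
move=> h h1 h2; apply: le_trans (lerD h1 h2); apply: le_trans (Pr_or _ _ _).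
apply: Pr_sub => d hd; have [g1|g1] := leP (G1 d) s; last by left.
have [g2|g2] := leP (G2 d) u; last by right.
by case: hd; apply: h.
Qed.

Lemma quarter_sqr (F : R) : 0 < F -> (Num.sqrt F / 4) ^+ 2 = F / 16 /\
  (Num.sqrt F / 4 + Num.sqrt F / 4) ^+ 2 = F / 4.
Proof.
move=> F0; have := sqr_sqrtr (ltW F0); move: (Num.sqrt F) => s <-.
by split; field.
Qed.

(** Norms add, not squares: two pieces of norm sqrt F / 4 give sqrt F / 2, whose square is F / 4. *)
Lemma step_contraction (Z : 'M[C]_(M, W)) F : 0 < F -> fn2 Z <= F ->
  Pr R (fun d => ~ fn2 (PT U V (noise w Z d)) <= F / 4) <=
  (r * W + 1)%:R * expR (- P) + (M * r + 1)%:R * expR (- P).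
Proof.
move=> F0 ZF; apply: Pr_not_le (step_left_tail F0 ZF) (step_right_tail F0 ZF) => d.
have [e1 e2] := quarter_sqr F0; rewrite -e1 -e2.
by apply: fn2_PT_le => //; rewrite divr_ge0 // sqrtr_ge0.
Qed.

(** The uniform bound nu2 on |Z f_om|^2 is pulled out of the sum, and the batch energy is spent on
    the fixed vector h instead; this is how the maximum over frequencies reproduces itself. *)
Lemma step_vector_tail (Z : 'M[C]_(M, W)) m (B : 'M[C]_(m, M)) (b x : R) (h : 'cV[C]_W) nu2 :
  0 < nu2 -> (forall om : 'I_Om, fn2 (Z *m fv om) <= nu2) ->
  fn2 B = b -> 0 <= b -> 0 <= x -> fn2 h <= x -> b * x <= T ->
  Pr R (fun d => nu2 / 16 < fn2 (B *m (noise w Z d *m h))) <= (m * 1 + 1)%:R * expR (- P).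
Proof.
move=> n0 Zn hB b0 x0 hx bxT.
have [M1 r1 k1 WO0] := step_facts; have [T0 h1 h2 h3 h4] := step_T.
have n16 : 0 < nu2 / 16 by rewrite divr_gt0.
have := @noise_frobenius_tail R M W Om m 1 B h w Z p (sig2 nu2) (B2 nu2) (nu2 / 16)
  (B2_gt0 n0) (sig2_ge0 n0) _ _ n16 (step_threshold n0).
rewrite hB => tail; apply: le_trans (tail _ _).
- by apply: Pr_sub => d; rewrite mulmxA.
- apply: (@le_trans _ _ (b * (nu2 * \sum_om nsq (w om) * fn2 (adjmx h *m fv om)))).
    rewrite mulr_sumr mulr_sumr; apply: ler_sum => om _; rewrite -mulrA fn2_fvec_swap.
    apply: ler_wpM2l => //; set G := fn2 _.
    have -> : nu2 * (nsq (w om) * G) = G * (nsq (w om) * nu2) by ring.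
    apply: ler_wpM2l; first exact: fn2_ge0.
    by apply: ler_wpM2l; rewrite ?nsq_ge0.
  apply: (@le_trans _ _ (b * (nu2 * (energy_const * kap%:R * x)))).
    apply: ler_wpM2l => //; apply: ler_wpM2l; first exact: ltW.
    apply: le_trans (batch_energy _) _; rewrite fn2_adj; apply: ler_wpM2l => //.
    by rewrite mulr_ge0.
  have -> : b * (nu2 * (energy_const * kap%:R * x)) = b * x * (energy_const * kap%:R * nu2) by ring.
  by apply: step_sum_ineq; rewrite // ?mulr_ge0 // ltW.
move=> om; apply: (@le_trans _ _ (b * x * WO * (nsq (w om) * fn2 (Z *m fv om)))).
  apply: ler_wpM2r; first by rewrite mulr_ge0 ?nsq_ge0 ?fn2_ge0.
  rewrite -mulrA; apply: ler_wpM2l => //; rewrite fn2_fvec_swap.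
  apply: le_trans (fn2_mul_fvec_le _ _) _; rewrite fn2_adj mulrC.
  by apply: ler_wpM2r => //; apply: ltW.
have bx0 : 0 <= b * x by rewrite mulr_ge0.
have WO0' := ltW WO0.
apply: (@step_max_ineq _ 1); [exact: mulr_ge0|exact: ler01|exact: ltW| |].
  by rewrite mulr1; apply: mul_T_le.
by rewrite mul1r.
Qed.

(** [PTE] splits the vector into U U^* N f and the complement of U applied to N V V^* f. The first
    has b x = r W / Om; the second has b x = M rho2, because |V V^* f|^2 <= rho2. *)
Lemma step_coherence (Z : 'M[C]_(M, W)) nu2 :
  0 < nu2 -> (forall om : 'I_Om, fn2 (Z *m fv om) <= nu2) ->
  Pr R (fun d => exists om : 'I_Om, ~ fn2 (PT U V (noise w Z d) *m fv om) <= nu2 / 4) <=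
  Om%:R * ((r * 1 + 1)%:R * expR (- P) + (M * 1 + 1)%:R * expR (- P)).
Proof.
move=> n0 Zn; rewrite -[X in X%:R * _]card_ord; apply: Pr_exists => om.
have [M1 r1 k1 WO0] := step_facts; have [T0 h1 h2 h3 h4] := step_T.
have t1 := @step_vector_tail Z r (adjmx U) r%:R WO (fv om) nu2 n0 Zn (fn2_isom_adj hU) _ _ _ h2.
have hx : fn2 (V *m (adjmx V *m fv om)) <= rho2 by rewrite fn2_isom.
have t2 := @step_vector_tail Z M 1%:M M%:R rho2 _ nu2 n0 Zn (fn2_1 M) _ _ hx h1.
have fW : fn2 (fv om) <= WO by rewrite fn2_fvec.
apply: Pr_not_le (t1 (ler0n _ _) (ltW WO0) fW) (t2 (ler0n _ _) (ltW rho20)) => d.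
have [e1 e2] := quarter_sqr n0; rewrite -e1 -e2 mul1mx => g1 g2.
have q0 : 0 <= Num.sqrt nu2 / 4 by rewrite divr_ge0 // sqrtr_ge0.
rewrite PTE mulmxDl; apply: (fn2_triangle q0 q0).
  by rewrite -!mulmxA fn2_isom.
rewrite -!mulmxA; apply: le_trans (opb_mul _ (opb_compl hU)) _.
by rewrite mul1r.
Qed.

Lemma step_operator (Z : 'M[C]_(M, W)) s : 0 < s -> fn2 Z <= r%:R * s ->
  (forall om : 'I_Om, fn2 (Z *m fv om) <= rho2 * s) ->
  Pr R (fun d => exists y : 'cV_W, s / 16 * fn2 y < fn2 (noise w Z d *m y)) <=
  ((M + W) * (Om + Om).+1)%:R * expR (- P).
Proof.
move=> s0 ZF Zn; have [M1 r1 k1 WO0] := step_facts; have [T0 h1 h2 h3 h4] := step_T.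
have s16 : 0 < s / 16 by rewrite divr_gt0.
have WO0' := ltW WO0; have s0' := ltW s0; have rho0' := ltW rho20.
have pp0 := ltW window_const_gt0.
have Mp : 0 <= M%:R * window_const by rewrite mulr_ge0.
apply: (@noise_operator_tail R M W Om l w Z p (sig2 s) (B2 s) (s / 16) window_const) => //.
- exact: W_le_Om.
- exact: l_bounds.
- exact: B2_gt0.
- exact: sig2_ge0.
- rewrite -/WO; apply: (@le_trans _ _ (WO * (energy_const * kap%:R * (r%:R * s)))).
    apply: ler_wpM2l => //; apply: le_trans (batch_energy Z) _.
    by apply: ler_wpM2l => //; rewrite mulr_ge0.
  have -> : WO * (energy_const * kap%:R * (r%:R * s)) = r%:R * WO * (energy_const * kap%:R * s) by ring.
  by apply: step_sum_ineq; rewrite // mulr_ge0.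
- move=> n; apply: (@le_trans _ _ (M%:R * rho2 * (energy_const * kap%:R * s))); last first.
    by apply: step_sum_ineq; rewrite // mulr_ge0.
  apply: (@le_trans _ _ (M%:R * window_const * (\sum_(om < Om | (om <= n)%N && (n < om + l)%N)
     nsq (w om) * (rho2 * s)))).
    apply: ler_wpM2l => //; apply: ler_sum => om _; apply: ler_wpM2l => //; exact: nsq_ge0.
  rewrite -mulr_suml.
  set S := \sum_(om < Om | _) _.
  have -> : M%:R * window_const * (S * (rho2 * s)) = M%:R * rho2 * s * (window_const * S) by ring.
  have -> : M%:R * rho2 * (energy_const * kap%:R * s) = M%:R * rho2 * s * (energy_const * kap%:R) by ring.
  by apply: ler_wpM2l (batch_window n); rewrite !mulr_ge0.
- move=> om; apply: (@step_max_ineq _ rho2) => //; exact: mul_T_le.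
- move=> om; apply: (@le_trans _ _ (M%:R * (sampling_const * WO) * (nsq (w om) * fn2 (Z *m fv om)))).
    apply: ler_wpM2r; first by rewrite mulr_ge0 ?nsq_ge0 ?fn2_ge0.
    by apply: ler_wpM2l => //; apply: window_const_le.
  apply: (@le_trans _ _ (M%:R * (sampling_const * WO) * (4 * kap%:R ^+ 2 * (rho2 * s)))).
    apply: ler_wpM2l; first by do 2?apply: mulr_ge0.
    apply: ler_pM => //; [exact: nsq_ge0|exact: fn2_ge0].
  have -> : M%:R * (sampling_const * WO) * (4 * kap%:R ^+ 2 * (rho2 * s)) =
     4 * sampling_const * kap%:R ^+ 2 * s * (M%:R * rho2 * WO) by ring.
  have -> : B2 s = 4 * sampling_const * kap%:R ^+ 2 * s * T ^+ 2 by rewrite /B2; ring.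
  apply: ler_wpM2l; first by rewrite !(sqr_ge0, mulr_ge0).
  by apply: mul_T_le => //; rewrite mulr_ge0.
exact: step_threshold.
Qed.
End GolfingStep.

(** * Complex inner product *)

Section ComplexInner.
Variable R : realType.
Local Notation C := R[i].

(** The full complex pairing, of which [rip] is the real part: matrix entries are recovered from
    it. *)
Definition cip m n (A B : 'M[C]_(m, n)) : C := \tr (adjmx A *m B).

Lemma nsq_cip_le m n (A B : 'M[C]_(m, n)) : nsq (cip A B) <= fn2 A * fn2 B.
Proof.
set z := cip A B; have [->|z0] := eqVneq (nsq z) 0.
  by rewrite mulr_ge0 ?fn2_ge0.
have zp : 0 < nsq z by rewrite lt_neqAle eq_sym z0 nsq_ge0.
have e : rip (z *: A) B = nsq z.
  rewrite /rip adjmxZ -scalemxAl linearZ /= -/(cip A B) -/z.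
  by rewrite -[conjc z * z]nsqE.
have := rip_CS (z *: A) B; rewrite e fn2Z expr2 -mulrA.
by rewrite ler_pM2l.
Qed.

Lemma cipDl m n (A B D : 'M[C]_(m, n)) : cip (A + B) D = cip A D + cip B D.
Proof. by rewrite /cip adjmxD mulmxDl linearD. Qed.
Lemma cipNl m n (A D : 'M[C]_(m, n)) : cip (- A) D = - cip A D.
Proof. by rewrite /cip adjmxN mulNmx linearN. Qed.
Lemma cip_suml m n I (s : seq I) (P : pred I) (F : I -> 'M[C]_(m, n)) D :
  cip (\sum_(i <- s | P i) F i) D = \sum_(i <- s | P i) cip (F i) D.
Proof.
apply: (big_morph (fun X => cip X D) (fun x y => cipDl x y D)).
by rewrite /cip adjmx0 mul0mx linear0.
Qed.

Lemma cip_PTp M W r (U : 'M[C]_(M, r)) (V : 'M[C]_(W, r)) X Y :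
  cip (PTp U V X) Y = cip X (PTp U V Y).
Proof.
rewrite /cip /PTp !adjmxM !cproj_adj -!mulmxA mxtrace_mulC.
by rewrite -!mulmxA.
Qed.

Lemma cip_delta m n i j (X : 'M[C]_(m, n)) : cip (delta_mx i j) X = X i j.
Proof.
rewrite /cip /mxtrace (bigD1 j) //= mxE (bigD1 i) //= adjmxE mxE !eqxx conjc1 mul1r.
rewrite !big1 ?addr0 // => [k kj|k ki].
  by rewrite mxE big1 // => l _; rewrite adjmxE mxE (negPf kj) andbF conjc0 mul0r.
by rewrite adjmxE mxE (negPf ki) conjc0 mul0r.
Qed.
End ComplexInner.

(** * Golfing iterates and the dual matrix they produce *)

Section GolfingScheme.
Variable R : realType.
Local Notation C := R[i].
Local Notation toC := (@toC R).
Variables (M W Om r : nat) (U : 'M[C]_(M, r)) (V : 'M[C]_(W, r)).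
Hypotheses (hU : adjmx U *m U = 1%:M) (hV : adjmx V *m V = 1%:M).
Local Notation dT := {ffun 'I_Om * 'I_M -> bool}.
Local Notation fv om := (fvec R W Om om).
Variables (kap : nat) (w : nat -> 'I_Om -> C).
Hypothesis w_residue : forall k om, (k < kap)%N -> w k om != 0 -> (om %% kap = k)%N.

Fixpoint golf (Z0 : 'M[C]_(M, W)) k (d : dT) : 'M[C]_(M, W) :=
  if k is k'.+1 then - PT U V (noise (w k') (golf Z0 k' d) d) else Z0.

Lemma noise_local k (Z : 'M[C]_(M, W)) (d d' : dT) : (k < kap)%N ->
  (forall (om : 'I_Om) m, (om %% kap = k)%N -> d (om, m) = d' (om, m)) ->
  noise (w k) Z d = noise (w k) Z d'.
Proof.
move=> kk h; apply: eq_bigr => om _.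
have z (X Y : 'M[C]_(M, W)) : 0 *: X = 0 *: Y by rewrite !scale0r.
have [->|/(w_residue kk) e] := eqVneq (w k om) 0; first exact: z.
have -> : signs R d om = signs R d' om; last by [].
by apply/matrixP => m j; rewrite !mxE h.
Qed.

Lemma golfS Z0 k d : golf Z0 k.+1 d = - PT U V (noise (w k) (golf Z0 k d) d).
Proof. by []. Qed.

(** After k stages only the signs of the residues below k have been read, so the batch of residue k
    is still fresh. *)
Lemma golf_local Z0 k (d d' : dT) : (k <= kap)%N ->
  (forall (om : 'I_Om) m, (om %% kap < k)%N -> d (om, m) = d' (om, m)) ->
  golf Z0 k d = golf Z0 k d'.
Proof.
elim: k => [|k IH] kk h; first by [].
have e : golf Z0 k d = golf Z0 k d'.
  by apply: IH => [|om m hm]; [apply: ltnW|apply: h; apply: ltnW].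
have e2 : noise (w k) (golf Z0 k d) d = noise (w k) (golf Z0 k d') d'.
  by rewrite -e; apply: noise_local => // om m e'; apply: h; rewrite e'.
exact: (congr1 (fun N => - PT U V N) e2).
Qed.

(* The batch used at stage [k] is independent of the previous ones. *)
Lemma golf_stage_Pr Z0 k (Good : 'M[C]_(M, W) -> Prop)
    (Bad : 'M[C]_(M, W) -> Prop) q : (k < kap)%N -> 0 <= q ->
  (forall Z, Good Z -> Pr R (fun d => Bad (noise (w k) Z d)) <= q) ->
  Pr R (fun d => Good (golf Z0 k d) /\ Bad (noise (w k) (golf Z0 k d) d)) <= q.
Proof.
move=> kk q0 h; pose A (om : 'I_Om * 'I_M) := (om.1 %% kap == k)%N.
apply: (Pr_resample (A := A)) => d.
have e1 (d' : dT) : golf Z0 k (mix A d d') = golf Z0 k d.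
  apply: golf_local => [|om m hm]; first exact: ltnW.
  by rewrite ffunE /A /= ltn_eqF.
have e2 (Z : 'M[C]_(M, W)) (d' : dT) : noise (w k) Z (mix A d d') = noise (w k) Z d'.
  by apply: noise_local => // om m e; rewrite ffunE /A /= e eqxx.
have [g|g] := EM (Good (golf Z0 k d)).
  by apply: le_trans (h _ g); apply: Pr_sub => d'; rewrite e1 e2 => -[].
rewrite -[X in X <= _](_ : Pr R (fun _ : dT => False) = _).
  by rewrite /Pr asboolF // Ex_cst.
by apply: eq_Ex => d'; rewrite e1; congr (nat_of_bool _)%:R; apply: asbool_equiv_eq; split => // -[].
Qed.

(** Each summand is a whole batch, mean plus noise, hence measured. Its tangent part telescopes,
    since minus the projected noise is the next iterate. *)
Definition golf_dual Z0 (d : dT) : 'M[C]_(M, W) :=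
  \sum_(k < kap) (golf Z0 k d + noise (w k) (golf Z0 k d) d).

Lemma golf_tangent Z0 k d : PTp U V Z0 = 0 -> PTp U V (golf Z0 k d) = 0.
Proof. by case: k => [//|k] h; rewrite golfS PTpN PTpPT // oppr0. Qed.

Lemma golf_dual_PT Z0 d : PTp U V Z0 = 0 ->
  PT U V (golf_dual Z0 d) = Z0 - golf Z0 kap d.
Proof.
move=> h0; rewrite /golf_dual; elim: kap => [|k IH]; first by rewrite big_ord0 /PT PTp0 !subrr.
rewrite big_ord_recr PTD IH PTD (PT_id (golf_tangent k d h0)) golfS opprK.
by rewrite addrA addrNK.
Qed.

Lemma golf_dual_PTp Z0 d : PTp U V Z0 = 0 ->
  PTp U V (golf_dual Z0 d) = \sum_(k < kap) PTp U V (noise (w k) (golf Z0 k d) d).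
Proof.
move=> h0; rewrite PTp_sum; apply: eq_bigr => k _.
by rewrite PTpD golf_tangent // add0r.
Qed.

Hypothesis w_exact : forall k, (k < kap)%N ->
  \sum_om w k om *: (fv om *m adjmx (fv om)) = 1%:M.

Lemma measured_batch k (Z : 'M[C]_(M, W)) (d : dT) : (k < kap)%N -> Z + noise (w k) Z d =
  \sum_om w k om *: (signs R d om *m (adjmx (signs R d om) *m (Z *m fv om)) *m adjmx (fv om)).
Proof.
move=> kk; rewrite -{1}[Z]mulmx1 -(w_exact kk) mulmx_sumr /noise -big_split /=.
apply: eq_bigr => om _; rewrite -scalemxAr -scalerDr; congr (_ *: _).
by rewrite !mulmxA -mulmxDl !mulmxBl mul1mx addrC subrK.
Qed.

Lemma AmeasE (d : dT) (X : 'M[C]_(M, W)) (om : 'I_Om) :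
  adjmx (signs R d om) *m X *m fv om = (Ameas d X om ord0)%:M.
Proof.
apply/matrixP => i j; rewrite !ord1 mxE [RHS]mxE eqxx mulr1n.
under eq_bigr do rewrite mxE mulr_suml.
rewrite exchange_big mxE; apply: eq_bigr => m _; apply: eq_bigr => k _.
rewrite adjmxE [signs _ _ _ _ _]mxE fcolE.
have -> : conjc (toC (sgnR R (d (om, m)))) = sgnC R (d (om, m)) by rewrite conjc_real -sgnRC.
by rewrite -mulrA mulrC.
Qed.

Lemma golf_dual_range Z0 (d : dT) (H : 'M[C]_(M, W)) :
  Ameas d H = 0 -> cip (golf_dual Z0 d) H = 0.
Proof.
move=> hH; rewrite cip_suml big1 // => k _; rewrite measured_batch // cip_suml big1 // => om _.
have h0 : adjmx (signs R d om) *m H *m fv om = 0.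
  by rewrite AmeasE hH mxE; apply/matrixP => i j; rewrite !mxE mul0rn.
rewrite /cip adjmxZ -scalemxAl linearZ /= !adjmxM adjmxK -!mulmxA mxtrace_mulC.
by rewrite -!mulmxA (mulmxA _ H) h0 !mulmx0 linear0 mulr0.
Qed.

Hypothesis w_le : forall k om, (k < kap)%N -> nsq (w k om) <= 4 * kap%:R ^+ 2.
Hypothesis Om0 : (0 < Om)%N.

Lemma fn2_signs (d : dT) (om : 'I_Om) : fn2 (signs R d om) = M%:R.
Proof.
rewrite fn2_col; under eq_bigr do rewrite mxE nsq_toC sgnR_sqr.
by rewrite sumr_const card_ord.
Qed.

(** A deterministic bound from |d|^2 = M and |f_om|^2 = W / Om, meant for estimates that tolerate
    polynomial losses. *)
Lemma fn2_measured_batch k (Z : 'M[C]_(M, W)) (d : dT) x : (k < kap)%N -> 0 <= x -> fn2 Z <= x ^+ 2 ->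
  fn2 (Z + noise (w k) Z d) <= (2 * kap%:R * (M * W)%:R * x) ^+ 2.
Proof.
move=> kk x0 hx; rewrite measured_batch //.
have OmR : 0 < Om%:R :> R by rewrite ltr0n.
pose y : R := 2 * kap%:R * M%:R * (W%:R / Om%:R) * x.
have y0 : 0 <= y by rewrite /y !(mulr_ge0, invr_ge0).
have -> : 2 * kap%:R * (M * W)%:R * x = \sum_(om < Om) y.
  rewrite sumr_const card_ord -[_ *+ _]mulr_natr natrM /y; field.
  by rewrite lt0r_neq0.
apply: fn2_sum_triangle => // om; rewrite fn2Z.
apply: (@le_trans _ _ (4 * kap%:R ^+ 2 * (M%:R * (M%:R * (fn2 Z * (W%:R / Om%:R))) * (W%:R / Om%:R)))).
  apply: ler_pM; rewrite ?nsq_ge0 ?fn2_ge0 ?w_le //.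
  apply: le_trans (fn2M _ _) _; rewrite fn2_adj fn2_fvec; apply: ler_wpM2r.
    by rewrite divr_ge0.
  apply: le_trans (fn2M _ _) _; rewrite fn2_signs; apply: ler_wpM2l => //.
  apply: le_trans (fn2M _ _) _; rewrite fn2_adj fn2_signs; apply: ler_wpM2l => //.
  by apply: le_trans (fn2M _ _) _; rewrite fn2_fvec.
have -> : y ^+ 2 = 4 * kap%:R ^+ 2 * (M%:R * (M%:R * (x ^+ 2 * (W%:R / Om%:R))) * (W%:R / Om%:R)).
  by rewrite /y; ring.
do ?[apply: ler_wpM2l; first by rewrite !(sqr_ge0, mulr_ge0)].
by do ?[apply: ler_wpM2r; first by rewrite divr_ge0 | apply: ler_wpM2l; first by []].
Qed.

Definition half k : R := 2^-1 ^+ k.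

Lemma half_ge0 k : 0 <= half k.
Proof. by rewrite /half exprn_ge0 // invr_ge0. Qed.

Lemma sum_half n : \sum_(k < n) half k <= 2.
Proof. by apply: geom_le2; rewrite // invr_ge0. Qed.

Lemma fn2_golf_dual Z0 (d : dT) x : 0 <= x ->
  (forall k, (k <= kap)%N -> fn2 (golf Z0 k d) <= (x * half k) ^+ 2) ->
  fn2 (golf_dual Z0 d) <= (4 * kap%:R * (M * W)%:R * x) ^+ 2.
Proof.
move=> x0 h; have hh := half_ge0.
have N0 : 0 <= 2 * kap%:R * (M * W)%:R * x by rewrite !mulr_ge0.
apply: (@le_trans _ _ ((\sum_(k < kap) 2 * kap%:R * (M * W)%:R * (x * half k)) ^+ 2)).
  apply: fn2_sum_triangle => k; first by rewrite !mulr_ge0.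
  by apply: fn2_measured_batch; rewrite // ?mulr_ge0 // h // ltnW.
apply: lerXn2r; rewrite ?nnegrE.
- by apply: sumr_ge0 => k _; rewrite !mulr_ge0.
- by rewrite !mulr_ge0.
under eq_bigr do rewrite mulrA; rewrite -mulr_sumr.
by apply: le_trans (ler_wpM2l N0 (sum_half kap)) _; rewrite le_eqVlt; apply/orP; left; apply/eqP; ring.
Qed.

(** Stage k contributes norm at most half k / 4, and these norms add up to at most 1/2. *)
Lemma opb_golf_dual Z0 (d : dT) : PTp U V Z0 = 0 ->
  (forall k, (k < kap)%N -> opb (half k ^+ 2 / 16) (noise (w k) (golf Z0 k d) d)) ->
  opb (2^-1 ^+ 2) (PTp U V (golf_dual Z0 d)).
Proof.
move=> h0 h y; rewrite golf_dual_PTp // mulmx_suml.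
have hh := half_ge0.
set s := Num.sqrt (fn2 y); have s0 : 0 <= s by apply: sqrtr_ge0.
have es : fn2 y = s ^+ 2 by rewrite sqr_sqrtr ?fn2_ge0.
apply: (@le_trans _ _ ((\sum_(k < kap) half k / 4 * s) ^+ 2)).
  apply: fn2_sum_triangle => k; first by rewrite !mulr_ge0 ?half_ge0 ?invr_ge0.
  have := opb_PTp hU hV (divr_ge0 (sqr_ge0 (half k)) (ler0n R 16)) (h k (ltn_ord k)) y.
  rewrite es; move=> /le_trans; apply; rewrite le_eqVlt; apply/orP; left; apply/eqP.
  by field.
rewrite es -exprMn; apply: lerXn2r; rewrite ?nnegrE ?mulr_ge0 ?invr_ge0 //.
  by apply: sumr_ge0 => k _; rewrite !mulr_ge0 ?half_ge0 ?invr_ge0.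
rewrite -mulr_suml -mulr_suml; apply: ler_wpM2r => //.
by rewrite ler_pdivrMr //; apply: le_trans (sum_half kap) _; lra.
Qed.
End GolfingScheme.

(** * Deterministic recovery from decaying iterates *)

Section GolfingRecovery.
Variable R : realType.
Local Notation C := R[i].
Variables (M W Om r : nat) (U : 'M[C]_(M, r)) (V : 'M[C]_(W, r)).
Local Notation dT := {ffun 'I_Om * 'I_M -> bool}.
Local Notation fv om := (fvec R W Om om).
Local Notation half := (half R).
Local Notation N := ((M * W)%:R : R).
Hypotheses (hU : adjmx U *m U = 1%:M) (hV : adjmx V *m V = 1%:M).

Lemma fn2_PT_contr X : fn2 (PT U V X) <= fn2 X.
Proof.
have := fn2_ge0 (X - PT U V X).
rewrite fn2D fn2N ripNr ripC (rip_PT _ (PTpPT hU hV X)) ripE; lra.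
Qed.

Lemma cip_PT X Y : cip (PT U V X) Y = cip X (PT U V Y).
Proof.
rewrite /PT cipDl cipNl cip_PTp /cip -linearB /=; congr (\tr _).
by rewrite mulmxBr.
Qed.

(* [None] starts the dual certificate; the entries of [PT H] are controlled
   by the schemes started at the projected elementary matrices. *)
Definition golf_start (i : option ('I_M * 'I_W)) : 'M[C]_(M, W) :=
  if i is Some mj then PT U V (delta_mx mj.1 mj.2) else U *m adjmx V.

Lemma golf_start_tangent i : PTp U V (golf_start i) = 0.
Proof. by case: i => [mj|]; [exact: PTpPT|exact: PTp_UV]. Qed.

Variables (kap : nat) (w : nat -> 'I_Om -> C) (d : dT).
Hypothesis Om0 : (0 < Om)%N.
Hypothesis w_le : forall k om, (k < kap)%N -> nsq (w k om) <= 4 * kap%:R ^+ 2.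
Hypothesis w_exact : forall k, (k < kap)%N ->
  \sum_om w k om *: (fv om *m adjmx (fv om)) = 1%:M.
Local Notation golf i k := (golf U V w (golf_start i) k d).
Hypothesis golf_decay : forall i k, (k <= kap)%N -> fn2 (golf i k) <= (N * half k) ^+ 2.
Hypothesis kap_large : 16 * kap%:R * N ^+ 4 < 2 ^+ kap.

Let Y := golf_dual U V kap w.

(** The entry is <Z0, P_T H>, and Z0 is the tangent part of the dual matrix Y plus the last iterate.
    Since <Y, H> = 0, the pairing with P_T Y equals minus the pairing of Y with P_T^perp H. *)
Lemma tangent_entry_le H i j : Ameas d H = 0 ->
  nsq (PT U V H i j) <= 2 * ((4 * kap%:R * N * N) ^+ 2 * fn2 (PTp U V H))
     + 2 * ((N * half kap) ^+ 2 * fn2 (PT U V H)).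
Proof.
move=> hH; set Z0 := golf_start (Some (i, j)).
have t0 : PTp U V Z0 = 0 := golf_start_tangent (Some (i, j)).
have N0 : 0 <= N by [].
have tG : PTp U V (golf (Some (i, j)) kap) = 0 by apply: golf_tangent.
have e : PT U V H i j = - cip (Y Z0 d) (PTp U V H) + cip (golf (Some (i, j)) kap) (PT U V H).
  rewrite -cip_delta -cip_PT -[PT _ _ (delta_mx _ _)]/Z0 -cip_PTp -cip_PT.
  rewrite (PT_id tG).
  have eZ : PT U V (Y Z0 d) = Z0 - golf (Some (i, j)) kap by apply: golf_dual_PT.
  have h : cip (Y Z0 d) H = 0 by apply: golf_dual_range.
  rewrite -{1}[Z0](subrK (golf (Some (i, j)) kap)) -eZ cipDl; congr (_ + _).
  by rewrite /PT cipDl cipNl h sub0r.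
rewrite e; apply: le_trans (nsqD_le _ _) _; rewrite nsqN; apply: lerD.
  apply: ler_wpM2l => //; apply: le_trans (nsq_cip_le _ _) _; apply: ler_wpM2r; first exact: fn2_ge0.
  by apply: fn2_golf_dual => // k kk; apply: (golf_decay (Some (i, j)) kk).
apply: ler_wpM2l => //; apply: le_trans (nsq_cip_le _ _) _; apply: ler_wpM2r; first exact: fn2_ge0.
exact: golf_decay.
Qed.

Lemma half_kap : half kap = (2 ^+ kap)^-1.
Proof. by rewrite /half exprVn. Qed.

Hypothesis kap0 : (0 < kap)%N.
Hypothesis N1 : 1 <= N.

Lemma half_kap_small : kap%:R * N ^+ 4 * half kap < 16^-1.
Proof.
rewrite half_kap ltr_pdivrMr ?exprn_gt0 //.
move: kap_large; set x := kap%:R * _; rewrite -mulrA -/x => h; lra.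
Qed.

(** Summing over the M W entries leaves |P_T H|^2 on the right as well, with a coefficient that
    [kap_large] makes at most 1/2, so it is absorbed on the left. *)
Lemma tangent_part_le H : Ameas d H = 0 ->
  fn2 (PT U V H) <= (8 * kap%:R * N ^+ 3) ^+ 2 * fn2 (PTp U V H).
Proof.
move=> hH; set y := fn2 (PTp U V H); set t := fn2 (PT U V H).
have y0 : 0 <= y := fn2_ge0 _; have t0 : 0 <= t := fn2_ge0 _.
have k1 : 1 <= kap%:R :> R by rewrite ler1n.
have h : t <= N * (2 * ((4 * kap%:R * N * N) ^+ 2 * y) + 2 * ((N * half kap) ^+ 2 * t)).
  set b := 2 * _ + _; rewrite {1}/t /fn2.
  apply: (@le_trans _ _ (\sum_(i < M) \sum_(j < W) b)).
    by apply: ler_sum => i _; apply: ler_sum => j _; exact: tangent_entry_le.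
  by rewrite !sumr_const !card_ord -mulrnA -[b *+ _]mulr_natr mulrC mulnC.
have hk := half_kap_small; have hk0 := half_ge0 R kap.
have N4 : N ^+ 2 * half kap <= 16^-1.
  apply: le_trans (ltW hk); apply: ler_wpM2r => //.
  apply: (@le_trans _ _ (1 * N ^+ 4)); last by apply: ler_wpM2r; rewrite ?exprn_ge0.
  by rewrite mul1r ler_weXn2l.
have N3 : N ^+ 3 * half kap ^+ 2 <= 4^-1.
  apply: (@le_trans _ _ ((N ^+ 2 * half kap) ^+ 2)).
    have -> : (N ^+ 2 * half kap) ^+ 2 = N ^+ 4 * half kap ^+ 2 by ring.
    apply: ler_wpM2r; first exact: sqr_ge0.
    by rewrite ler_weXn2l.
  have : 0 <= N ^+ 2 * half kap by apply: mulr_ge0 => //; apply: sqr_ge0.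
  move: N4; move: (_ * half kap) => q; nra.
have h2 := ler_wpM2r t0 N3.
have e1 : N * (2 * ((N * half kap) ^+ 2 * t)) = 2 * (N ^+ 3 * half kap ^+ 2 * t) by ring.
have e2 : N * (2 * ((4 * kap%:R * N * N) ^+ 2 * y)) = 32 * kap%:R ^+ 2 * N ^+ 5 * y by ring.
have h3 : t <= 64 * kap%:R ^+ 2 * N ^+ 5 * y.
  move: h; rewrite mulrDr e1 e2; move: h2; set q := _ ^+ 3 * _ * t.
  set z := _ * y; have -> : 64 * kap%:R ^+ 2 * N ^+ 5 * y = 2 * z by rewrite /z; ring.
  by move=> *; lra.
apply: le_trans h3 _; apply: ler_wpM2r => //.
have -> : (8 * kap%:R * N ^+ 3) ^+ 2 = 64 * kap%:R ^+ 2 * N ^+ 6 by ring.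
by apply: ler_wpM2l; [rewrite mulr_ge0 ?sqr_ge0|rewrite ler_weXn2l].
Qed.

Hypothesis noise_decay : forall k, (k < kap)%N ->
  opb (half k ^+ 2 / 16) (noise (w k) (golf None k) d).

Lemma AmeasB (A B : 'M[C]_(M, W)) : Ameas d (A - B) = Ameas d A - Ameas d B.
Proof.
have e m n (A' B' : 'M[C]_(m, n)) i j : (A' - B') i j = A' i j - B' i j by rewrite !mxE.
apply/matrixP => om j; rewrite e !mxE -sumrB; apply: eq_bigr => m _; rewrite -sumrB.
by apply: eq_bigr => k _; rewrite e !mulrBl.
Qed.

Lemma golfing_recovery (C0 X : 'M[C]_(M, W)) s : is_svd C0 U s V ->
  Ameas d X = Ameas d C0 -> X <> C0 -> nucnorm C0 < nucnorm X.
Proof.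
move=> hsvd hX neq; pose H := X - C0.
have hH : Ameas d H = 0 by rewrite AmeasB hX subrr.
have t0 := golf_start_tangent None.
have N0 : 0 <= N by []; have hk0 := half_ge0 R kap.
apply: (@certificate_nucnorm_lt _ _ _ _ C0 X (Y (golf_start None) d) U s V
  (N * half kap) (8 * kap%:R * N ^+ 3)) => //.
- have h : cip (Y (golf_start None) d) H = 0 by apply: golf_dual_range.
  exact: (congr1 (@complex.Re R) h).
- exact: mulr_ge0.
- by rewrite !mulr_ge0 ?exprn_ge0.
- by rewrite /Y golf_dual_PT // opprB addrC subrK; apply: golf_decay.
- exact: opb_golf_dual.
- exact: tangent_part_le.
(* The product of the final residue with the bound of [tangent_part_le] must stay below 1/2; this
   dictates the condition 16 kap N^4 < 2^kap. *)
have -> : N * half kap * (8 * kap%:R * N ^+ 3) = 8 * (kap%:R * N ^+ 4 * half kap) by ring.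
have := half_kap_small; lra.
Qed.
End GolfingRecovery.

(** * Probability that some golfing stage fails *)

Section GolfingProbability.
Variable R : realType.
Local Notation C := R[i].
Variables (M W Om r : nat) (U : 'M[C]_(M, r)) (V : 'M[C]_(W, r)).
Local Notation dT := {ffun 'I_Om * 'I_M -> bool}.
Local Notation fv om := (fvec R W Om om).
Local Notation half := (half R).
Local Notation N := ((M * W)%:R : R).
Hypotheses (hU : adjmx U *m U = 1%:M) (hV : adjmx V *m V = 1%:M).
Variables (kap p : nat) (w : nat -> 'I_Om -> C) (rho2 T a : R).
Hypotheses (M0 : (0 < M)%N) (W0 : (0 < W)%N) (r0 : (0 < r)%N) (kap0 : (0 < kap)%N).
Hypothesis hO : (4 * (W * kap) <= Om)%N.
Hypothesis w_residue : forall k om, (k < kap)%N -> w k om != 0 -> (om %% kap = k)%N.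
Hypothesis w_le : forall k om, (k < kap)%N -> nsq (w k om) <= 4 * kap%:R ^+ 2.
Hypotheses (rho20 : 0 < rho2) (rho2W : rho2 <= W%:R / Om%:R).
Hypothesis hrho : forall om : 'I_Om, fn2 (adjmx V *m fv om) <= rho2.
Hypothesis TE : T = M%:R * rho2 + r%:R * (W%:R / Om%:R).
Hypothesis hT : kap%:R * p.+1%:R * T <= a.
Hypotheses (a1 : a <= 1) (ha : chaos_const R * ((energy_const R + 4 * sampling_const R) * a) <= 16^-1).
Let e : R := expR (- p.+1%:R).
Local Notation golf i k d := (golf U V w (golf_start U V i) k d).

(** The failure events are phrased as a good iterate followed by a bad step. Each is then unlikely
    on its own, without conditioning on earlier success, and when none occurs the decay follows by
    induction on k. *)
Definition contraction_fails k i (d : dT) :=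
  fn2 (golf i k d) <= r%:R * half k ^+ 2 /\
  ~ fn2 (PT U V (noise (w k) (golf i k d) d)) <= r%:R * half k ^+ 2 / 4.

Definition coherence_fails k (d : dT) :=
  (forall om : 'I_Om, fn2 (golf None k d *m fv om) <= rho2 * half k ^+ 2) /\
  exists om : 'I_Om,
    ~ fn2 (PT U V (noise (w k) (golf None k d) d) *m fv om) <= rho2 * half k ^+ 2 / 4.

Definition operator_fails k (d : dT) :=
  (fn2 (golf None k d) <= r%:R * half k ^+ 2 /\
   forall om : 'I_Om, fn2 (golf None k d *m fv om) <= rho2 * half k ^+ 2) /\
  exists y : 'cV[C]_W, half k ^+ 2 / 16 * fn2 y < fn2 (noise (w k) (golf None k d) d *m y).

Lemma half_gt0 k : 0 < half k.
Proof. by rewrite exprn_gt0 // invr_gt0. Qed.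

Lemma half_sqrS k : half k.+1 ^+ 2 = half k ^+ 2 / 4.
Proof. by rewrite /half (exprS _ k); field. Qed.

Let q1 := (r * W + 1)%:R * e + (M * r + 1)%:R * e.
Let q2 := Om%:R * ((r * 1 + 1)%:R * e + (M * 1 + 1)%:R * e).
Let q3 := ((M + W) * (Om + Om).+1)%:R * e.

Let e0 : 0 <= e. Proof. exact: expR_ge0. Qed.

Lemma contraction_fails_Pr k i : (k < kap)%N -> Pr R (contraction_fails k i) <= q1.
Proof.
move=> kk; have rR : 0 < r%:R :> R by rewrite ltr0n.
have F0 : 0 < r%:R * half k ^+ 2 by rewrite mulr_gt0 // exprn_gt0 // half_gt0.
apply: (golf_stage_Pr U V w_residue _ (Good := fun Z => fn2 Z <= r%:R * half k ^+ 2)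
  (Bad := fun B => ~ fn2 (PT U V B) <= r%:R * half k ^+ 2 / 4)) => //.
  by rewrite addr_ge0 // mulr_ge0.
move=> Z hZ; apply: (step_contraction hU hV (kap := kap) (rho2 := rho2) (T := T) (a := a)) => //.
  by exists k => om; apply: w_residue.
by move=> om; apply: w_le.
Qed.

Lemma coherence_fails_Pr k : (k < kap)%N -> Pr R (coherence_fails k) <= q2.
Proof.
move=> kk; have F0 : 0 < rho2 * half k ^+ 2 by rewrite mulr_gt0 // exprn_gt0 // half_gt0.
apply: (golf_stage_Pr U V w_residue _
  (Good := fun Z => forall om : 'I_Om, fn2 (Z *m fv om) <= rho2 * half k ^+ 2)
  (Bad := fun B => exists om : 'I_Om, ~ fn2 (PT U V B *m fv om) <= rho2 * half k ^+ 2 / 4)) => //.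
  by rewrite mulr_ge0 // addr_ge0 // mulr_ge0.
move=> Z hZ; apply: (step_coherence hU hV (kap := kap) (rho2 := rho2) (T := T) (a := a)) => //.
  by exists k => om; apply: w_residue.
by move=> om; apply: w_le.
Qed.

Lemma operator_fails_Pr k : (k < kap)%N -> Pr R (operator_fails k) <= q3.
Proof.
move=> kk; have F0 : 0 < half k ^+ 2 by rewrite exprn_gt0 // half_gt0.
apply: (golf_stage_Pr U V w_residue _
  (Good := fun Z => fn2 Z <= r%:R * half k ^+ 2 /\
      forall om : 'I_Om, fn2 (Z *m fv om) <= rho2 * half k ^+ 2)
  (Bad := fun B => exists y : 'cV[C]_W, half k ^+ 2 / 16 * fn2 y < fn2 (B *m y))) => //.
  by rewrite mulr_ge0.
move=> Z [hZ hZ']; apply: (step_operator (kap := kap) (r := r) (rho2 := rho2) (T := T) (a := a)) => //.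
  by exists k => om; apply: w_residue.
by move=> om; apply: w_le.
Qed.

Definition golfing_fails (d : dT) :=
  (exists k : 'I_kap, exists i, contraction_fails k i d) \/
  (exists k : 'I_kap, coherence_fails k d \/ operator_fails k d).

Lemma golf_decay d : ~ golfing_fails d ->
  forall i k, (k <= kap)%N -> fn2 (golf i k d) <= r%:R * half k ^+ 2.
Proof.
move=> nf i; elim=> [_|k IH kk].
  rewrite /half expr0 expr1n mulr1; case: i => [mj|].
    apply: le_trans (fn2_PT_contr hU hV _) _; rewrite -ripE /rip -/(cip _ _) cip_delta.
    by rewrite mxE !eqxx ler1n.
  by rewrite [golf _ _ _]/= fn2_isom // fn2_isom_adj.
rewrite golfS fn2N.
have -> : r%:R * half k.+1 ^+ 2 = r%:R * half k ^+ 2 / 4 by rewrite half_sqrS mulrA.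
apply: contrapT => h; apply: nf; left; exists (Ordinal kk), i; split => //.
by apply: IH; apply: ltnW.
Qed.

Lemma golf_coherence_decay d : ~ golfing_fails d ->
  forall k, (k <= kap)%N -> forall om : 'I_Om,
  fn2 (golf None k d *m fv om) <= rho2 * half k ^+ 2.
Proof.
move=> nf; elim=> [_ om|k IH kk om].
  by rewrite /half expr0 expr1n mulr1 [golf _ _ _]/= -mulmxA fn2_isom.
rewrite golfS mulNmx fn2N.
have -> : rho2 * half k.+1 ^+ 2 = rho2 * half k ^+ 2 / 4 by rewrite half_sqrS mulrA.
apply: contrapT => h; apply: nf; right; exists (Ordinal kk); left; split; last by exists om.
by apply: IH; apply: ltnW.
Qed.

Lemma golf_noise_decay d : ~ golfing_fails d ->
  forall k, (k < kap)%N -> opb (half k ^+ 2 / 16) (noise (w k) (golf None k d) d).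
Proof.
move=> nf k kk y; rewrite leNgt; apply/negP => h; apply: (nf); right; exists (Ordinal kk); right.
split; last by exists y.
by split; [exact: (golf_decay nf _ (ltnW kk))|exact: (golf_coherence_decay nf (ltnW kk))].
Qed.

Lemma golfing_fails_Pr : Pr R golfing_fails <= 18 * kap%:R * N ^+ 2 * Om%:R * e.
Proof.
have rM := isom_rank hU; have rW := isom_rank hV.
have Om0 : (0 < Om)%N by apply: leq_trans hO; rewrite !muln_gt0 W0 kap0.
have N0 : (0 < M * W)%N by rewrite muln_gt0 M0.
apply: le_trans (Pr_or _ _ _) _.
apply: (@le_trans _ _ (kap%:R * ((M * W).+1%:R * q1) + kap%:R * (q2 + q3))).
  apply: lerD; rewrite -[X in X%:R * _]card_ord; apply: Pr_exists => k.
    rewrite -[X in X.+1%:R]/(M * W)%N.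
    have -> : (M * W).+1 = #|{: option ('I_M * 'I_W)}|.
      by rewrite card_option card_prod !card_ord.
    by apply: Pr_exists => i; apply: contraction_fails_Pr.
  apply: le_trans (Pr_or _ _ _) _.
  by apply: lerD; [apply: coherence_fails_Pr|apply: operator_fails_Pr].
pose n := (M * W)%N.
pose c := (n.+1 * (r * W + 1 + (M * r + 1)) + (Om * (r * 1 + 1 + (M * 1 + 1)) +
  (M + W) * (Om + Om).+1))%N.
have -> : kap%:R * ((M * W).+1%:R * q1) + kap%:R * (q2 + q3) = kap%:R * c%:R * e.
  by rewrite /q1 /q2 /q3 /c !natrD !natrM !natrD !natrM; ring.
have -> : 18 * kap%:R * N ^+ 2 * Om%:R * e = kap%:R * (18 * n ^ 2 * Om)%N%:R * e.
  by rewrite /n !natrM; ring.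
apply: ler_wpM2r => //; apply: ler_wpM2l => //; rewrite ler_nat.
have hM : (M <= n)%N by rewrite leq_pmulr.
have hW : (W <= n)%N by rewrite leq_pmull.
have hrW : (r * W <= n)%N by rewrite leq_mul2r rM orbT.
have hMr : (M * r <= n)%N by rewrite leq_mul2l rW orbT.
have hr : (r <= n)%N by apply: leq_trans rM hM.
(* The three counts are at most 8 n^2, 4 n Om and 6 n Om, all in units dominated by n^2 Om; hence 18
   = 8 + 4 + 6. *)
have b1 : (n.+1 * (r * W + 1 + (M * r + 1)) <= 2 * n * (4 * n))%N.
  by apply: leq_mul; lia.
have b2 : (Om * (r * 1 + 1 + (M * 1 + 1)) <= Om * (4 * n))%N.
  by rewrite leq_mul2l; apply/orP; right; lia.
have b3 : ((M + W) * (Om + Om).+1 <= 2 * n * (3 * Om))%N by apply: leq_mul; lia.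
have b4 : (n * n <= n ^ 2 * Om)%N by rewrite -mulnn leq_pmulr.
have b5 : (n * Om <= n ^ 2 * Om)%N by rewrite leq_mul2r -mulnn leq_pmulr ?orbT.
have e1 : (2 * n * (4 * n) = 8 * (n * n))%N by rewrite mulnACA.
have e2 : (Om * (4 * n) = 4 * (n * Om))%N by rewrite mulnCA mulnA (mulnC n) mulnA.
have e3 : (2 * n * (3 * Om) = 6 * (n * Om))%N by rewrite mulnACA.
rewrite e1 in b1; rewrite e2 in b2; rewrite e3 in b3; rewrite /c -mulnA.
move: b1 b2 b3 b4 b5; move: (n * n)%N (n * Om)%N (n ^ 2 * Om)%N => y1 y2 y3.
move: (n.+1 * _)%N (Om * _)%N ((M + W) * _)%N => x1 x2 x3; clear; lia.
Qed.
End GolfingProbability.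

(** * Recovery probability and number of stages *)

Section RecoveryProbability.
Variable R : realType.
Local Notation C := R[i].

Lemma prob_Pr M Om (P : {ffun 'I_Om * 'I_M -> bool} -> Prop) : prob R P = Pr R P.
Proof.
rewrite /prob /Pr /Ex; congr (_ / _); rewrite -sum1_card natr_sum [LHS]big_mkcond.
by apply: eq_bigr => d _; rewrite !inE; case: asboolP.
Qed.

Lemma golfing_recovery_Pr M W Om r kap p (C0 : 'M[C]_(M, W)) (U : 'M[C]_(M, r)) s
    (V : 'M[C]_(W, r)) (rho2 a : R) : is_svd C0 U s V ->
  (0 < M)%N -> (0 < W)%N -> (0 < r)%N -> (0 < kap)%N -> (4 * (W * kap) <= Om)%N ->
  16 * kap%:R * (M * W)%:R ^+ 4 < 2 ^+ kap :> R ->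
  0 < rho2 -> rho2 <= W%:R / Om%:R ->
  (forall om : 'I_Om, fn2 (adjmx V *m fvec R W Om om) <= rho2) ->
  kap%:R * p.+1%:R * (M%:R * rho2 + r%:R * (W%:R / Om%:R)) <= a -> a <= 1 ->
  chaos_const R * ((energy_const R + 4 * sampling_const R) * a) <= 16^-1 ->
  1 - 18 * kap%:R * (M * W)%:R ^+ 2 * Om%:R * expR (- p.+1%:R) <=
  prob R (fun d : {ffun 'I_Om * 'I_M -> bool} => forall X : 'M[C]_(M, W),
    Ameas d X = Ameas d C0 -> X <> C0 -> nucnorm C0 < nucnorm X).
Proof.
move=> hsvd M0 W0 r0 kap0 hO hk rho0 rhoW hrho hT a1 ha.
have [hU hV _ _] := hsvd; have rM := isom_rank hU.
have Om0 : (0 < Om)%N by apply: leq_trans hO; rewrite !muln_gt0 W0 kap0.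
have N0 : (0 < M * W)%N by rewrite muln_gt0 M0.
have /choice [w hw] : forall k, exists w : 'I_Om -> C, (k < kap)%N ->
  [/\ forall om, w om != 0 -> (om %% kap = k)%N, forall om, nsq (w om) <= 4 * kap%:R ^+ 2
    & \sum_om w om *: (fvec R W Om om *m adjmx (fvec R W Om om)) = 1%:M].
  move=> k; have [kk|kk] := ltnP k kap; last by exists (fun=> 0).
  by have [w hw] := exact_weights R W0 kap0 kk hO; exists w.
have w_residue k om : (k < kap)%N -> w k om != 0 -> (om %% kap = k)%N.
  by move=> kk; have [h _ _] := hw k kk; apply: h.
have w_le k om : (k < kap)%N -> nsq (w k om) <= 4 * kap%:R ^+ 2.
  by move=> kk; have [_ h _] := hw k kk; apply: h.
have w_exact k : (k < kap)%N ->
  \sum_om w k om *: (fvec R W Om om *m adjmx (fvec R W Om om)) = 1%:M.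
  by move=> kk; have [_ _ h] := hw k kk; apply: h.
have := golfing_fails_Pr hU hV M0 W0 r0 kap0 hO w_residue w_le rho0 rhoW hrho (erefl _) hT a1 ha.
set F := golfing_fails _ _ _ _ _ => hF.
rewrite prob_Pr; apply: (@le_trans _ _ (1 - Pr R F)); first by rewrite lerD2l lerN2.
apply: Pr_compl => d nF X; apply: (golfing_recovery hU hV Om0 w_le w_exact _ hk kap0) => //.
- move=> i k kk; apply: le_trans (golf_decay hU hV r0 nF i kk) _.
  rewrite exprMn; apply: ler_wpM2r; first exact: sqr_ge0.
  rewrite -natrX ler_nat; apply: leq_trans rM _; apply: (@leq_trans (M * W)).
    by rewrite leq_pmulr.
  by rewrite -mulnn leq_pmulr.
- by rewrite ler1n.
- by move=> k kk; apply: (golf_noise_decay hU hV r0 hrho nF kk).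
- exact: hsvd.
Qed.

(** kap = 16 n with 2^n > N: of 2^kap, the factor 2^(4 n) pays for N^4 and 2^(12 n) for 16 kap = 256
    n. As N >= 2, n is at most twice the binary logarithm of N. *)
Lemma golfing_stages_exist N : (1 < N)%N ->
  exists kap, [/\ (0 < kap)%N, 16 * kap%:R * N%:R ^+ 4 < 2 ^+ kap :> R
    & kap%:R <= 32 / ln 2 * ln (N%:R : R)].
Proof.
move=> N1; pose n := (trunc_log 2 N).+1; exists (16 * n)%N.
have N0 : (0 < N)%N by apply: ltnW.
have l2 : 0 < ln 2 :> R by rewrite ln_gt0 // ltr1n.
split=> //.
  rewrite -natrX -!natrM -natrX ltr_nat.
  have h1 : (N ^ 4 <= 2 ^ (4 * n))%N.
    by rewrite mulnC expnM leq_exp2r // ltnW // trunc_log_ltn.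
  have h2 : (16 * (16 * n) < 2 ^ (12 * n))%N.
    apply: (@leq_trans (2 ^ (8 * n) * 2 ^ (4 * n))); last by rewrite -expnD -mulnDl.
    have h3 : (16 * 16 <= 2 ^ (8 * n))%N.
      by apply: (@leq_trans (2 ^ 8)); rewrite // leq_exp2l // leq_pmulr.
    have h4 : (n < 2 ^ (4 * n))%N.
      by apply: (@leq_trans (2 ^ n)); [exact: ltn_expl|rewrite leq_exp2l // leq_pmull].
    have : (16 * 16 * n.+1 <= 2 ^ (8 * n) * 2 ^ (4 * n))%N by apply: leq_mul.
    by rewrite mulnS mulnA; apply: leq_trans; rewrite -add1n leq_add2r.
  have h5 : (N ^ 4 * (16 * (16 * n)) < 2 ^ (4 * n) * 2 ^ (12 * n))%N.
    by apply: (@leq_trans (N ^ 4 * (16 * (16 * n)).+1)); rewrite ?leq_mul // ltn_pmul2l // expn_gt0 N0.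
  by rewrite mulnC; move: h5; rewrite -expnD -mulnDl.
have h : n.-1%:R * ln 2 <= ln N%:R :> R.
  rewrite mulr_natl -lnXn // -natrX ler_ln ?posrE ?ltr0n ?expn_gt0 // ler_nat.
  exact: trunc_logP.
have h' : ln 2 <= ln N%:R :> R by rewrite ler_ln ?posrE ?ltr0n // ler_nat.
rewrite -mulrA mulrC -mulrA ler_pdivlMl // natrM mulrCA.
apply: (@le_trans _ _ (16 * (2 * ln N%:R))); last lra.
apply: ler_wpM2l => //; rewrite -[n]/(n.-1.+1) -addn1 natrD; lra.
Qed.

Lemma xexp_le (x : R) : x * expR (- x) <= 2 * expR (- (x / 2)).
Proof.
have e : expR (- x) = expR (- (x / 2)) * expR (- (x / 2)) by rewrite -expRD; congr expR; field.
have h : x <= 2 * expR (x / 2) by have := expR_ge1Dx (x / 2); lra.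
rewrite e mulrA; apply: ler_wpM2r; first exact: expR_ge0.
apply: le_trans (ler_wpM2r (expR_ge0 _) h) _.
by rewrite -mulrA expRN mulfV ?gt_eqF ?expR_gt0 ?mulr1.
Qed.

End RecoveryProbability.

(** * Choice of constants *)

Section Constants.
Variable R : realType.

(** Replacing Om by 2 N kap x / a costs a factor x, absorbed by half of exp (- x). The other half is
    at most N^(- 6 beta), against the factor N^5 collected from kap and N; and 5 - 6 beta <= 1 -
    beta. *)
Lemma failure_bound (n : nat) (kap kc x a Om P beta : R) : (1 < n)%N ->
  0 < a -> 0 <= kap -> 0 <= kc -> 0 <= x -> 1 < beta ->
  kap <= kc * ln n%:R -> Om <= 2 * n%:R * kap * x / a -> x <= P + 1 ->
  12 * beta * ln n%:R <= x ->
  18 * kap * n%:R ^+ 2 * Om * expR (- P) <=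
    72 * expR 1 * kc ^+ 2 / a * powR n%:R (1 - beta).
Proof.
move=> n1 a0 k0 kc0 x0 b1 hk hOm hP hx.
have N0 : 0 < n%:R :> R by rewrite ltr0n ltnW.
set N : R := n%:R in N0 hk hOm hx *; set L := ln N in hk hx.
have eN : N = expR L by rewrite lnK // posrE.
have L0 : 0 < L by rewrite ln_gt0 // /N ltr1n.
have LN : L <= N by rewrite eN; have := expR_ge1Dx L; lra.
have e0 (y : R) : 0 <= expR y by exact: expR_ge0.
have hkN : kap <= kc * N by apply: le_trans hk _; apply: ler_wpM2l.
have h1 : expR (- P) <= expR 1 * expR (- x) by rewrite -expRD ler_expR; lra.
have N2 : 0 <= 18 * kap * N ^+ 2 by rewrite !mulr_ge0 ?sqr_ge0.
apply: (@le_trans _ _ (18 * kap * N ^+ 2 * (2 * N * kap * x / a) * (expR 1 * expR (- x)))).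
  apply: (@le_trans _ _ (18 * kap * N ^+ 2 * (2 * N * kap * x / a) * expR (- P))).
    by apply: ler_wpM2r => //; apply: ler_wpM2l.
  apply: ler_wpM2l => //; rewrite mulr_ge0 // divr_ge0 ?(ltW a0) // !mulr_ge0 // ltW.
have -> : 18 * kap * N ^+ 2 * (2 * N * kap * x / a) * (expR 1 * expR (- x)) =
  36 * expR 1 / a * (kap ^+ 2 * N ^+ 3) * (x * expR (- x)) by ring.
have c0 : 0 <= 36 * expR 1 / a by rewrite divr_ge0 ?mulr_ge0 // ltW.
apply: (@le_trans _ _ (36 * expR 1 / a * ((kc * N) ^+ 2 * N ^+ 3) * (2 * expR (- (6 * beta * L))))).
  apply: ler_pM.
  - by rewrite mulr_ge0 // mulr_ge0 ?sqr_ge0 ?exprn_ge0 ?ltW.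
  - by rewrite mulr_ge0.
  - apply: ler_wpM2l => //; apply: ler_wpM2r; first by rewrite exprn_ge0 // ltW.
    by rewrite lerXn2r ?nnegrE // (le_trans k0).
  - apply: le_trans (xexp_le x) _; apply: ler_wpM2l => //; rewrite ler_expR; lra.
have -> : 36 * expR 1 / a * ((kc * N) ^+ 2 * N ^+ 3) * (2 * expR (- (6 * beta * L))) =
  72 * expR 1 * kc ^+ 2 / a * (N ^+ 5 * expR (- (6 * beta * L))) by ring.
apply: ler_wpM2l; first by rewrite divr_ge0 ?(ltW a0) // !mulr_ge0 // sqr_ge0.
rewrite /powR gt_eqF // -/L {1}eN -expRM_natl -expRD ler_expR.
have : 0 <= (5 * beta - 4) * L by rewrite mulr_ge0 ?(ltW L0) //; lra.
by rewrite -[_ *+ _]mulr_natl; lra.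
Qed.

(** The value allowed for kap P T: small enough for one stage to contract, with + 1 in the
    denominator to keep it at most 1. *)
Definition step_size : R := (16 * (chaos_const R * (energy_const R + 4 * sampling_const R)) + 1)^-1.

Lemma step_size_spec : [/\ 0 < step_size, step_size <= 1 &
  chaos_const R * ((energy_const R + 4 * sampling_const R) * step_size) <= 16^-1].
Proof.
set X := chaos_const R * (energy_const R + 4 * sampling_const R).
have X0 : 0 < X.
  by rewrite mulr_gt0 ?mulr_gt0 ?expR_gt0 // /energy_const /sampling_const; lra.
have X1 : 0 < 16 * X + 1 by lra.
split; rewrite /step_size -/X; first by rewrite invr_gt0.
  by rewrite invf_le1 //; lra.
by rewrite mulrA -/X ler_pdivrMr //; lra.
Qed.

(** The maximum of |V^* f_om|^2 is positive because these numbers add up to r by Parseval, and at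
    most W / Om because V^* is a contraction. *)
Lemma coherence_bound M W Om r (C0 : 'M[R[i]]_(M, W)) (U : 'M[R[i]]_(M, r)) s
    (V : 'M[R[i]]_(W, r)) mu2 : is_svd C0 U s V -> (0 < r)%N -> (0 < Om)%N -> (W <= Om)%N ->
  coherence Om V <= mu2 ->
  exists rho2 : R, [/\ 0 < rho2, rho2 <= W%:R / Om%:R, rho2 <= mu2 * r%:R / Om%:R &
    forall om : 'I_Om, fn2 (adjmx V *m fvec R W Om om) <= rho2].
Proof.
move=> [hU hV _ _] r0 Om0 WO hmu; pose rho2 : R := \big[Num.max/0]_(om < Om) sqnorm (adjmx V *m fcol R W om).
have rR : 0 < r%:R :> R by rewrite ltr0n.
have OR : 0 < Om%:R :> R by rewrite ltr0n.
have hrho (om : 'I_Om) : fn2 (adjmx V *m fvec R W Om om) <= rho2.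
  rewrite -fcolE -sqnormE; exact: (le_bigmax _ (fun om : 'I_Om => sqnorm (adjmx V *m fcol R W om))).
exists rho2; split => //.
- rewrite ltNge; apply/negP => h.
  have := parseval (adjmx V) WO Om0; rewrite fn2_isom_adj // => e.
  have : r%:R <= 0 :> R by rewrite -e; apply: sumr_le0 => om _; apply: le_trans (hrho om) h.
  by rewrite leNgt rR.
- apply: bigmax_le => [|om _]; first by rewrite divr_ge0.
  rewrite sqnormE fcolE; apply: le_trans (opb_isom_adj hV _) _.
  by rewrite mul1r fn2_fvec.
by rewrite ler_pdivlMr // -ler_pdivrMr // (mulrC rho2) mulrAC.
Qed.
End Constants.

Theorem theorem1 (R : realType) :
  exists c K : R, 0 < c /\ 0 < K /\
  forall (M W Om r : nat) (C0 : 'M[R[i]]_(M, W))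
         (U : 'M[R[i]]_(M, r)) (s : 'rV[R]_r) (V : 'M[R[i]]_(W, r))
         (mu0 beta : R),
    (0 < M)%N -> odd W -> (W < Om)%N -> (0 < r)%N ->
    is_svd C0 U s V ->
    coherence Om V <= mu0 ^+ 2 ->
    1 < beta ->
    c * beta * (mu0 ^+ 2 * M%:R + W%:R) * r%:R * (ln ((M * W)%:R)) ^+ 3 <= Om%:R ->
    1 - K * powR ((M * W)%:R) (1 - beta) <=
      @prob R M Om (fun d : {ffun 'I_Om * 'I_M -> bool} =>
              forall X : 'M[R[i]]_(M, W),
                Ameas d X = Ameas d C0 -> X <> C0 -> nucnorm C0 < nucnorm X).

Proof.
pose l2 : R := ln 2; pose kc : R := 32 / l2; pose a : R := step_size R.
have l20 : 0 < l2 by rewrite ln_gt0 // ltr1n.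
have kc0 : 0 < kc by rewrite divr_gt0.
have kcE : 32 / l2 = kc by [].
clearbody kc.
have [a0 a1 ha] := step_size_spec R; rewrite -/a in a0 a1 ha.
(* Tuned for [hcL]: L >= ln 2 gives (1 + L) l2^2 <= (1 + l2) L^2, so the lower powers of the
   logarithm are absorbed by L^3. *)
pose c : R := 12 * kc * (1 + l2) / (a * l2 ^+ 2).
(* The summand 1 settles M W = 1, where the logarithm vanishes and the claimed lower bound is at
   most 0. *)
pose K : R := 1 + 72 * expR 1 * kc ^+ 2 / a.
have c0 : 0 < c.
  have l21 : 0 < 1 + l2 by lra.
  by rewrite divr_gt0 // mulr_gt0 ?exprn_gt0 // mulr_gt0.
have K1 : 0 <= 72 * expR 1 * kc ^+ 2 / a.
  apply: divr_ge0; last exact: ltW.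
  by apply: mulr_ge0; [apply: mulr_ge0; rewrite ?expR_ge0|apply: sqr_ge0].
exists c, K; split=> //; split; first by rewrite ltr_pwDl.
move=> M W Om r C0 U s V mu0 beta M0 _ WOm r0 hsvd hcoh b1 hOm.
have [hU hV _ _] := hsvd; have rM := isom_rank hU; have rW := isom_rank hV.
have W0 : (0 < W)%N := leq_trans r0 rW.
have Om0 : (0 < Om)%N := leq_ltn_trans (leq0n W) WOm.
have N0 : (0 < M * W)%N by rewrite muln_gt0 M0.
have [N1|N1] := leqP (M * W) 1.
  have -> : (M * W)%N = 1%N by apply/eqP; rewrite eqn_leq N1.
  rewrite powR1 mulr1 prob_Pr; apply: le_trans (_ : 0 <= _); last by apply: Ex_ge0.
  by rewrite /K; lra.
have [kap [kap0 hkap kapL]] := golfing_stages_exist R N1.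
have [rho2 [rho0 rhoW rhomu hrho]] := coherence_bound hsvd r0 Om0 (ltnW WOm) hcoh.
set N : R := (M * W)%:R in hOm hkap kapL *.
set L := ln N in hOm kapL; rewrite -/l2 kcE in kapL.
have Ll2 : l2 <= L by rewrite ler_ln ?posrE ?ltr0n // ler_nat.
have L0 : 0 < L := lt_le_trans l20 Ll2.
have beta0 : 0 < beta := lt_trans ltr01 b1.
have S1L : 0 < 1 + L by rewrite addr_gt0.
have OR : 0 < Om%:R :> R by rewrite ltr0n.
have kR : 0 < kap%:R :> R by rewrite ltr0n.
have MR : 1 <= M%:R :> R by rewrite ler1n.
have rR : 1 <= r%:R :> R by rewrite ler1n.
have WR : 1 <= W%:R :> R by rewrite ler1n.
pose T := M%:R * rho2 + r%:R * (W%:R / Om%:R).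
pose S := (mu0 ^+ 2 * M%:R + W%:R) * r%:R.
have hS : c * beta * S * L ^+ 3 <= Om%:R by rewrite /S mulrA.
have T0 : 0 < T.
  by rewrite ltr_pwDl ?mulr_gt0 // ?(lt_le_trans ltr01) // mulr_ge0 // divr_ge0.
have TS : T <= S / Om%:R.
  have -> : S / Om%:R = M%:R * (mu0 ^+ 2 * r%:R / Om%:R) + r%:R * (W%:R / Om%:R).
    by rewrite /S; ring.
  by rewrite lerD2r; apply: ler_wpM2l.
have WS : W%:R <= S.
  have h : 0 <= mu0 ^+ 2 * M%:R by rewrite mulr_ge0 // sqr_ge0.
  rewrite /S; nra.
(* From rho2 <= W / Om and r <= M, whatever the coherence; it bounds Om by a multiple of kap x, as
   [failure_bound] asks. *)
have TN : Om%:R <= 2 * N / T.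
  rewrite ler_pdivlMr // mulrC -ler_pdivlMr //.
  have -> : 2 * N / Om%:R = M%:R * (W%:R / Om%:R) + M%:R * (W%:R / Om%:R).
    by rewrite /N natrM; ring.
  apply: lerD; first by apply: ler_wpM2l.
  by apply: ler_wpM2r; rewrite ?divr_ge0 // ler_nat.
(* The largest real moment order compatible with kap P T <= a. *)
pose x := a / (kap%:R * T).
have x0 : 0 < x by rewrite divr_gt0 // mulr_gt0.
have hcL : 12 * (1 + L) * kc * L <= a * c * L ^+ 3.
  have l2s : 0 < l2 ^+ 2 by rewrite exprn_gt0.
  have e : a * c * L ^+ 3 * l2 ^+ 2 = 12 * kc * L * ((1 + l2) * L ^+ 2).
    by rewrite /c; field; rewrite !gt_eqF.
  rewrite -(ler_pM2r l2s) e.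
  have -> : 12 * (1 + L) * kc * L * l2 ^+ 2 = 12 * kc * L * ((1 + L) * l2 ^+ 2) by ring.
  apply: ler_wpM2l; first by rewrite ltW // !mulr_gt0.
  have h1 : l2 ^+ 2 <= L ^+ 2 by apply: lerXn2r; rewrite ?nnegrE // ltW.
  have h2 : L * l2 * l2 <= L * l2 * L by apply: ler_wpM2l => //; rewrite ltW // mulr_gt0.
  by rewrite !mulrDl !mul1r; apply: lerD => //; move: h2; rewrite !expr2; lra.
have hx : 12 * (1 + L) * beta <= x.
  rewrite ler_pdivlMr ?mulr_gt0 //.
  have b0 : 0 <= 12 * (1 + L) * beta by rewrite ltW // !mulr_gt0.
  have hkT : kap%:R * T <= kc * L * (S / Om%:R).
    by apply: ler_pM => //; apply: ltW.
  apply: le_trans (ler_wpM2l b0 hkT) _.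
  have -> : 12 * (1 + L) * beta * (kc * L * (S / Om%:R)) =
    12 * (1 + L) * kc * L * (beta * (S / Om%:R)) by ring.
  have S0 : 0 <= beta * (S / Om%:R) by rewrite mulr_ge0 ?divr_ge0 ?(ltW beta0) // (le_trans _ WS).
  apply: le_trans (ler_wpM2r S0 hcL) _.
  have -> : a * c * L ^+ 3 * (beta * (S / Om%:R)) = a * ((c * beta * S * L ^+ 3) / Om%:R) by ring.
  by rewrite -[leRHS]mulr1; apply: ler_wpM2l; [exact: ltW|rewrite ler_pdivrMr // mul1r].
have hO : (4 * (W * kap) <= Om)%N.
  rewrite -(ler_nat R) !natrM; apply: le_trans hS.
  apply: (@le_trans _ _ (12 * (1 + L) * kc * L * W%:R)).
    have h : W%:R * kap%:R <= W%:R * (kc * L) by apply: ler_wpM2l.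
    apply: (@le_trans _ _ (4 * (W%:R * (kc * L)))); first by apply: ler_wpM2l.
    have h0 : 0 <= W%:R * (kc * L) by rewrite mulr_ge0 // ltW // mulr_gt0.
    have -> : 12 * (1 + L) * kc * L * W%:R = 12 * (1 + L) * (W%:R * (kc * L)) by ring.
    by apply: ler_wpM2r => //; lra.
  apply: le_trans (ler_wpM2r (ler0n _ _) hcL) _.
  have cL0 : 0 <= c * L ^+ 3 by rewrite ltW // mulr_gt0 // exprn_gt0.
  have -> : a * c * L ^+ 3 * W%:R = c * L ^+ 3 * (a * W%:R) by ring.
  have -> : c * beta * S * L ^+ 3 = c * L ^+ 3 * (beta * S) by ring.
  apply: ler_wpM2l => //; apply: ler_pM => //; [exact: ltW|].
  by apply: le_trans a1 _; apply: ltW.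
have eb : 12 * (1 + L) * beta = 12 * beta + 12 * beta * L by ring.
have bL : 0 < beta * L by rewrite mulr_gt0.
have hLb : 12 * beta * L <= x by apply: le_trans hx; rewrite eb; lra.
have x1 : 1 <= x by apply: le_trans hx; rewrite eb -mulrA; lra.
(* The stage lemmas use order p + 1, so p = P - 1; this needs P >= 1, which [x1] provides. *)
pose P := Num.truncn x; have /andP[P1 P2] := truncn_itv (ltW x0).
have P0 : (0 < P)%N by rewrite truncn_gt0.
have eP : (P.-1.+1 = P)%N by rewrite prednK.
have hT : kap%:R * P.-1.+1%:R * T <= a.
  by rewrite eP mulrAC mulrC -ler_pdivlMr // mulr_gt0.
have := golfing_recovery_Pr hsvd M0 W0 r0 kap0 hO hkap rho0 rhoW hrho hT a1 ha.
apply: le_trans; rewrite lerD2l lerN2 eP -/N.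
apply: le_trans (failure_bound (kc := kc) (x := x) (a := a) (beta := beta) N1 _ _ _ _ _ _ _ _ _) _ => //.
- exact: ltW.
- exact: ltW.
- apply: le_trans TN _; rewrite le_eqVlt; apply/orP; left; apply/eqP; rewrite /x -/N; field.
  by rewrite !gt_eqF.
- by rewrite natr1 ltW.
by apply: ler_wpM2r; [exact: powR_ge0|rewrite lerDr ler01].
Qed.
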